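(* Let $\mathcal{E}\subset\mathbb{S}^{d-1}$ be a set of $d$ linearly independent directions with $$\min_{x\in\mathbb{S}^{d-1}}\max_{\xi\in\mathcal{E}}|\xi\cdot x|\ge\varepsilon_0>0.$$ If $G\subset\mathbb{R}^d$ is a connected and compact Lip-2 domain with parameter $L>1$, then for any $0<p\le\infty$ and $r\in\mathbb{N}$, $$w_r(G;\mathcal{E})_p\le C(p,d,r,L,\varepsilon_0)<\infty,$$ where the constant $C(p,d,r,L,\varepsilon_0)$ depends only on $p,d,r,L$ and $\varepsilon_0$.
   Context: A (nonempty) compact set $G\subset\mathbb{R}^d$ is a Lip-2 domain with parameter $L>1$ if there exists a constant $\delta>0$ such that $\operatorname{diam}(G)\le L\delta$ and each point $x\in G$ is contained in a closed ball $B_x\subset G$ of radius $\delta$. Notation. $\|\cdot\|$ is the Euclidean norm, $\mathbb{S}^{d-1}=\{x\in\mathbb{R}^d:\|x\|=1\}$, $\mathbb{N}=\{1,2,\dots\}$. For $0<p<\infty$, $L^p(\Omega)$ is the usual Lebesgue space; $L^\infty(\Omega):=C(\overline{\Omega})$ with the uniform norm. For a nonempty bounded measurable set $\Omega\subset\mathbb{R}^d$, $h\in\mathbb{R}^d\setminus\{0\}$ and $r\in\mathbb{N}$ put $\Omega_{r,h}:=\{x\in\Omega: x,x+h,\dots,x+rh\in\Omega\}$ and $\triangle_h^r f(x):=\sum_{j=0}^r(-1)^{r+j}\binom{r}{j}f(x+jh)$ for $x\in\Omega_{r,h}$. For $\xi\in\mathbb{S}^{d-1}$, $t>0$, $0<p\le\infty$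 let $\omega_\xi^r(f,t)_{L^p(\Omega)}:=\sup_{|u|\le t}\|\triangle_{u\xi}^rf\|_{L^p(\Omega_{r,u\xi})}$ (the norm over an empty set is $0$). For a nonempty $\mathcal{E}\subset\mathbb{S}^{d-1}$ let $\omega^r_{\mathcal{E}}(f;\Omega)_p:=\sup_{\xi\in\mathcal{E}}\omega^r_\xi(f,\operatorname{diam}(\Omega))_{L^p(\Omega)}$. $\Pi^d_{r-1}(\mathcal{E})$ is the set of all real continuous functions $Q$ on $\mathbb{R}^d$ such that for every fixed $x\in\mathbb{R}^d$ and $\xi\in\mathcal{E}$ the function $t\mapsto Q(x+t\xi)$ is an algebraic polynomial of degree $<r$ in $t\in\mathbb{R}$. Set $E_r(f;\mathcal{E})_{L^p(\Omega)}:=\inf\{\|f-Q\|_{L^p(\Omega)}:Q\in\Pi^d_{r-1}(\mathcal{E})\}$. The directional Whitney constant is $w_r(\Omega;\mathcal{E})_p:=\sup\{E_r(f;\mathcal{E})_{L^p(\Omega)}: f\in L^p(\Omega),\ \omega^r_{\mathcal{E}}(f;\Omega)_p\le 1\}\in[0,\infty]$. *)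

(* Defs.v *)
From HB Require Import structures.
From mathcomp Require Import all_boot all_order all_algebra.
From mathcomp Require Import all_classical all_reals all_analysis.

Set Implicit Arguments.
Unset Strict Implicit.
Unset Printing Implicit Defensive.

Import Order.TTheory GRing.Theory Num.Theory.
Import numFieldNormedType.Exports.

Local Open Scope classical_set_scope.
Local Open Scope ring_scope.

Definition rV_display : measure_display.
Proof. exact: default_measure_display. Qed.

Section measurable_rV.
Context {R : realType} (d : nat).

Definition rV_coord (i : 'I_d) (x : 'rV[R]_d) : measurableTypeR R := x ord0 i.

Let rV_set0 : g_sigma_preimage rV_coord set0.
Proof. exact: sigma_algebra0. Qed.

Let rV_setC A : g_sigma_preimage rV_coord A -> g_sigma_preimage rV_coord (~` A).
Proof. exact: sigma_algebraC. Qed.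

Let rV_bigcup (F : _^nat) : (forall i, g_sigma_preimage rV_coord (F i)) ->
  g_sigma_preimage rV_coord (\bigcup_i (F i)).
Proof. exact: sigma_algebra_bigcup. Qed.

(* The product sigma-algebra on R^d, i.e. its Borel sets, built as the library *)
(* does for n.-tuple T.                                                        *)
HB.instance Definition _ := @isMeasurable.Build rV_display
  'rV[R]_d (g_sigma_preimage rV_coord) rV_set0 rV_setC rV_bigcup.

End measurable_rV.

Section measurable_rV_lemmas.
Context {R : realType}.

Lemma measurable_rV_coord d (i : 'I_d) :
  measurable_fun [set: 'rV[R]_d] (@rV_coord R d i).
Proof.
move=> _ Y mY; rewrite setTI; apply: sub_sigma_algebra => /=.
rewrite -bigcup_seq/=; exists i => /=; first by rewrite mem_index_enum.
by exists Y => //; rewrite setTI.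
Qed.

Lemma measurable_fun_rVP d0 (T : measurableType d0) d (f : T -> 'rV[R]_d) :
  (forall i, measurable_fun [set: T] (@rV_coord R d i \o f)) ->
  measurable_fun [set: T] f.
Proof.
move=> mf _ A; rewrite setTI; move: A.
have sE : g_sigma_preimage (fun i => @rV_coord R d i \o f) =
    preimage_set_system [set: T] f (g_sigma_preimage (@rV_coord R d)).
  exact: g_sigma_preimage_comp.
move=> A mA.
have : preimage_set_system [set: T] f (g_sigma_preimage (@rV_coord R d))
    (f @^-1` A) by exists A => //; rewrite setTI.
rewrite -sE; apply: smallest_sub; first exact: sigma_algebra_measurable.
rewrite -bigcup_seq => B [i _] [C mC <-]; exact: mf.
Qed.

Definition rV_cons d (x : measurableTypeR R * 'rV[R]_d) : 'rV[R]_d.+1 :=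
  row_mx (x.1)%:M x.2.

Lemma rV_cons0 d x : @rV_cons d x ord0 ord0 = x.1.
Proof.
rewrite /rV_cons (_ : ord0 = lshift d (ord0 : 'I_1)); last exact/val_inj.
by rewrite (@row_mxEl _ _ 1) mxE eqxx mulr1n.
Qed.

Lemma rV_consS d x i : @rV_cons d x ord0 (lift ord0 i) = x.2 ord0 i.
Proof.
rewrite /rV_cons (_ : lift ord0 i = rshift 1 i); last exact/val_inj.
by rewrite (@row_mxEr _ _ 1).
Qed.

Lemma measurable_rV_cons d : measurable_fun setT (@rV_cons d).
Proof.
apply: measurable_fun_rVP => i.
case: (unliftP ord0 i) => [j|] ->.
  rewrite (_ : _ \o _ = rV_coord j \o snd).
    by apply: measurableT_comp => //; exact: measurable_rV_coord.
  by apply/funext => x; rewrite /= /rV_coord rV_consS.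
rewrite (_ : _ \o _ = fst); first exact: measurable_fst.
by apply/funext => x; rewrite /= /rV_coord rV_cons0.
Qed.

Definition rV_uncons d (v : 'rV[R]_d.+1) : measurableTypeR R * 'rV[R]_d :=
  (v ord0 ord0, \row_i v ord0 (lift ord0 i)).

Lemma rV_consK d : cancel (@rV_cons d) (@rV_uncons d).
Proof.
move=> [x v]; congr pair; first by rewrite rV_cons0.
by apply/rowP => i; rewrite mxE rV_consS.
Qed.

Lemma rV_unconsK d : cancel (@rV_uncons d) (@rV_cons d).
Proof.
move=> v; apply/rowP => i; case: (unliftP ord0 i) => [j|] ->.
  by rewrite rV_consS mxE.
by rewrite rV_cons0.
Qed.

Lemma measurable_rV_uncons d : measurable_fun setT (@rV_uncons d).
Proof.
apply/measurable_fun_pair; first exact: (@measurable_rV_coord d.+1 ord0).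
apply: measurable_fun_rVP => i.
rewrite (_ : _ \o _ = rV_coord (lift ord0 i)); first exact: measurable_rV_coord.
by apply/funext => x; rewrite /= /rV_coord mxE.
Qed.

End measurable_rV_lemmas.

Section lebesgue_rV_step.
Context {R : realType} (d : nat).
Variable mu : {sigma_finite_measure set 'rV[R]_d -> \bar R}.

Definition lebesgue_rV_step : set 'rV[R]_d.+1 -> \bar R :=
  pushforward (lebesgue_measure \x mu)%E (@rV_cons R d).

HB.instance Definition _ := Measure.copy lebesgue_rV_step
  (measure_function_pushforward__canonical__measure_function_Measure
     (lebesgue_measure \x mu)%E (@measurable_rV_cons R d)).

Let lebesgue_rV_step_sigma_finite : sigma_finite setT lebesgue_rV_step.
Proof.
have /sigma_finiteP[F [TF ndF Foo]] := sigma_finiteT (@lebesgue_measure R).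
have /sigma_finiteP[G [TG ndG Goo]] := sigma_finiteT mu.
exists (fun n => @rV_uncons R d @^-1` (F n `*` G n)).
  rewrite -preimage_bigcup (_ : \bigcup_n _ = setT) ?preimage_setT//.
  rewrite -setXTT TF TG predeqE => -[x y]; split.
    by move=> [n _ []/= ? ?]; split; exists n.
  move=> [/= [n _ Fnx] [k _ Gky]]; exists (maxn n k) => //; split.
  - by move: x Fnx; exact/subsetPset/ndF/leq_maxl.
  - by move: y Gky; exact/subsetPset/ndG/leq_maxr.
move=> n; have [mF Fn] := Foo n; have [mG Gn] := Goo n; split.
  rewrite -[X in measurable X]setTI; apply: measurable_rV_uncons => //.
  exact: measurableX.
rewrite /lebesgue_rV_step /pushforward -comp_preimage.
rewrite (_ : _ \o _ = id); last by apply/funext => x; exact: rV_consK.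
by rewrite preimage_id product_measure1E// lte_mul_pinfty// ge0_fin_numE.
Qed.

HB.instance Definition _ := Measure_isSigmaFinite.Build _ _ _
  lebesgue_rV_step lebesgue_rV_step_sigma_finite.

End lebesgue_rV_step.

Fixpoint lebesgue_rV (R : realType) (d : nat) :
    {sigma_finite_measure set 'rV[R]_d -> \bar R} :=
  if d is d'.+1 then lebesgue_rV_step (lebesgue_rV R d')
  else dirac (0 : 'rV[R]_0).

(* Characterizes lebesgue_rV: the measure of a box is its volume. *)
Lemma lebesgue_rV_box (R : realType) (d : nat) (a b : 'rV[R]_d) :
  (forall i, a ord0 i <= b ord0 i) ->
  lebesgue_rV R d
    [set x | forall i, x ord0 i \in `[a ord0 i, b ord0 i]] =
  (\prod_i (b ord0 i - a ord0 i))%:E.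
Proof.
elim: d a b => [|d IH] a b ab.
  by rewrite big_ord0 /= diracE mem_set//= => -[].
rewrite /= /lebesgue_rV_step /pushforward.
pose a' : 'rV[R]_d := \row_i a ord0 (lift ord0 i).
pose b' : 'rV[R]_d := \row_i b ord0 (lift ord0 i).
pose B := [set x : 'rV[R]_d | forall i, x ord0 i \in `[a' ord0 i, b' ord0 i]].
have mB : measurable B.
  rewrite (_ : B = \bigcap_(i in [set: 'I_d])
      (@rV_coord R d i @^-1` `[a' ord0 i, b' ord0 i]%classic)).
    apply: fin_bigcap_measurable => [|i _]; first exact: finite_finset.
    by rewrite -[X in measurable X]setTI; exact: measurable_rV_coord.
  apply/seteqP; split => x /= Bx i; first by move=> _; exact: Bx.
    exact: (Bx i Logic.I).
rewrite (_ : _ @^-1` _ = `[a ord0 ord0, b ord0 ord0]%classic `*` B).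
  rewrite product_measure1E//= lebesgue_measure_itv/= lte_fin.
  rewrite IH; last by move=> i; rewrite !mxE.
  rewrite big_ord_recl.
  under eq_bigr do rewrite !mxE.
  have := ab ord0; rewrite le_eqVlt => /orP[/eqP->|->].
    by rewrite ltxx subrr mul0r mul0e.
  by rewrite -EFinB -EFinM.
apply/seteqP; split => [[x v]/= h|[x v]/= [h1 h2] i].
  split; first by have := h ord0; rewrite rV_cons0.
  by move=> i; have := h (lift ord0 i); rewrite rV_consS !mxE.
case: (unliftP ord0 i) => [j|] ->; last by rewrite rV_cons0.
by have := h2 j; rewrite rV_consS !mxE.
Qed.

Section euclidean.
Context {R : realType} {d : nat}.
Implicit Types (x y : 'rV[R]_d) (A G : set 'rV[R]_d).

(* The norm `|x| that the library puts on 'rV[R]_d is the sup norm; it induces *)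
(* the same topology as the Euclidean norm below.                              *)
Definition dotp x y : R := \sum_i x ord0 i * y ord0 i.

Definition enorm x : R := Num.sqrt (dotp x x).

Definition unit_sphere : set 'rV[R]_d := [set x | enorm x = 1].

Definition eclosed_ball x (delta : R) : set 'rV[R]_d :=
  [set y | enorm (y - x) <= delta].

(* As a real supremum, meaningful for nonempty bounded sets only. *)
Definition diam A : R := sup [set enorm (x - y) | x in A & y in A].

Definition lip2_domain (L : R) G :=
  [/\ G !=set0, compact G &
    exists2 delta : R, 0 < delta &
      diam G <= L * delta /\
      forall x, G x -> exists2 c, eclosed_ball c delta x &
        eclosed_ball c delta `<=` G].

Definition independent_directions (E : set 'rV[R]_d) :=
  E `<=` unit_sphere /\
  exists2 s : d.-tuple 'rV[R]_d, free s & E = [set` s].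

(* min_(x in sphere) max_(xi in E) |xi . x|: for E finite and nonempty and     *)
(* d > 0 the supremum and the infimum are attained.                            *)
Definition minmax_dotp (E : set 'rV[R]_d) : R :=
  inf [set sup [set `|dotp xi x| | xi in E] | x in unit_sphere].

End euclidean.

Section whitney.
Context {R : realType} {d : nat}.
Implicit Types (f Q : 'rV[R]_d -> R) (p : \bar R) (r : nat) (t : R).
Implicit Types (A Omega E : set 'rV[R]_d) (h xi : 'rV[R]_d).

(* The L^p(A) (quasi-)norm of f for 0 < p <= +oo; for p = +oo it is the uniform *)
(* norm and not the essential supremum. It is 0 when A is empty.                *)
Definition lp_norm p A f : \bar R :=
  match p with
  | +oo%E => ereal_sup (0%E |` [set `|f x|%:E | x in A])
  | _ => Lnorm (lebesgue_rV R d) p ((EFin \o f) \_ A)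
  end.

(* L^oo(Omega) stands for C(closure Omega). *)
Definition in_Lp p Omega f : Prop :=
  match p with
  | +oo%E => {within closure Omega, continuous f}
  | _ => measurable_fun Omega f /\ (lp_norm p Omega f < +oo)%E
  end.

Definition diff_domain r h Omega : set 'rV[R]_d :=
  [set x | forall j : nat, (j <= r)%N -> Omega (x + h *+ j)].

Definition fin_diff r h f : 'rV[R]_d -> R :=
  fun x => \sum_(j < r.+1) (-1) ^+ (r + j) * 'C(r, j)%:R * f (x + h *+ j).

(* u = 0 is allowed: for r > 0 the difference with h = 0 vanishes. *)
Definition dir_modulus r xi f t p Omega : \bar R :=
  ereal_sup [set lp_norm p (diff_domain r (u *: xi) Omega)
                           (fin_diff r (u *: xi) f) | u in [set u | `|u| <= t]].

Definition dirs_modulus r E f Omega p : \bar R :=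
  ereal_sup [set dir_modulus r xi f (diam Omega) p Omega | xi in E].

(* Pi^d_(r-1)(E); size q <= r says that q has degree < r. *)
Definition dir_poly r E : set ('rV[R]_d -> R) :=
  [set Q | continuous Q /\
    forall x xi, E xi -> exists2 q : {poly R}, (size q <= r)%N &
      forall t, Q (x + t *: xi) = q.[t]].

Definition best_approx r f E p Omega : \bar R :=
  ereal_inf [set lp_norm p Omega (f \- Q) | Q in dir_poly r E].

Definition whitney_const r Omega E p : \bar R :=
  ereal_sup [set best_approx r f E p Omega | f in
    [set f | in_Lp p Omega f /\ (dirs_modulus r E f Omega p <= 1)%E]].

End whitney.

(* Main.v *)
Require Import Defs.
From mathcomp Require Import all_boot all_order all_algebra.
From mathcomp Require Import all_classical all_reals all_analysis.
From mathcomp Require Import measurable_realfun.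
From mathcomp Require Import ring lra zify.

Set Implicit Arguments.
Unset Strict Implicit.
Unset Printing Implicit Defensive.

Import Order.TTheory GRing.Theory Num.Theory.
Import numFieldNormedType.Exports.

Local Open Scope classical_set_scope.
Local Open Scope ring_scope.

(* One direction, all 0 < p <= oo at once. If all mixed r-th differences of f  *)
(* along xi are small on a slab, then by induction on r each Delta_u f is near *)
(* a polynomial of degree < r - 1 along xi. Subtract from f a discrete         *)
(* primitive of the polynomial near Delta_h f, so that Delta_h f becomes       *)
(* small; then the polynomial near Delta_u f is nearly h-periodic, hence       *)
(* nearly constant, and u |-> Delta_u f is nearly additive and nearly          *)
(* h-periodic. A Hyers-Ulam contraction makes every Delta_u f small, and       *)
(* Fubini provides a level s such that f is near f o pi_s, pi_s being the      *)
(* projection on {l = s} along xi. No integral mean is used, so p < 1 is       *)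
(* allowed. The construction preserves polynomiality along the other           *)
(* directions, and treating the directions of E one after the other gives Q    *)
(* in dir_poly r E near f on a small ball of G.                                *)
(*                                                                             *)
(* The function F = f - Q has the same differences as f. If F is small on a    *)
(* ball B of radius rho, it is small on the part of G lying in the ball of     *)
(* radius (1 + eta) rho: from such a point some xi in E, with a suitable sign, *)
(* points inward, and r steps along it land in B. Smallness thus spreads       *)
(* inside a ball and from a ball of radius delta to any other at distance      *)
(* slightly more than 2 delta between centers, and a connected G is exhausted  *)
(* by a chain whose length is bounded by a count of grid cells.                *)

(** * Translation invariance of Lebesgue measure *)

(** The argument is local-to-global, and every constant is fixed before [G] and [E] are given.
    Locally, [whitney_flow] is the inequality in one direction, resting on [second_step_small],
    [first_step_small] and [exists_good_section]. [tensor_whitney] applies it to the d directions in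
    turn and, by [sep_dir_poly], ends with a continuous polynomial [Q] near [f] on a parallelepiped
    inside one ball of radius delta; its constant ignores the shape of the box, since everything is
    expressed in coordinates adapted to [E]. Globally, f - Q still has small r-th differences, and
    [small_extend] recovers its value at a point from r values further along a line.
    [inward_direction] supplies the line, [small_ball_chain] and [small_ball_jump] carry smallness
    from ball to ball, and [small_connected] bounds the number of jumps by a count of cells that
    depends on L, d, r and eps0 only. The number eps0 enters through [directions_of], which turns
    the min-max condition into a lower bound for some inner product and an upper bound for the dual
    coordinates. *)

Section borel_rV.
Context {R : realType}.

(** The sigma-algebra is generated by the coordinates, so an open set is reached as the union of the
    countably many boxes with rational centre and radius 1/(n+1) that it contains. *)
Lemma open_measurable_rV d (O : set 'rV[R]_d) : open O -> measurable O.
Proof.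
move=> oO.
pose c (q : 'rV[rat]_d) : 'rV[R]_d := map_mx ratr q.
pose B (qn : 'rV[rat]_d * nat) := [set y : 'rV[R]_d |
  forall i, `|c qn.1 ord0 i - y ord0 i| < qn.2.+1%:R^-1].
have mB qn : measurable (B qn).
  rewrite (_ : B qn = \bigcap_(i in [set: 'I_d])
      (rV_coord i @^-1` (ball (c qn.1 ord0 i) (qn.2.+1%:R^-1) : set R))).
    apply: fin_bigcap_measurable => [|i _]; first exact: finite_finset.
    rewrite -[X in measurable X]setTI; apply: measurable_rV_coord => //.
    by apply: open_measurable; exact: ball_open.
  by apply/seteqP; split => x /= h i; [move=> _; exact: h|exact: (h i Logic.I)].
rewrite (_ : O = \bigcup_(qn in [set qn | B qn `<=` O]) B qn); last first.
  apply/seteqP; split => [x Ox|x [qn /= BO]]; last exact: BO.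
  have /nbhs_ballP[e /= e0 eO] : nbhs x O by move: oO; rewrite openE; exact.
  have [n n0] : exists n, n.+1%:R^-1 < e / 2.
    have := @near_infty_natSinv_lt R (PosNum (divr_gt0 e0 (ltr0Sn _ 1))).
    by case=> n _ /(_ n (leqnn _)) => nlt; exists n.
  have /choice[q hq] : forall i, exists q : rat,
      ratr q \in `]x ord0 i - n.+1%:R^-1, x ord0 i + n.+1%:R^-1[.
    move=> i; have /rat_in_itvoo[q qi] :
      x ord0 i - n.+1%:R^-1 < x ord0 i + n.+1%:R^-1 by rewrite ltrD2l gtrN// invr_gt0.
    by exists q.
  exists (\row_i q i, n) => /=; last first.
    by move=> i; have := hq i; rewrite /c !mxE in_itv/= ltr_distl => /andP[-> ->].
  move=> y By; apply: eO; split => // i j; rewrite (ord1 i) /ball/=.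
  have := By j; have := hq j; rewrite /c !mxE/= in_itv/= => qj yj.
  have xq : `|x ord0 j - ratr (q j)| < n.+1%:R^-1.
    by rewrite distrC ltr_distl.
  apply: (le_lt_trans (ler_distD (ratr (q j)) _ _)).
  by rewrite [ltRHS]splitr ltrD// (lt_trans _ n0).
rewrite bigcup_mkcond; apply: countable_bigcupT_measurable => // qn.
by case: ifP.
Qed.

Lemma closed_measurable_rV d (O : set 'rV[R]_d) : closed O -> measurable O.
Proof. by move/closed_openC/open_measurable_rV/measurableC; rewrite setCK. Qed.

Lemma continuous_within_measurable_rV d (D : set 'rV[R]_d) (f : 'rV[R]_d -> R) :
  measurable D -> {within D, continuous f} -> measurable_fun D f.
Proof.
move=> mD cf; apply: (measurability _ (RGenOpens.measurableE R)).
move=> _ [_ [a [b ->] <-]].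
have /open_subspaceP[V oV VE] : open ((f : subspace D -> R) @^-1` `]a, b[).
  by move/continuousP : cf; apply; exact: interval_open.
by rewrite setIC -VE; apply: measurableI => //; exact: open_measurable_rV.
Qed.

Lemma continuous_measurable_rV d (f : 'rV[R]_d -> R) :
  continuous f -> measurable_fun setT f.
Proof.
by move=> cf; apply: continuous_within_measurable_rV => //; exact: continuous_subspaceT.
Qed.

End borel_rV.

Section translation_invariance.
Context {R : realType}.

Lemma measurable_addl_rV d (v : 'rV[R]_d) :
  measurable_fun setT (fun x : 'rV[R]_d => (x + v : 'rV[R]_d)).
Proof.
apply: measurable_fun_rVP => i; rewrite (_ : _ \o _ = fun x => rV_coord i x + v ord0 i).
  by apply: measurable_funD => //; exact: measurable_rV_coord.
by apply/funext => x; rewrite /= /rV_coord mxE.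
Qed.

(** The pushforward under the translation gives half-open intervals their length, so uniqueness of
    Lebesgue measure applies. *)
Lemma lebesgue_measure_shift (t : R) (A : set (measurableTypeR R)) : measurable A ->
  lebesgue_measure ((fun x : measurableTypeR R => x + t) @^-1` A) = lebesgue_measure A.
Proof.
move=> mA.
have mt : measurable_fun setT (fun x : measurableTypeR R => (x + t : measurableTypeR R)).
  by apply: measurable_funD.
rewrite -[LHS]/(pushforward lebesgue_measure
  (fun x : measurableTypeR R => x + t : measurableTypeR R) A).
apply/esym.
pose m : {measure set (measurableTypeR R) -> \bar R} :=
  measure_function_pushforward__canonical__measure_function_Measure (@lebesgue_measure R) mt.
rewrite -[RHS]/(m A).
apply: lebesgue_measure_unique => //= _ [[a b]] _ <-.
rewrite /pushforward/= (_ : _ @^-1` _ = `]a - t, b - t]%classic).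
  rewrite !lebesgue_measure_itv/= !lte_fin ltrBlDr subrK -!EFinB.
  by rewrite (_ : b - t - (a - t) = b - a)//; ring.
by apply/seteqP; split => x /=; rewrite !in_itv/= ltrBlDr lerBrDr.
Qed.

Lemma ge0_integral_shift (t : R) (f : measurableTypeR R -> \bar R) :
  measurable_fun setT f -> (forall x, 0 <= f x)%E ->
  (\int[lebesgue_measure]_x f (x + t)%R = \int[lebesgue_measure]_x f x)%E.
Proof.
move=> mf f0.
have mt : measurable_fun setT (fun x : measurableTypeR R => (x + t : measurableTypeR R)).
  by apply: measurable_funD.
have := @ge0_integral_pushforward _ _ _ _ R _ mt lebesgue_measure setT f measurableT mf.
rewrite preimage_setT /= => <- //.
apply: eq_measure_integral => A mA _; exact: lebesgue_measure_shift.
Qed.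

(** The first coordinate is sliced off: inside each section the tail is moved by induction, then the
    sections are moved by the one-dimensional invariance. *)
Lemma lebesgue_rV_shift d (v : 'rV[R]_d) (A : set 'rV[R]_d) : measurable A ->
  lebesgue_rV R d ((fun x : 'rV[R]_d => x + v) @^-1` A) = lebesgue_rV R d A.
Proof.
elim: d v A => [|d IH] v A mA.
  by rewrite (_ : _ @^-1` _ = A)//; apply/seteqP; split => x /=; rewrite !thinmx0.
rewrite /= /lebesgue_rV_step /pushforward.
set B := rV_cons (d:=d) @^-1` A.
have mB : measurable B by rewrite -[B]setTI; exact: measurable_rV_cons.
pose w : 'rV[R]_d := \row_i v ord0 (lift ord0 i).
have consD (x : measurableTypeR R) (y : 'rV[R]_d) :
    rV_cons (x, y) + v = rV_cons (x + v ord0 ord0 : measurableTypeR R, y + w).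
  apply/rowP => i; rewrite mxE; case: (unliftP ord0 i) => [j|] ->.
    by rewrite !rV_consS /= !mxE.
  by rewrite !rV_cons0.
rewrite /product_measure1.
transitivity (\int[lebesgue_measure]_x 
  ((fun x => lebesgue_rV R d (xsection B x)) (x + v ord0 ord0 : measurableTypeR R)%R))%E.
  apply: eq_integral => x _ /=.
  rewrite -[RHS](IH w); last exact: measurable_xsection.
  set S1 := xsection _ _; set S2 := (X in _ = _ X).
  suff -> : S1 = S2 by []; apply/seteqP; split => y /=;
  by rewrite /S1 /S2 /xsection /= !inE /= consD.
rewrite (@ge0_integral_shift _ (fun x => lebesgue_rV R d (xsection B x)))//.
exact: measurable_fun_xsection.
Qed.

Lemma ge0_integral_shift_rV d (v : 'rV[R]_d) (f : 'rV[R]_d -> \bar R) :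
  measurable_fun setT f -> (forall x, 0 <= f x)%E ->
  (\int[lebesgue_rV R d]_x f (x + v)%R = \int[lebesgue_rV R d]_x f x)%E.
Proof.
move=> mf f0.
have := @ge0_integral_pushforward _ _ _ _ R _ (measurable_addl_rV v)
  (lebesgue_rV R d) setT f measurableT mf.
rewrite preimage_setT /= => <- //.
apply: eq_measure_integral; first exact: measurable_addl_rV.
by move=> mv A mA _; exact: lebesgue_rV_shift.
Qed.

End translation_invariance.

(** * The p-th power functional *)

(** Comparison with n times the largest term uses no convexity, so one bound serves both q < 1 and q
    >= 1. *)
Lemma powR_sum_le {R : realType} n (a : 'I_n -> R) (q : R) : 0 < q ->
  (forall i, 0 <= a i) -> (\sum_i a i) `^ q <= n%:R `^ q * \sum_i a i `^ q.
Proof.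
move=> q0; case: n a => [|n] a a0.
  by rewrite !big_ord0 powR0 ?mulr0// gt_eqF.
pose i0 := [arg max_(i > ord0) a i]%O.
have amax i : a i <= a i0 by rewrite /i0; case: arg_maxP => // j _; exact.
apply: (@le_trans _ _ ((n.+1%:R * a i0) `^ q)).
  apply: ge0_ler_powR; rewrite ?nnegrE ?(ltW q0) ?sumr_ge0 ?mulr_ge0//.
  by rewrite mulr_natl -[X in _ *+ X](card_ord n.+1) -sumr_const ler_sum.
rewrite powRM// ler_wpM2l ?powR_ge0//.
by rewrite (bigD1 i0)//= lerDl sumr_ge0// => i _; exact: powR_ge0.
Qed.

Section power_functional.
Context {R : realType} {d : nat}.
Implicit Types (p : \bar R) (f g h k : 'rV[R]_d -> R) (A B : set 'rV[R]_d).

(** The degree of homogeneity of [Phi]: at infinity [Phi] is the norm itself, hence the value 1. *)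
Definition pexp p : R := if p is q%:E then q else 1.

(* The p-th power of the L^p norm (the uniform norm itself for p = +oo): it is   *)
(* translation invariant and subadditive up to a constant, also for p < 1. Only  *)
(* these two properties and Fubini are used, so that all p are treated at once.  *)
Definition Phi p f : \bar R :=
  match p with
  | q%:E => \int[lebesgue_rV R d]_x (`|f x| `^ q)%:E
  | _ => ereal_sup [set `|f x|%:E | x in [set: 'rV[R]_d]]
  end.

(* If |f| <= C * (|g_1| + ... + |g_n|) and Phi (g_i) <= e for all i, then        *)
(* Phi f <= quasi_const p n C * e.                                               *)
Definition quasi_const p n (C : R) : R := n%:R `^ pexp p * n%:R * C `^ pexp p.

(** Functions stay total and are cut off by zero outside A, so that shifts are plain compositions.
    For finite p the number e bounds the p-th power of the norm, not the norm. *)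
Definition small p A f (e : R) : Prop := (Phi p (f \_ A) <= e%:E)%E.

Lemma pexp_gt0 p : (0 < p)%E -> 0 < pexp p.
Proof. by case: p. Qed.

Lemma quasi_const_ge0 p n C : 0 <= quasi_const p n C.
Proof. by rewrite /quasi_const !mulr_ge0 ?powR_ge0. Qed.

Lemma quasi_const11 p : quasi_const p 1 1 = 1.
Proof. by rewrite /quasi_const powR1 !mulr1. Qed.

Lemma Phi_ge0 p f : (0 <= Phi p f)%E.
Proof.
case: p => [q| |]/=.
- by apply: integral_ge0 => x _; rewrite lee_fin powR_ge0.
- by apply: (@le_trans _ _ `|f 0|%:E); [rewrite lee_fin|apply: ereal_sup_ubound; exists 0].
- by apply: (@le_trans _ _ `|f 0|%:E); [rewrite lee_fin|apply: ereal_sup_ubound; exists 0].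
Qed.

Lemma measurable_powR_norm f q : measurable_fun setT f ->
  measurable_fun setT (fun x => (`|f x| `^ q)%:E).
Proof.
move=> mf; apply/measurable_EFinP.
apply: (@measurableT_comp _ _ _ _ _ _ (@powR R ^~ q)); first exact: measurable_powR.
exact: measurableT_comp.
Qed.

Lemma Phi_dom p n (C : R) f (g : 'I_n -> 'rV[R]_d -> R) (e : R) : (0 < p)%E ->
  0 <= C -> 0 <= e -> measurable_fun setT f -> (forall i, measurable_fun setT (g i)) ->
  (forall x, `|f x| <= C * \sum_i `|g i x|) -> (forall i, (Phi p (g i) <= e%:E)%E) ->
  (Phi p f <= (quasi_const p n C * e)%:E)%E.
Proof.
move=> p0 C0 e0 mf mg fg ge; case: p p0 ge => [q| |]//= q0 ge.
  have {}q0 : 0 < q by [].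
  apply: (@le_trans _ _ (\int[lebesgue_rV R d]_x
      ((C `^ q * n%:R `^ q)%:E * \sum_i (`|g i x| `^ q)%:E))%E).
    apply: ge0_le_integral => //.
    - exact: measurable_powR_norm.
    - by apply: measurable_funeM; apply: emeasurable_sum => i; exact: measurable_powR_norm.
    - move=> x _; rewrite sumEFin lee_fin.
      apply: (@le_trans _ _ ((C * \sum_i `|g i x|) `^ q)).
        by rewrite ge0_ler_powR ?nnegrE ?(ltW q0) ?mulr_ge0 ?sumr_ge0.
      rewrite powRM ?sumr_ge0// -mulrA ler_wpM2l ?powR_ge0//.
      exact: powR_sum_le.
  rewrite ge0_integralZl_EFin//; first last.
  - by rewrite mulr_ge0 ?powR_ge0.
  - by apply: emeasurable_sum => i; exact: measurable_powR_norm.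
  - by move=> x _; rewrite sume_ge0.
  rewrite ge0_integral_sum//; last by move=> i; exact: measurable_powR_norm.
  apply: (@le_trans _ _ ((C `^ q * n%:R `^ q)%:E * \sum_(i < n) e%:E)%E).
    by rewrite lee_wpmul2l ?lee_fin ?mulr_ge0 ?powR_ge0// lee_sum.
  rewrite sumEFin -EFinM lee_fin sumr_const card_ord /quasi_const/=.
  by rewrite -[e *+ n]mulr_natl; lra.
apply: ge_ereal_sup => _ [x _ <-]; rewrite lee_fin.
apply: (le_trans (fg x)); rewrite /quasi_const /= !powRr1//.
have -> : n%:R * n%:R * C * e = C * (n%:R * n%:R * e) by ring.
apply: ler_wpM2l => //.
apply: (@le_trans _ _ (\sum_(i < n) e)).
  apply: ler_sum => i _; rewrite -lee_fin; apply: le_trans (ge i).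
  by apply: ereal_sup_ubound; exists x.
rewrite sumr_const card_ord -[e *+ n]mulr_natl ler_wpM2r// -natrM ler_nat.
by case: (n) => // k; rewrite leq_pmulr.
Qed.

Lemma Phi_shift p f (v : 'rV[R]_d) : measurable_fun setT f ->
  Phi p (fun x => f (x + v)) = Phi p f.
Proof.
move=> mf; have sup_shift : [set `|f (x + v)|%:E | x in [set: 'rV[R]_d]] =
    [set `|f x|%:E | x in [set: 'rV[R]_d]].
  apply/seteqP; split => _ [x _ <-]; first by exists (x + v).
  by exists (x - v) => //; rewrite subrK.
case: p => [q| |]/=; [|by rewrite sup_shift..].
rewrite (@ge0_integral_shift_rV _ _ v (fun x => (`|f x| `^ q)%:E))//.
exact: measurable_powR_norm.
Qed.

Lemma measurable_patch A f : measurable A -> measurable_fun setT f ->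
  measurable_fun setT (f \_ A).
Proof.
by move=> mA mf; apply/(measurable_restrictT f mA); exact: measurable_funTS.
Qed.

Lemma patch_in A f x : A x -> (f \_ A) x = f x.
Proof. by move=> Ax; rewrite patchE mem_set. Qed.

Lemma patch_notin A f x : ~ A x -> (f \_ A) x = 0.
Proof. by move=> Ax; rewrite patchE memNset. Qed.

Lemma small_ge0 p A f e : small p A f e -> 0 <= e.
Proof. by move=> /(le_trans (Phi_ge0 _ _)); rewrite lee_fin. Qed.

Lemma small_le p A f e e' : e <= e' -> small p A f e -> small p A f e'.
Proof. by move=> ee' /le_trans; apply; rewrite lee_fin. Qed.

(** Each dominating function has its own set, which lets the same statement yield both [small_dom]
    and [small_cover]. *)
Lemma small_domg p n C A f (B : 'I_n -> set 'rV[R]_d) (g : 'I_n -> 'rV[R]_d -> R) e :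
  (0 < p)%E -> 0 <= C -> 0 <= e -> measurable A -> (forall i, measurable (B i)) ->
  measurable_fun setT f -> (forall i, measurable_fun setT (g i)) ->
  (forall x, A x -> `|f x| <= C * \sum_i `|(g i \_ (B i)) x|) ->
  (forall i, small p (B i) (g i) e) -> small p A f (quasi_const p n C * e).
Proof.
move=> p0 C0 e0 mA mB mf mg fg ge.
apply: (@Phi_dom _ _ _ _ (fun i => g i \_ (B i))) => //.
- exact: measurable_patch.
- by move=> i; exact: measurable_patch.
move=> x; have [Ax|Ax] := pselect (A x); first by rewrite patch_in//; exact: fg.
by rewrite patch_notin// normr0 mulr_ge0// sumr_ge0.
Qed.

Lemma small_dom p n C A f (g : 'I_n -> 'rV[R]_d -> R) e :
  (0 < p)%E -> 0 <= C -> 0 <= e -> measurable A ->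
  measurable_fun setT f -> (forall i, measurable_fun setT (g i)) ->
  (forall x, A x -> `|f x| <= C * \sum_i `|g i x|) ->
  (forall i, small p A (g i) e) -> small p A f (quasi_const p n C * e).
Proof.
move=> p0 C0 e0 mA mf mg fg ge.
apply: (@small_domg _ _ _ _ _ (fun=> A) g) => // x Ax.
by under eq_bigr do rewrite patch_in//; exact: fg.
Qed.

Lemma small_shift p A B f (v : 'rV[R]_d) e : (0 < p)%E -> measurable A -> measurable B ->
  measurable_fun setT f -> (forall x, B x -> A (x + v)) ->
  small p A f e -> small p B (fun x => f (x + v)) e.
Proof.
move=> p0 mA mB mf BA fe; have e0 := small_ge0 fe.
have mv := @measurable_addl_rV R d v.
rewrite -[e]mul1r -(quasi_const11 p); apply: (@Phi_dom _ 1 1 _ (fun _ x => (f \_ A) (x + v))) => //.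
- by apply: measurable_patch => //; exact: measurableT_comp.
- by move=> _; apply: (@measurableT_comp _ _ _ _ _ _ (f \_ A)) => //; exact: measurable_patch.
- move=> x; rewrite big_ord1 mul1r; have [Bx|Bx] := pselect (B x).
    by rewrite !patch_in//; exact: BA.
  by rewrite patch_notin// normr0.
- by move=> _; rewrite (@Phi_shift p (f \_ A))//; exact: measurable_patch.
Qed.

Lemma small_sub p A B f e : (0 < p)%E -> measurable A -> measurable B ->
  measurable_fun setT f -> B `<=` A -> small p A f e -> small p B f e.
Proof.
move=> p0 mA mB mf BA fe.
have -> : f = fun x => f (x + 0) by apply/funext => x; rewrite addr0.
by apply: (small_shift p0 mA mB) => // x Bx; rewrite addr0; exact: BA.
Qed.

Lemma small_cover p n A (B : 'I_n -> set 'rV[R]_d) f e : (0 < p)%E -> 0 <= e ->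
  measurable A -> (forall i, measurable (B i)) -> measurable_fun setT f ->
  (forall x, A x -> exists i, B i x) -> (forall i, small p (B i) f e) ->
  small p A f (quasi_const p n 1 * e).
Proof.
move=> p0 e0 mA mB mf AB fe.
apply: (@small_domg _ _ _ _ _ B (fun=> f)) => // x /AB[i Bix].
rewrite mul1r (bigD1 i)//= patch_in// lerDl sumr_ge0//.
Qed.

Lemma small_eq p A f g e : (forall x, A x -> f x = g x) -> small p A f e -> small p A g e.
Proof.
move=> fg; rewrite /small (_ : f \_ A = g \_ A)//.
apply/funext => x; have [Ax|Ax] := pselect (A x); first by rewrite !patch_in// fg.
by rewrite !patch_notin.
Qed.

Lemma small2 p A f g h C e : (0 < p)%E -> 0 <= C -> measurable A ->
  measurable_fun setT f -> measurable_fun setT g -> measurable_fun setT h ->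
  (forall x, A x -> `|f x| <= C * (`|g x| + `|h x|)) ->
  small p A g e -> small p A h e -> small p A f (quasi_const p 2 C * e).
Proof.
move=> p0 C0 mA mf mg mh fgh sg sh; have e0 := small_ge0 sg.
apply: (@small_dom _ 2 _ _ _ (fun i => if i == ord0 then g else h)) => //.
- by move=> i; case: ifP.
- by move=> x Ax; rewrite big_ord_recl big_ord1/=; exact: fgh.
- by move=> i; case: ifP.
Qed.

Lemma small3 p A f g h k C e : (0 < p)%E -> 0 <= C -> measurable A ->
  measurable_fun setT f -> measurable_fun setT g -> measurable_fun setT h ->
  measurable_fun setT k ->
  (forall x, A x -> `|f x| <= C * (`|g x| + `|h x| + `|k x|)) ->
  small p A g e -> small p A h e -> small p A k e -> small p A f (quasi_const p 3 C * e).
Proof.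
move=> p0 C0 mA mf mg mh mk fgh sg sh sk; have e0 := small_ge0 sg.
apply: (@small_dom _ 3 _ _ _ (fun i => if i == 0%N :> nat then g else
   if i == 1%N :> nat then h else k)) => //.
- by move=> i; do 2 case: ifP => //.
- by move=> x Ax; rewrite !big_ord_recl big_ord0/= addr0 addrA; exact: fgh.
- by move=> i; do 2 case: ifP => //.
Qed.

End power_functional.

(** * Averaging along a flow *)

Section flow.
Context {R : realType} {d : nat}.
Implicit Types (p : \bar R) (f g l : 'rV[R]_d -> R) (Y : set 'rV[R]_d) (xi : 'rV[R]_d).

Definition slab Y (l : 'rV[R]_d -> R) rho : set 'rV[R]_d := [set x | Y x /\ `|l x| <= rho].

(** The projection along xi onto the level l = s, when l grows at unit speed along xi. *)
Definition fproj (xi : 'rV[R]_d) (l : 'rV[R]_d -> R) s x := x + (s - l x) *: xi.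

Definition dstep (xi : 'rV[R]_d) t f x := f (x + t *: xi) - f x.

Lemma measurable_slab Y l rho : measurable Y -> measurable_fun setT l ->
  measurable (slab Y l rho).
Proof.
move=> mY ml.
have ml' : measurable_fun setT (fun x => `|l x|) by exact: measurableT_comp.
rewrite (_ : slab _ _ _ = Y `&` (setT `&` (fun x => `|l x|) @^-1` `]-oo, rho]%classic)).
  apply: measurableI => //.
  by apply: ml' => //; exact: measurable_itv.
by apply/seteqP; split => x /=; rewrite in_itv/=; [case|case=> ? [_]].
Qed.

Lemma measurable_flow_gen dT (T : measurableType dT) (xi : 'rV[R]_d) (u : T -> R)
    (y : T -> 'rV[R]_d) :
  measurable_fun setT u -> measurable_fun setT y ->
  measurable_fun setT (fun z => (y z + u z *: xi : 'rV[R]_d)).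
Proof.
move=> mu my; apply: measurable_fun_rVP => i.
rewrite (_ : _ \o _ = fun z => rV_coord i (y z) + u z * xi ord0 i).
  apply: measurable_funD; last exact: measurable_funM.
  by apply: measurableT_comp => //; exact: measurable_rV_coord.
by apply/funext => z; rewrite /= /rV_coord !mxE.
Qed.

Lemma measurable_fproj xi l s : measurable_fun setT l ->
  measurable_fun setT (fproj xi l s).
Proof.
by move=> ml; apply: measurable_flow_gen => //; exact: measurable_funB.
Qed.

Lemma measurable_shift f (v : 'rV[R]_d) : measurable_fun setT f ->
  measurable_fun setT (fun x : 'rV[R]_d => f (x + v)).
Proof. by move=> mf; apply: (measurableT_comp mf); exact: measurable_addl_rV. Qed.

Lemma measurable_dstep xi t f : measurable_fun setT f -> measurable_fun setT (dstep xi t f).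
Proof. by move=> mf; apply: measurable_funB => //; exact: measurable_shift. Qed.

(* Fubini on the pairs (x, s), after the substitution s = l x + u. *)
Lemma exists_good_section p xi l Y g (tau e : R) : (0 < p)%E -> 0 < tau -> 0 < e ->
  measurable_fun setT l -> (forall x t, l (x + t *: xi) = l x + t) ->
  measurable Y -> (forall x t, Y x -> Y (x + t *: xi)) -> measurable_fun setT g ->
  (forall u, `|u| <= 2 * tau -> small p (slab Y l tau) (dstep xi u g) e) ->
  exists2 s, `|s| <= tau & small p (slab Y l tau) (fun x => g x - g (fproj xi l s x)) (3 * e).
Proof.
move=> p0 t0 e0 ml lD mY YD mg ge.
have mS := measurable_slab tau mY ml.
have gproj s x : g x - g (fproj xi l s x) = - dstep xi (s - l x) g x.
  by rewrite /dstep /fproj opprB.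
case: p p0 ge => [q| |]//= q0 ge; last first.
  (* For the uniform norm the level 0 works: a point of the slab is at flow time at most tau from
     it. *)
  exists 0; first by rewrite normr0 ltW.
  apply: ge_ereal_sup => _ [x _ <-]; have [Sx|Sx] := pselect (slab Y l tau x).
    rewrite patch_in// gproj normrN; apply: (@le_trans _ _ e%:E); last first.
      by rewrite lee_fin ler_peMl ?(ltW e0)// ler1n.
    have ul : `|0 - l x| <= 2 * tau.
      rewrite sub0r normrN; apply: le_trans (Sx.2) _.
      by rewrite ler_peMl ?(ltW t0)// ler1n.
    apply: le_trans (ge _ ul); apply: ereal_sup_ubound; exists x => //.
    by rewrite patch_in.
  by rewrite patch_notin// normr0 lee_fin mulr_ge0// ltW.
have {}q0 : 0 < q by [].
(* If every level |s| <= tau were bad, the double integral would be at least 2 tau * 3 e;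
   integrating over the steps |u| <= 2 tau bounds it by 4 tau * e. *)
apply: contrapT => hN.
have {}hN (s : R) : `|s| <= tau ->
   ((3 * e)%:E < Phi q%:E ((fun x => g x - g (fproj xi l s x))%R \_ (slab Y l tau)))%E.
  by move=> sl; rewrite ltNge; apply/negP => hle; apply: hN; exists s.
(* Pairs (t, x) for which both ends of the step lie in the slab; this forces |t| <= 2 tau. *)
pose S2 := [set tx : measurableTypeR R * 'rV[R]_d | slab Y l tau tx.2 /\ `|l tx.2 + tx.1| <= tau].
have mlt : measurable_fun setT
    (fun tx : measurableTypeR R * 'rV[R]_d => `|l tx.2 + tx.1|).
  apply: measurableT_comp => //.
  by apply: measurable_funD => //; exact: measurableT_comp.
have mS2 : measurable S2.
  rewrite (_ : S2 = (setT `&` snd @^-1` slab Y l tau) `&`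
    (setT `&` (fun tx => `|l tx.2 + tx.1|) @^-1` `]-oo, tau]%classic)).
    apply: measurableI; first exact: measurable_snd.
    by apply: mlt => //; exact: measurable_itv.
  by apply/seteqP; split => x /=; rewrite in_itv/=; [case|case=> -[_ ?] [_]].
pose D := (fun tx : measurableTypeR R * 'rV[R]_d => dstep xi tx.1 g tx.2) \_ S2.
have mD : measurable_fun setT D.
  apply/(measurable_restrictT _ mS2); apply: measurable_funTS.
  apply: measurable_funB; last exact: measurableT_comp.
  by apply: measurableT_comp => //; apply: measurable_flow_gen.
pose F tx : \bar R := (`|D tx| `^ q)%:E.
have mF : measurable_fun setT F.
  apply/measurable_EFinP.
  apply: (@measurableT_comp _ _ _ _ _ _ (@powR R ^~ q)); first exact: measurable_powR.
  exact: measurableT_comp.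
have F0 tx : (0 <= F tx)%E by rewrite lee_fin powR_ge0.
(* For fixed x this shear is a translation in s, so it preserves the inner integral. *)
pose sh (sx : measurableTypeR R * 'rV[R]_d) : measurableTypeR R * 'rV[R]_d :=
  (sx.1 - l sx.2, sx.2).
have msh : measurable_fun setT sh.
  apply: measurable_fun_pair => //; apply: measurable_funB => //.
  exact: measurableT_comp.
have mFsh : measurable_fun setT (F \o sh) by exact: measurableT_comp.
have Fsh0 sx : (0 <= (F \o sh) sx)%E by exact: F0.
have upper : (\int[lebesgue_measure]_t \int[lebesgue_rV R d]_x F (t, x) <= (4 * tau * e)%:E)%E.
  apply: (@le_trans _ _ (\int[@lebesgue_measure R]_(t in `[(- (2 * tau))%R, (2 * tau)%R]) e%:E)%E).
    rewrite [leRHS]integral_mkcond; apply: ge0_le_integral => //.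
    - by move=> t _; apply: integral_ge0 => x _; exact: F0.
    - exact: (@measurable_fun_fubini_tonelli_F _ _ _ _ R (lebesgue_rV R d) F).
    - by apply/(measurable_restrictT _ (measurable_itv _)).
    move=> t _; rewrite patchE; case: ifPn.
      rewrite inE/= in_itv/= -ler_norml => ht; apply: le_trans (ge t ht).
      apply: ge0_le_integral => //.
      - exact: (measurableT_comp mF).
      - by apply: measurable_powR_norm; apply: measurable_patch => //; exact: measurable_dstep.
      move=> x _; rewrite lee_fin /D; have [Sx|Sx] := pselect (S2 (t, x)).
        by rewrite patchE mem_set// patch_in//; case: Sx.
      by rewrite patchE memNset// normr0 powR0 ?gt_eqF// powR_ge0.
    rewrite notin_setE/= in_itv/= -ler_norml => ht.
    rewrite integral0_eq// => x _; rewrite /F /D patchE memNset ?normr0 ?powR0 ?gt_eqF//.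
    move=> -[/= [_ lx] lxt]; apply: ht.
    have -> : t = (l x + t) - l x by rewrite addrAC subrr add0r.
    by rewrite (le_trans (ler_normB _ _))// mulr_natl mulr2n lerD.
  rewrite integral_cst//= lebesgue_measure_itv/= lte_fin gtrN ?mulr_gt0// -EFinD -EFinM lee_fin.
  by rewrite le_eqVlt; apply/orP; left; apply/eqP; ring.
have lower : ((6 * tau * e)%:E <= \int[lebesgue_measure]_t \int[lebesgue_rV R d]_x F (t, x))%E.
  rewrite (fubini_tonelli F mF F0).
  have -> : (\int[lebesgue_rV R d]_x \int[lebesgue_measure]_t F (t, x) =
      \int[lebesgue_rV R d]_x \int[lebesgue_measure]_s (F \o sh) (s, x))%E.
    apply: eq_integral => x _; apply/esym.
    apply: (@ge0_integral_shift _ (- l x) (fun t => F (t, x))) => //.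
    exact: (measurableT_comp mF).
  rewrite -(fubini_tonelli (F \o sh) mFsh Fsh0).
  apply: (@le_trans _ _ (\int[@lebesgue_measure R]_(t in `[(- tau)%R, tau]) (3 * e)%:E)%E).
    rewrite integral_cst//= lebesgue_measure_itv/= lte_fin gtrN// -EFinD -EFinM lee_fin.
    by rewrite le_eqVlt; apply/orP; left; apply/eqP; ring.
  rewrite [leLHS]integral_mkcond; apply: ge0_le_integral => //.
  - by move=> t _; rewrite patchE; case: ifP => //; rewrite lee_fin mulr_ge0// ltW.
  - by apply/(measurable_restrictT _ (measurable_itv _)).
  - exact: (@measurable_fun_fubini_tonelli_F _ _ _ _ R (lebesgue_rV R d) (F \o sh)).
  move=> s _; rewrite patchE; case: ifPn; last by move=> _; apply: integral_ge0 => x _; exact: F0.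
  rewrite inE/= in_itv/= -ler_norml => hs; apply: (le_trans (ltW (hN s hs))).
  apply: ge0_le_integral => //.
  - apply: measurable_powR_norm; apply: measurable_patch => //.
    by apply: measurable_funB => //; apply: (measurableT_comp mg); exact: measurable_fproj.
  - exact: (measurableT_comp mFsh).
  move=> x _; rewrite lee_fin /D; have [Sx|Sx] := pselect (slab Y l tau x).
    rewrite patch_in// /sh/= patchE mem_set/=; first by rewrite gproj normrN.
    by split => //=; rewrite addrC subrK.
  by rewrite patch_notin// normr0 powR0 ?gt_eqF// powR_ge0.
have := le_trans lower upper; rewrite lee_fin leNgt; apply/negP; rewrite negbK.
by rewrite ltr_pM2r// ltr_pM2r// ltr_nat.
Qed.

End flow.

(** * Polynomials and mixed differences *)

Section real_polynomials.
Context {R : realType}.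
Implicit Types (P b : {poly R}).

(** Induction on the degree through P(t) = P(0) + t P1(t): the values of P1 at 1, ..., r+1 are
    differences of node values of P, and a shift by 1 turns these points into the nodes 0, ..., r.
    The shift is why the induction uses N + 1. *)
Lemma horner_le_nodes r (N : R) : 0 <= N -> exists2 C : R, 0 <= C &
  forall P (t : R), (size P <= r.+1)%N -> `|t| <= N ->
    `|P.[t]| <= C * \sum_(j < r.+1) `|P.[j%:R]|.
Proof.
elim: r N => [|r IH] N N0.
  exists 1 => // P t sP _; rewrite big_ord1 mul1r.
  by rewrite (size1_polyC sP) !hornerC.
have [C C0 HC] := IH (N + 1) (addr_ge0 N0 ler01).
exists (1 + N * C * r.+2%:R) => [|P t sP tN]; first by rewrite addr_ge0 ?mulr_ge0.
have /factor_theorem[P1 P1E] : root (P - P.[0]%:P) 0.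
  by rewrite /root !hornerE subrr.
pose Q := P1 \Po ('X + 1%:P).
have P1t s : P.[s] = P.[0] + P1.[s] * s.
  have := congr1 (fun p : {poly R} => p.[s]) P1E; rewrite !hornerE subr0 => <-.
  by rewrite addrC subrK.
have sQ : (size Q <= r.+1)%N.
  rewrite (leq_trans (size_comp_poly_leq _ _))// size_XaddC muln1.
  have [->|P10] := eqVneq P1 0; first by rewrite size_poly0.
  have : (size (P - P.[0]%:P)%R <= r.+2)%N.
    by rewrite (leq_trans (size_polyD _ _))// size_polyN geq_max sP size_polyC; case: eqP.
  by rewrite P1E size_Mmonic ?monicXsubC// size_XsubC addn2/= ltnS prednK ?size_poly_gt0.
have Qs s : Q.[s] = P1.[s + 1] by rewrite /Q horner_comp !hornerE.
set S := \sum_(j < _) _.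
have Pj (j : 'I_r.+2) : `|P.[j%:R]| <= S.
  by rewrite /S (bigD1 j)//= lerDl sumr_ge0.
have QS : \sum_(j < r.+1) `|Q.[j%:R]| <= r.+2%:R * S.
  apply: (@le_trans _ _ (\sum_(j < r.+1) (`|P.[(j.+1)%:R]| + `|P.[0]|))).
    apply: ler_sum => j _; rewrite Qs natr1.
    have -> : P1.[j.+1%:R] = (P.[j.+1%:R] - P.[0]) / j.+1%:R.
      by rewrite P1t addrC addKr mulfK.
    rewrite normrM; apply: (@le_trans _ _ (`|P.[j.+1%:R] - P.[0]| * 1)).
      by rewrite ler_wpM2l// normfV normr_nat invf_le1 ?ler1n.
    by rewrite mulr1 (le_trans (ler_normB _ _)).
  rewrite big_split/= sumr_const card_ord -[_ *+ r.+1]mulr_natl.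
  have -> : r.+2%:R * S = S + r.+1%:R * S by rewrite -natr1; ring.
  apply: lerD; last by rewrite ler_wpM2l// (Pj ord0).
  by rewrite /S [leRHS]big_ord_recl lerDr.
rewrite P1t (le_trans (ler_normD _ _))// mulrDl mul1r lerD//; first exact: (Pj ord0).
rewrite normrM mulrC -!mulrA ler_pM//.
have -> : P1.[t] = Q.[t - 1] by rewrite Qs subrK.
apply: le_trans (HC _ _ sQ _) _.
  by rewrite (le_trans (ler_normB _ _))// normr1 lerD.
by rewrite ler_wpM2l.
Qed.

(** The forward difference P(X + h) - P, written as a Taylor sum without its constant term so that
    the drop in degree is visible. *)
Definition poly_step (h : R) P : {poly R} :=
  \sum_(1 <= i < size P) h ^+ i *: P^`N(i).

Lemma horner_poly_step h P t : (poly_step h P).[t] = P.[t + h] - P.[t].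
Proof.
rewrite nderiv_taylor; last exact: mulrC.
have [->|P0] := eqVneq P 0.
  by rewrite /poly_step size_poly0 big_geq// big_ord0 !horner0 subrr.
rewrite -(big_mkord xpredT (fun i => (P^`N(i)).[t] * h ^+ i)).
rewrite big_ltn ?size_poly_gt0// nderivn0 expr0 mulr1 [RHS]addrC addKr /poly_step horner_sum.
by apply: eq_bigr => i _; rewrite hornerZ mulrC.
Qed.

Lemma size_poly_step h P r : (size P <= r.+1)%N -> (size (poly_step h P) <= r)%N.
Proof.
move=> sP; apply: (leq_trans (size_sum _ _ _)).
rewrite big_nat_cond; apply/bigmax_leqP_seq => i _ /andP[/andP[i1 iP] _].
rewrite (leq_trans (size_scale_leq _ _))// /nderivn (leq_trans (size_poly _ _))//.
by rewrite leq_subLR (leq_trans sP)// -add1n leq_add2r.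
Qed.

(** The difference of X^(r+1) has leading term (r+1) h X^r, so a multiple of that monomial removes
    the top coefficient of b and induction does the rest. *)
Lemma poly_step_surj (h : R) r b : h != 0 -> (size b <= r)%N ->
  exists2 b' : {poly R}, (size b' <= r.+1)%N & forall t, b'.[t + h] - b'.[t] = b.[t].
Proof.
move=> h0; elim: r b => [|r IH] b sb.
  exists 0; first by rewrite size_poly0.
  by move=> t; move: sb; rewrite leqn0 size_poly_eq0 => /eqP->; rewrite !horner0 subrr.
pose b0 : {poly R} := (b`_r / (h * r.+1%:R)) *: 'X^(r.+1).
have sb0 : (size b0 <= r.+2)%N by rewrite (leq_trans (size_scale_leq _ _))// size_polyXn.
have Db0r : (poly_step h b0)`_r = b`_r.
  have [br0|br0] := eqVneq b`_r 0.
    by rewrite /poly_step /b0 br0 mul0r scale0r size_poly0 big_geq// coef0.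
  have a0 : b`_r / (h * r.+1%:R) != 0 by rewrite mulf_neq0// invr_eq0 mulf_neq0.
  rewrite /poly_step /b0 size_scale// size_polyXn big_ltn// coefD nderivn1 derivZ derivXn.
  rewrite expr1 !coefZ coefMn coefXn eqxx coef_sum big_nat_cond big1 ?addr0.
    by rewrite mulrCA divfK// mulf_neq0.
  move=> i /andP[/andP[i2 _] _]; rewrite coefZ nth_default ?mulr0//.
  rewrite /nderivn (leq_trans (size_poly _ _))// size_scale// size_polyXn.
  by rewrite leq_subLR -(addn2 r) addnC leq_add2r.
have [|b1 sb1 b1E] := IH (b - poly_step h b0).
  apply/leq_sizeP => j; rewrite leq_eqVlt => /predU1P[<-|rj].
    by rewrite coefB Db0r subrr.
  rewrite coefB !nth_default ?subrr// ?(leq_trans _ rj)//; exact: size_poly_step.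
exists (b0 + b1).
  by rewrite (leq_trans (size_polyD _ _))// geq_max sb0 (leq_trans sb1).
by move=> t; have := b1E t; rewrite !hornerD hornerN horner_poly_step; lra.
Qed.

Lemma sum_binomial_stepS r (phi : nat -> R) :
  \sum_(j < r.+2) (-1) ^+ (r.+1 + j) * 'C(r.+1, j)%:R * phi j =
  \sum_(j < r.+1) (-1) ^+ (r + j) * 'C(r, j)%:R * (phi j.+1 - phi j).
Proof.
under [RHS]eq_bigr do rewrite mulrBr.
rewrite sumrB.
pose B := \sum_(j < r.+1) (-1) ^+ (r + j) * 'C(r, j)%:R * phi j.+1.
pose D := \sum_(j < r.+1) (-1) ^+ (r + j) * 'C(r, j)%:R * phi j.
pose A := \sum_(j < r.+1) (-1) ^+ (r + j) * 'C(r, j.+1)%:R * phi j.+1.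
have AD : (-1) ^+ r.+1 * phi 0%N + A = - D.
  rewrite /A /D big_ord_recr/= bin_small// mulr0 mul0r addr0.
  rewrite big_ord_recl/= bin0 addn0 opprD; congr (_ + _).
    by rewrite exprS; ring.
  rewrite -sumrN; apply: eq_bigr => j _; rewrite /bump/= add1n addnS exprS; ring.
rewrite big_ord_recl/= bin0 addn0 mulr1.
rewrite (_ : \sum_j _ = A + B); first by rewrite addrA AD addrC /B /D.
rewrite /A /B -big_split/=; apply: eq_bigr => j _.
rewrite /bump/= add1n binS natrD addSn addnS !exprS; ring.
Qed.

Lemma sum_binomial_poly0 r P : (size P <= r)%N ->
  \sum_(j < r.+1) (-1) ^+ (r + j) * 'C(r, j)%:R * P.[j%:R] = 0.
Proof.
elim: r P => [|r IH] P sP.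
  move: sP; rewrite leqn0 size_poly_eq0 => /eqP->.
  by rewrite big1// => i _; rewrite horner0 mulr0.
rewrite (sum_binomial_stepS r (fun j => P.[j%:R])).
rewrite -[RHS](IH (poly_step 1 P)); last exact: size_poly_step.
by apply: eq_bigr => j _; rewrite horner_poly_step natr1.
Qed.

End real_polynomials.

Section mixed_differences.
Context {R : realType} {d : nat}.
Implicit Types (f g : 'rV[R]_d -> R) (xi x : 'rV[R]_d) (hs : seq R) (hg : seq (R * R)).

(** The induction on r peels off one step of arbitrary length at a time, so differences with equal
    steps do not suffice; [mixed_fin_diff] derives the mixed ones from them. *)
Fixpoint mixed xi hs f := if hs is h :: hs' then mixed xi hs' (dstep xi h f) else f.

Lemma dstepB xi h f g x : dstep xi h (fun x => f x - g x) x = dstep xi h f x - dstep xi h g x.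
Proof. by rewrite /dstep; ring. Qed.

Lemma mixedB xi hs f g x : mixed xi hs (fun x => f x - g x) x = mixed xi hs f x - mixed xi hs g x.
Proof.
elim: hs f g => //= h hs IH f g; rewrite -IH; congr mixed.
by apply/funext => y; rewrite dstepB.
Qed.

Lemma mixed_cst0 xi hs : mixed xi hs (fun=> 0) = fun=> 0.
Proof.
elim: hs => //= h hs IH; rewrite (_ : dstep _ _ _ = fun=> 0)//.
by apply/funext => y; rewrite /dstep subrr.
Qed.

Lemma mixed0 xi hs f : 0 \in hs -> mixed xi hs f = fun=> 0.
Proof.
elim: hs f => //= h hs IH f; rewrite inE => /predU1P[<-|/IH //].
rewrite (_ : dstep _ _ _ = fun=> 0) ?mixed_cst0//.
by apply/funext => y; rewrite /dstep scale0r addr0 subrr.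
Qed.

Lemma measurable_mixed xi hs f : measurable_fun setT f -> measurable_fun setT (mixed xi hs f).
Proof. by elim: hs f => //= h hs IH f mf; apply: IH; exact: measurable_dstep. Qed.

(* (s, H, H') stands for s * f (x + (H - c * H') *: xi) in the expansion of the *)
(* mixed difference with steps h_i - c * g_i.                                   *)
Fixpoint kterms hg : seq (R * R * R) :=
  if hg is (h, g) :: hg' then
    [seq (t.1.1, t.1.2 + h, t.2 + g) | t <- kterms hg'] ++
    [seq (- t.1.1, t.1.2, t.2) | t <- kterms hg']
  else [:: (1, 0, 0)].

Lemma size_kterms hg : size (kterms hg) = (2 ^ size hg)%N.
Proof. by elim: hg => //= -[h g] hg IH; rewrite size_cat !size_map IH expnS mul2n addnn. Qed.

Lemma kterms_bound hg t : t \in kterms hg ->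
  [/\ `|t.1.1| = 1, `|t.1.2| <= \sum_(p <- hg) `|p.1| & `|t.2| <= \sum_(p <- hg) `|p.2|].
Proof.
elim: hg t => [|[h g] hg IH] t /=.
  by rewrite inE => /eqP-> /=; rewrite !big_nil normr1 normr0.
rewrite mem_cat => /orP[] /mapP[t' /IH[t1 t2 t3] ->] /=; rewrite !big_cons/=; split => //.
- by rewrite (le_trans (ler_normD _ _))// addrC lerD2l.
- by rewrite (le_trans (ler_normD _ _))// addrC lerD2l.
- by rewrite normrN.
- by rewrite (le_trans t2)// lerDr.
- by rewrite (le_trans t3)// lerDr.
Qed.

Lemma mixed_kterms xi hg (c : R) f x :
  mixed xi [seq p.1 - c * p.2 | p <- hg] f x =
  \sum_(t <- kterms hg) t.1.1 * f (x + (t.1.2 - c * t.2) *: xi).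
Proof.
elim: hg f => [|[h g] hg IH] f /=.
  by rewrite big_seq1/= mul1r mulr0 subrr scale0r addr0.
rewrite IH big_cat !big_map/= -big_split/=; apply: eq_bigr => t _.
rewrite /dstep mulrBr mulNr -addrA -scalerDl.
by congr (_ * f (x + _ *: xi) - _); ring.
Qed.

(** Indices start at 0, so the step h_i - c g_i vanishes exactly when c = i + 1 or h_i = 0. *)
Definition ksteps hs : seq (R * R) :=
  [seq (nth 0 hs i, nth 0 hs i / i.+1%:R) | i <- iota 0 (size hs)].

Lemma ksteps1 hs : [seq p.1 | p <- ksteps hs] = hs.
Proof.
by rewrite /ksteps -map_comp (@eq_map _ _ _ (nth 0 hs)) ?map_nth_iota0 ?take_size.
Qed.

Lemma mixed_expand xi hs f x :
  mixed xi hs f x = \sum_(t <- kterms (ksteps hs)) t.1.1 * f (x + t.1.2 *: xi).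
Proof.
have /= := mixed_kterms xi (ksteps hs) 0 f x.
under eq_map do rewrite mul0r subr0.
by rewrite ksteps1 => ->; apply: eq_bigr => t _; rewrite mul0r subr0.
Qed.

(* Kemperman: for c = j in 1..r the step of index j - 1 vanishes, so only c = 0 survives. *)
Lemma mixed_fin_diff xi hs f x : let r := size hs in
  mixed xi hs f x = \sum_(t <- kterms (ksteps hs))
    (-1) ^+ r * t.1.1 * fin_diff r ((- t.2) *: xi) f (x + t.1.2 *: xi).
Proof.
move=> r; pose m c := mixed xi [seq p.1 - c * p.2 | p <- ksteps hs] f x.
have m0 : m 0 = mixed xi hs f x.
  by rewrite /m; under eq_map do rewrite mul0r subr0; rewrite ksteps1.
have mj j : (0 < j <= r)%N -> m j%:R = 0.
  case: j => // j /=; rewrite /r => jr; rewrite /m mixed0//; apply/mapP.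
  exists (nth 0 hs j, nth 0 hs j / j.+1%:R); last by rewrite /= mulrC divfK ?subrr.
  by apply/mapP; exists j => //; rewrite mem_iota.
(* Only j = 0 contributes, so the binomial weights are free to insert; exchanging the sums then
   builds an r-th difference out of each term of [kterms]. *)
transitivity (\sum_(j < r.+1) (-1) ^+ j * 'C(r, j)%:R * m j%:R).
  rewrite big_ord_recl/= expr0 bin0 !mul1r m0 big1 ?addr0// => i _.
  by rewrite mj ?mulr0// /bump/= add1n ltn_ord.
rewrite /m; under eq_bigr => j _ do rewrite mixed_kterms mulr_sumr.
rewrite exchange_big/=; apply: eq_bigr => t _; rewrite /fin_diff mulr_sumr.
apply: eq_bigr => j _; rewrite exprD.
rewrite (_ : x + t.1.2 *: xi + _ = x + (t.1.2 - j%:R * t.2) *: xi).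
  have rr : (-1) ^+ r * (-1) ^+ r = 1 :> R by rewrite -expr2 sqrr_sign.
  by rewrite [RHS]mulrA [in RHS]mulrCA; ring: rr.
by rewrite -addrA -scaler_nat scalerA -scalerDl mulrN.
Qed.

End mixed_differences.

(** * Functions polynomial along a flow *)

Section flow_whitney.
Context {R : realType} {d : nat}.
Implicit Types (p : \bar R) (f g a q l : 'rV[R]_d -> R) (Y : set 'rV[R]_d) (xi x : 'rV[R]_d).
Implicit Types (V : ('rV[R]_d -> R) -> Prop) (b P : {poly R}).

(** The set Y is a full cylinder along xi; slabs cut it by |l| only, so every loss of domain is a
    loss in rho. *)
Record flow_box xi l Y : Prop := FlowBox {
  fb_ml : measurable_fun setT l;
  fb_l : forall x t, l (x + t *: xi) = l x + t;
  fb_mY : measurable Y;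
  fb_Y : forall x t, Y x -> Y (x + t *: xi) }.

(** Closure under exactly the operations of the one-direction construction. Taking V to be [sepm]
    keeps polynomiality along the directions already treated. *)
Record flow_class xi l V : Prop := FlowClass {
  fc_m : forall f, V f -> measurable_fun setT f;
  fc_B : forall f g, V f -> V g -> V (fun x => f x - g x);
  fc_shift : forall f t, V f -> V (fun x => f (x + t *: xi));
  fc_poly : forall f b, V f -> V (fun x => f x * b.[l x]);
  fc_proj : forall f s, V f -> V (fun x => f (fproj xi l s x)) }.

(** Polynomials of degree < r in l whose coefficients are constant along the flow. The finiteness of
    the coefficients on slabs is what yields [fpoly_finite]. *)
Inductive fpoly p xi l Y V r : ('rV[R]_d -> R) -> Prop :=
| fpoly0 : fpoly p xi l Y V r (fun=> 0)
| fpoly_add a b q : V a -> (forall x t, a (x + t *: xi) = a x) -> (size b <= r)%N ->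
    (forall rho, exists M, small p (slab Y l rho) a M) -> fpoly p xi l Y V r q ->
    fpoly p xi l Y V r (fun x => a x * b.[l x] + q x).

Lemma fc_0 xi l V f : flow_class xi l V -> V f -> V (fun=> 0).
Proof.
move=> cV Vf; rewrite (_ : (fun=> 0) = (fun x => f x - f x)); first exact: (fc_B cV).
by apply/funext => x; rewrite subrr.
Qed.

Lemma fc_D xi l V f g : flow_class xi l V -> V f -> V g -> V (fun x => f x + g x).
Proof.
move=> cV Vf Vg; rewrite (_ : (fun _ => _) = (fun x => f x - (0 - g x))).
  by apply: (fc_B cV) => //; apply: (fc_B cV) => //; exact: (fc_0 cV Vf).
by apply/funext => x; rewrite sub0r opprK.
Qed.

Lemma fc_dstep xi l V f t : flow_class xi l V -> V f -> V (dstep xi t f).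
Proof. by move=> cV Vf; apply: (fc_B cV) => //; exact: (fc_shift cV). Qed.

Lemma poly_bounded b (rho : R) : exists2 C : R, 0 <= C & forall t, `|t| <= rho -> `|b.[t]| <= C.
Proof.
have [r0|r0] := leP 0 rho; last first.
  by exists 0 => // t /(le_lt_trans)/(_ r0); rewrite normr_lt0.
have [C C0 HC] := horner_le_nodes (size b) r0.
exists (C * \sum_(j < (size b).+1) `|b.[j%:R]|); first by apply: mulr_ge0 => //; exact: sumr_ge0.
by move=> t tr; exact: HC.
Qed.

Section fpoly_theory.
Variables (p : \bar R) (xi : 'rV[R]_d) (l : 'rV[R]_d -> R) (Y : set 'rV[R]_d).
Variable V : ('rV[R]_d -> R) -> Prop.
Hypotheses (p0 : (0 < p)%E) (fb : flow_box xi l Y) (cV : flow_class xi l V).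
Local Notation fpoly := (fpoly p xi l Y V).

Let mS rho : measurable (slab Y l rho).
Proof. by apply: measurable_slab; [exact: fb_mY fb|exact: fb_ml fb]. Qed.

Lemma fpoly_V r q f : V f -> fpoly r q -> V q.
Proof.
move=> Vf; elim=> [|a b {}q Va _ _ _ _ Vq]; first exact: (fc_0 cV Vf).
by apply: (fc_D cV) => //; exact: (fc_poly cV).
Qed.

Lemma fpoly_size0 q : fpoly 0 q -> q = fun=> 0.
Proof.
elim=> // a b {}q _ _ + _ _ ->; rewrite leqn0 size_poly_eq0 => /eqP->.
by apply/funext => x; rewrite horner0 mulr0 addr0.
Qed.

Lemma fpoly_dstep r h q : fpoly r.+1 q -> fpoly r (dstep xi h q).
Proof.
elim=> [|a b {}q Va ia sb fa _ IH].
  rewrite (_ : dstep _ _ _ = fun=> 0); first exact: fpoly0.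
  by apply/funext => x; rewrite /dstep subrr.
rewrite (_ : dstep _ _ _ = fun x => a x * (poly_step h b).[l x] + dstep xi h q x).
  by apply: fpoly_add => //; exact: size_poly_step.
apply/funext => x; rewrite /dstep ia (fb_l fb) horner_poly_step; ring.
Qed.

Lemma mixed_fpoly0 hs q : fpoly (size hs) q -> mixed xi hs q = fun=> 0.
Proof. by elim: hs q => [|h hs IH] q /= => [/fpoly_size0|/fpoly_dstep/IH]. Qed.

Lemma fpoly_line r q x : fpoly r q ->
  exists2 P : {poly R}, (size P <= r)%N & forall t, q (x + t *: xi) = P.[t].
Proof.
elim=> [|a b {}q Va ia sb fa _ [P sP PE]].
  by exists 0 => [|t]; rewrite ?size_poly0 ?horner0.
exists (a x *: (b \Po ('X + (l x)%:P)) + P) => [|t].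
  rewrite (leq_trans (size_polyD _ _))// geq_max sP andbT.
  rewrite (leq_trans (size_scale_leq _ _))//.
  have [->|b0] := eqVneq b 0; first by rewrite comp_poly0 size_poly0.
  rewrite (leq_trans (size_comp_poly_leq _ _))// size_XaddC muln1 prednK//.
  by rewrite size_poly_gt0.
by rewrite ia (fb_l fb) PE hornerD hornerZ horner_comp hornerD hornerX hornerC [t + _]addrC.
Qed.

Lemma fpoly_step_surj r h q : h != 0 -> fpoly r q ->
  exists2 q', fpoly r.+1 q' & forall x, dstep xi h q' x = q x.
Proof.
move=> h0; elim=> [|a b {}q Va ia sb fa _ [q' fq' q'E]].
  by exists (fun=> 0) => [|x]; [exact: fpoly0|rewrite /dstep subrr].
have [b' sb' b'E] := poly_step_surj h0 sb.
exists (fun x => a x * b'.[l x] + q' x) => [|x]; first exact: fpoly_add.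
rewrite /dstep ia (fb_l fb) -q'E -b'E /dstep; ring.
Qed.

(** A qualitative bound: it lets the iteration of [first_step_small] start and does not enter the
    final constants. *)
Lemma fpoly_finite r q rho : (exists f, V f) -> fpoly r q -> exists M, small p (slab Y l rho) q M.
Proof.
move=> [f Vf]; elim=> [|a b {}q Va ia sb fa fq [M1 qM1]].
  exists (quasi_const p 0 1 * 0); apply: (@small_dom _ _ _ 0 1 _ _ (fun _ => f)) => //.
  - by move=> _; exact: (fc_m cV).
  - by move=> x _; rewrite normr0 big_ord0 mulr0.
  - by case.
have [M2 aM2] := fa rho; have [C C0 bC] := poly_bounded b rho.
have Vq := fpoly_V Vf fq.
exists (quasi_const p 2 (C + 1) * (M1 + M2)).
apply: (@small2 _ _ _ _ _ a q) => //; first by rewrite addr_ge0.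
- apply: (fc_m cV); apply: (fc_D cV) => //; exact: (fc_poly cV).
- exact: (fc_m cV).
- exact: (fc_m cV).
- move=> x [_ lx]; rewrite (le_trans (ler_normD _ _))// mulrDr lerD//.
    by rewrite normrM mulrC ler_wpM2r// (le_trans (bC _ lx))// lerDl.
  by rewrite ler_peMl// lerDr.
- by apply: small_le aM2; rewrite lerDr (small_ge0 qM1).
- by apply: small_le qM1; rewrite lerDl (small_ge0 aM2).
Qed.

(** A long slab is covered by flow translates of a short one, on which [a] takes the same values. *)
Lemma invariant_finite a tau M rho : V a -> (forall x t, a (x + t *: xi) = a x) ->
  0 < tau -> small p (slab Y l tau) a M -> exists M', small p (slab Y l rho) a M'.
Proof.
move=> Va ia t0 aM; pose n := (Num.truncn (2 * rho / tau)).+1.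
pose B (i : 'I_n) := slab Y (fun x => l x + (rho - i%:R * tau)) tau.
have mB i : measurable (B i).
  apply: measurable_slab; first exact: fb_mY fb.
  by apply: measurable_funD => //; exact: fb_ml fb.
exists (quasi_const p n 1 * M); apply: (@small_cover _ _ _ _ _ B) => //.
- exact: small_ge0 aM.
- exact: (fc_m cV) Va.
- move=> x [Yx]; rewrite ler_norml => /andP[x1 x2].
  pose z := (l x + rho) / tau; have z0 : 0 <= z.
    by rewrite /z divr_ge0 ?(ltW t0)//; lra.
  have /andP[z1 z2] := Num.Theory.truncn_itv z0.
  have zn : (Num.truncn z < n)%N.
    rewrite /n ltnS Num.Theory.le_truncn// /z ler_pM2r ?invr_gt0//; lra.
  exists (Ordinal zn); split => //=.
  have zE : l x + rho = z * tau by rewrite /z divfK// gt_eqF.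
  rewrite addrA zE -mulrBl normrM (gtr0_norm t0) ler_piMl ?(ltW t0)//.
  by rewrite ger0_norm ?subr_ge0// lerBlDl natr1 ltW.
- move=> i; apply: (@small_eq _ _ _ _ (fun x => a (x + (rho - i%:R * tau) *: xi))).
    by move=> x _; rewrite ia.
  apply: (@small_shift _ _ _ (slab Y l tau)) => //.
  - exact: (fc_m cV) Va.
  - by move=> x [Yx lx]; split; [exact: (fb_Y fb)|rewrite (fb_l fb)].
Qed.

End fpoly_theory.

(** Division by N gains N^q in [Phi] and three summands cost 3 * 3^q, so N^q >= 6 * 3^q makes the
    Hyers-Ulam step a contraction by 1/2, also for q < 1. *)
Lemma quasi_const3_small p : (0 < p)%E ->
  exists2 N : nat, (0 < N)%N & quasi_const p 3 N%:R^-1 <= 2^-1.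
Proof.
move=> p0; have q0 := pexp_gt0 p0; set q := pexp p in q0 *.
pose X : R := (6 * 3 `^ q) `^ q^-1.
have X0 : 0 <= X by exact: powR_ge0.
exists (Num.truncn X).+1 => //; set N := (Num.truncn X).+1.
have XN : X <= N%:R by rewrite ltW// /N; have /andP[] := Num.Theory.truncn_itv X0.
have Nq : 6 * 3 `^ q <= N%:R `^ q.
  have -> : 6 * 3 `^ q = X `^ q.
    by rewrite /X -powRrM mulVf ?gt_eqF// powRr1// mulr_ge0// powR_ge0.
  by rewrite ge0_ler_powR ?nnegrE// ltW.
have N0 : 0 < N%:R `^ q :> R by rewrite powR_gt0// ltr0n.
rewrite /quasi_const -/q.
have -> : N%:R^-1 `^ q = (N%:R `^ q)^-1 :> R.
  rewrite -[in LHS]powR_inv1// -powRrM mulN1r powRN//.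
rewrite ler_pdivrMr//; lra.
Qed.

End flow_whitney.

Section flow_whitney_induction.
Context {R : realType} {d : nat}.
Implicit Types (p : \bar R) (f g a q l : 'rV[R]_d -> R) (Y : set 'rV[R]_d) (xi x : 'rV[R]_d).
Implicit Types (V : ('rV[R]_d -> R) -> Prop) (e h u v c sigma : R).

Lemma dstep_mulrn xi h f n x :
  dstep xi (n%:R * h) f x = \sum_(i < n) dstep xi h f (x + (i%:R * h) *: xi).
Proof.
elim: n => [|n IH]; first by rewrite big_ord0 /dstep mul0r scale0r addr0 subrr.
rewrite big_ord_recr/= -IH /dstep.
have -> : x + (n.+1%:R * h) *: xi = x + (n%:R * h) *: xi + h *: xi.
  by rewrite -addrA -scalerDl -natr1 mulrDl mul1r.
ring.
Qed.

Lemma slab_shift xi l Y (rho rho' : R) x t : flow_box xi l Y -> slab Y l rho x ->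
  rho + `|t| <= rho' -> slab Y l rho' (x + t *: xi).
Proof.
move=> fb [Yx lx] rr; split; first exact: (fb_Y fb).
rewrite (fb_l fb) (le_trans (ler_normD _ _))// (le_trans _ rr)//.
by rewrite lerD2r.
Qed.

Lemma small_flow p xi l Y (rho rho' : R) f t e : (0 < p)%E -> flow_box xi l Y ->
  measurable_fun setT f -> rho' + `|t| <= rho -> small p (slab Y l rho) f e ->
  small p (slab Y l rho') (fun x => f (x + t *: xi)) e.
Proof.
move=> p0 fb mf rr; have mS z : measurable (slab Y l z).
  by apply: measurable_slab; [exact: (fb_mY fb)|exact: (fb_ml fb)].
by apply: small_shift => // x Sx; exact: (slab_shift fb Sx).
Qed.

(* Delta_u f is near a polynomial which, as Delta_h Delta_u f is small, is nearly constant. *)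
Lemma second_step_small p r N : (0 < p)%E -> exists2 K : R, 0 <= K &
  forall xi l Y V f g u v h sigma c, flow_box xi l Y -> flow_class xi l V -> V f ->
  fpoly p xi l Y V r g -> 0 < h -> `|u| <= h -> `|v| <= N%:R * h ->
  (N + r + 3)%:R * h <= sigma / 2 ->
  small p (slab Y l sigma) (dstep xi h f) c ->
  small p (slab Y l sigma) (fun x => dstep xi u f x - g x) c ->
  small p (slab Y l (sigma / 2)) (dstep xi v (dstep xi u f)) (K * c).
Proof.
move=> p0; have [CL CL0 HCL] := @horner_le_nodes R r N%:R (ler0n _ _).
(* [Ka], [Kb], [Kc], [Kd] bound in turn the shifts of Delta_(jh) f, then Delta_u Delta_(jh) f,
   Delta_(jh) g and Delta_v g. *)
pose Ka := quasi_const p r 1; pose Kb := quasi_const p 2 1 * Ka.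
pose Kc := quasi_const p 3 1 * (Kb + 1).
pose Kd := quasi_const p r.+1 CL * Kc.
have Ka0 : 0 <= Ka by exact: quasi_const_ge0.
have Kb0 : 0 <= Kb by rewrite mulr_ge0// quasi_const_ge0.
have Kc0 : 0 <= Kc by rewrite mulr_ge0 ?quasi_const_ge0// addr_ge0.
have Kd0 : 0 <= Kd by rewrite mulr_ge0// quasi_const_ge0.
exists (quasi_const p 3 1 * (Kd + 1)); first by rewrite mulr_ge0 ?quasi_const_ge0 ?addr_ge0.
move=> xi l Y V f g u v h sigma c fb cV Vf fg h0 uh vN hs sg1 sg2.
have c0 := small_ge0 sg1.
pose A := slab Y l (sigma / 2).
have mS z : measurable (slab Y l z).
  by apply: measurable_slab; [exact: (fb_mY fb)|exact: (fb_ml fb)].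
have mA : measurable A by exact: mS.
have hsum : N%:R * h + r%:R * h + 3 * h <= sigma / 2 by move: hs; rewrite !natrD; lra.
have Nh0 : 0 <= N%:R * h by rewrite mulr_ge0// ltW.
have rh0 : 0 <= r%:R * h by rewrite mulr_ge0// ltW.
have jh (j : nat) : (j <= r)%N -> 0 <= j%:R * h <= r%:R * h.
  by move=> jr; rewrite mulr_ge0 ?(ltW h0)//= ler_wpM2r ?(ltW h0)// ler_nat.
have mf := fc_m cV Vf.
have mg := fc_m cV (fpoly_V cV Vf fg).
have md t k : measurable_fun setT k -> measurable_fun setT (dstep xi t k).
  by move=> mk; exact: measurable_dstep.
pose g2 x := dstep xi u f x - g x.
have mg2 : measurable_fun setT g2 by apply: measurable_funB => //; exact: md.
have ms (k : 'rV[R]_d -> R) t : measurable_fun setT k ->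
    measurable_fun setT (fun x => k (x + t *: xi)).
  by move=> mk; exact: measurable_shift.
have shift k t : measurable_fun setT k -> `|t| <= sigma / 2 ->
    small p (slab Y l sigma) k c -> small p A (fun x => k (x + t *: xi)) c.
  move=> mk ht; apply: small_flow => //; lra.
have sa (j : nat) t : (j <= r)%N -> `|t| <= h ->
    small p A (fun x => dstep xi (j%:R * h) f (x + t *: xi)) (Ka * c).
  move=> jr th.
  apply: (@small_dom _ _ _ r 1 _ _ (fun i x => dstep xi h f (x + (t + i%:R * h) *: xi))) => //.
  - by apply: ms; exact: md.
  - by move=> i; apply: ms; exact: md.
  - move=> x _; rewrite mul1r dstep_mulrn (le_trans (ler_norm_sum _ _ _))//.
    rewrite (big_ord_widen r (fun i => `|dstep xi h f (x + t *: xi + (i%:R * h) *: xi)|) jr).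
    rewrite big_mkcond/=; apply: ler_sum => i _.
    by case: ifP => // _; rewrite -addrA -scalerDl.
  - move=> i; apply: shift => //; first exact: md.
    have /andP[i0 ir] := jh i (ltnW (ltn_ord i)).
    by rewrite (le_trans (ler_normD _ _))// (ger0_norm i0); lra.
have sb (j : nat) : (j <= r)%N ->
    small p A (dstep xi u (dstep xi (j%:R * h) f)) (Kb * c).
  move=> jr; rewrite /Kb -mulrA.
  apply: (@small2 _ _ _ _ _ (fun x => dstep xi (j%:R * h) f (x + u *: xi))
    (fun x => dstep xi (j%:R * h) f (x + 0 *: xi))) => //.
  - by apply md; apply md.
  - by apply: ms; exact: md.
  - by apply: ms; exact: md.
  - by move=> x _; rewrite mul1r /(dstep xi u) scale0r addr0 (le_trans (ler_normB _ _)).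
  - exact: sa.
  - by apply: sa => //; rewrite normr0 ltW.
have g2A t : `|t| <= sigma / 2 -> small p A (fun x => g2 (x + t *: xi)) c.
  by move=> ht; exact: shift.
have g2A0 : small p A g2 c.
  apply: small_eq (g2A 0 _); last by rewrite normr0; lra.
  by move=> x _; rewrite scale0r addr0.
have sc (j : nat) : (j <= r)%N -> small p A (dstep xi (j%:R * h) g) (Kc * c).
  move=> jr; have /andP[j0 jr'] := jh j jr; rewrite /Kc -mulrA.
  apply: (@small3 _ _ _ _ _ (fun x => g2 (x + (j%:R * h) *: xi)) g2
    (dstep xi u (dstep xi (j%:R * h) f))) => //.
  - exact: md.
  - exact: ms.
  - by apply md; apply md.
  - move=> x _; rewrite mul1r.
    have -> : dstep xi (j%:R * h) g x = - g2 (x + (j%:R * h) *: xi) + g2 x +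
        dstep xi u (dstep xi (j%:R * h) f) x.
      by rewrite /g2 /dstep [_ + u *: xi + _]addrAC; ring.
    by rewrite (le_trans (ler_normD _ _))// lerD2r (le_trans (ler_normD _ _))// normrN.
  - apply: small_le (g2A (j%:R * h) _); last by rewrite ger0_norm//; lra.
    by rewrite mulrDl mul1r lerDr mulr_ge0.
  - by apply: small_le g2A0; rewrite mulrDl mul1r lerDr mulr_ge0.
  - by apply: small_le (sb j jr); rewrite mulrDl mul1r lerDl.
have sd : small p A (dstep xi v g) (Kd * c).
  rewrite /Kd -mulrA.
  apply: (@small_dom _ _ _ r.+1 _ _ _ (fun j => dstep xi (j%:R * h) g)) => //.
  - by rewrite mulr_ge0.
  - exact: md.
  - by move=> j; exact: md.
  - move=> x _; have [P sP PE] := fpoly_line fb x fg.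
    have g0 : g x = P.[0] by rewrite -PE scale0r addr0.
    (* In the variable t, g(x + t h xi) - g(x) is a polynomial that is small at the nodes 0, ..., r,
       hence at t = v / h, which is at most N in absolute value. *)
    pose Q : {poly R} := P \Po (h *: 'X) - (g x)%:P.
    have QE t : Q.[t] = dstep xi (t * h) g x.
      by rewrite /Q /dstep PE hornerD horner_comp hornerN !hornerZ hornerX hornerC mulrC.
    have sQ : (size Q <= r.+1)%N.
      rewrite (leq_trans (size_polyD _ _))// size_polyN geq_max size_polyC.
      apply/andP; split; last by case: (_ != 0).
      have [->|P0] := eqVneq P 0; first by rewrite comp_poly0 size_poly0.
      rewrite (leq_trans (size_comp_poly_leq _ _))// size_scale ?gt_eqF// size_polyX muln1.
      by rewrite prednK ?size_poly_gt0// leqW.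
    have vE : v = v / h * h by rewrite divfK// gt_eqF.
    rewrite [in X in X <= _]vE -QE; under eq_bigr do rewrite -QE.
    by apply: HCL => //; rewrite normrM normfV (gtr0_norm h0) ler_pdivrMr.
  - by move=> j; apply: sc; rewrite -ltnS.
rewrite -mulrA; apply: (@small3 _ _ _ _ _ (fun x => g2 (x + v *: xi)) g2 (dstep xi v g)) => //.
- by apply md; apply md.
- exact: ms.
- exact: md.
- move=> x _; rewrite mul1r.
  have -> : dstep xi v (dstep xi u f) x = g2 (x + v *: xi) - g2 x + dstep xi v g x.
    by rewrite /g2 /(dstep xi v); ring.
  by rewrite (le_trans (ler_normD _ _))// lerD2r (le_trans (ler_normB _ _)).
- apply: small_le (g2A v _); first by rewrite mulrDl mul1r lerDr mulr_ge0.
  by rewrite (le_trans vN)//; lra.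
- by apply: small_le g2A0; rewrite mulrDl mul1r lerDr mulr_ge0.
- by apply: small_le sd; rewrite mulrDl mul1r lerDl.
Qed.

End flow_whitney_induction.

(** * The Whitney inequality in one direction *)

Section flow_whitney_theorem.
Context {R : realType} {d : nat}.
Implicit Types (p : \bar R) (f g a q l : 'rV[R]_d -> R) (Y : set 'rV[R]_d) (xi x : 'rV[R]_d).
Implicit Types (V : ('rV[R]_d -> R) -> Prop) (e h u v c sigma : R).

(* Hyers-Ulam: u |-> Delta_u f is nearly additive and nearly h-periodic, hence   *)
(* Delta_u f is near N^-1 Delta_w f with w = N u mod h, and this is iterated.    *)
Lemma first_step_small p : (0 < p)%E -> exists2 N : nat, (0 < N)%N & exists2 K : R, 0 <= K &
  forall xi l Y V f h sigma c M, flow_box xi l Y -> flow_class xi l V -> V f ->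
  0 < h -> 0 < c -> (N + 1)%:R * h <= sigma / 2 ->
  small p (slab Y l sigma) (dstep xi h f) c ->
  (forall u v, 0 <= u <= h -> `|v| <= N%:R * h ->
    small p (slab Y l (sigma / 2)) (dstep xi v (dstep xi u f)) c) ->
  (forall u, 0 <= u <= h -> small p (slab Y l (sigma / 2)) (dstep xi u f) M) ->
  forall u, 0 <= u <= h -> small p (slab Y l (sigma / 2)) (dstep xi u f) (K * c).
Proof.
move=> p0; have [N N0 KN] := @quasi_const3_small R p p0; exists N => //.
pose K3 := quasi_const p N 1; have K30 : 0 <= K3 by exact: quasi_const_ge0.
exists (K3 + 1); first by rewrite addr_ge0.
move=> xi l Y V f h sigma c M fb cV Vf h0 c0 hs sg1 sg2 sM.
pose A := slab Y l (sigma / 2).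
have mS z : measurable (slab Y l z).
  by apply: measurable_slab; [exact: (fb_mY fb)|exact: (fb_ml fb)].
have mA : measurable A by exact: mS.
have mf := fc_m cV Vf.
have md t k : measurable_fun setT k -> measurable_fun setT (dstep xi t k).
  by move=> mk; exact: measurable_dstep.
have ms (k : 'rV[R]_d -> R) t : measurable_fun setT k ->
    measurable_fun setT (fun x => k (x + t *: xi)).
  by move=> mk; exact: measurable_shift.
have NR0 : 0 < N%:R :> R by rewrite ltr0n.
have hN : N%:R * h + h <= sigma / 2 by move: hs; rewrite natrD; lra.
have M0 : 0 <= M by have := sM 0; rewrite lexx ltW// => /(_ isT)/small_ge0.
(* Any common bound for all Delta_u f may be halved as long as it dominates the accumulated error
   [K3 * c]. *)
have step B : K3 * c <= B -> (forall u, 0 <= u <= h -> small p A (dstep xi u f) B) ->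
    forall u, 0 <= u <= h -> small p A (dstep xi u f) (2^-1 * B).
  move=> KB sB u /andP[u0 uh].
  pose m := Num.truncn (N%:R * u / h).
  have z0 : 0 <= N%:R * u / h by rewrite divr_ge0 ?mulr_ge0 ?(ltW h0) ?(ltW NR0).
  have /andP[m1 m2] := Num.Theory.truncn_itv z0; rewrite -/m in m1 m2.
  pose w := N%:R * u - m%:R * h.
  have w0 : 0 <= w by rewrite subr_ge0 -ler_pdivlMr.
  have wh : w <= h.
    by move: m2; rewrite ltr_pdivrMr// -natr1 mulrDl mul1r /w => /ltW; lra.
  have mN : (m <= N)%N.
    rewrite -(ler_nat R) (le_trans m1)// ler_pdivrMr// ler_wpM2l//; exact: ltW.
  (* [E1] is the defect Delta_(Nu) f - N Delta_u f and [E2] is Delta_(mh) f shifted by w; since N u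
     = m h + w, N Delta_u f = Delta_w f + E2 - E1. *)
  pose E1 x := \sum_(i < N) dstep xi (i%:R * u) (dstep xi u f) x.
  pose E2 x := \sum_(i < m) dstep xi h f (x + (w + i%:R * h) *: xi).
  have mE1 : measurable_fun setT E1.
    by apply: measurable_sum => i; apply md; apply md.
  have mE2 : measurable_fun setT E2.
    by apply: measurable_sum => i; apply: ms; exact: md.
  have iN (i : nat) : (i < N)%N -> `|i%:R * u| <= N%:R * h.
    move=> /ltnW iN; rewrite ger0_norm ?mulr_ge0//.
    by rewrite ler_pM// ler_nat.
  have sE1 : small p A E1 B.
    apply: small_le KB _.
    apply: (@small_dom _ _ _ N 1 _ _ (fun i => dstep xi (i%:R * u) (dstep xi u f))) => //.
    - exact: ltW.
    - by move=> i; apply md; apply md.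
    - by move=> x _; rewrite mul1r; exact: ler_norm_sum.
    - by move=> i; apply: sg2; [rewrite u0|exact: iN].
  have sE2 : small p A E2 B.
    apply: small_le KB _; apply: (@small_le _ _ _ _ _ (quasi_const p m 1 * c)).
      rewrite ler_wpM2r ?(ltW c0)// /K3 /quasi_const powR1 !mulr1 ler_pM ?powR_ge0 ?ler_nat//.
      by rewrite ge0_ler_powR ?nnegrE ?ler_nat// ltW// pexp_gt0.
    apply: (@small_dom _ _ _ m 1 _ _
      (fun i x => dstep xi h f (x + (w + i%:R * h) *: xi))) => //.
    - exact: ltW.
    - by move=> i; apply: ms; exact: md.
    - by move=> x _; rewrite mul1r; exact: ler_norm_sum.
    - move=> i; apply: small_flow sg1 => //; first exact: md.
      rewrite ger0_norm; last by rewrite addr_ge0// mulr_ge0// ltW.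
      have : i%:R * h <= N%:R * h.
        by rewrite ler_wpM2r ?(ltW h0)// ler_nat (leq_trans _ mN)// ltnW.
      lra.
  apply: (@small_le _ _ _ _ _ (quasi_const p 3 N%:R^-1 * B)).
    by rewrite ler_wpM2r// (le_trans _ KB)// mulr_ge0// ltW.
  apply: (@small3 _ _ _ _ _ (dstep xi w f) E2 E1) => //.
  - exact: md.
  - exact: md.
  - move=> x _; rewrite ler_pdivlMl// -[X in X * _]gtr0_norm// -normrM.
    have -> : N%:R * dstep xi u f x = dstep xi w f x + E2 x - E1 x.
      have -> : E1 x = dstep xi (N%:R * u) f x - N%:R * dstep xi u f x.
        by rewrite dstep_mulrn /E1 mulr_natl -[X in _ *+ X](card_ord N) -sumr_const -sumrB.
      have -> : E2 x = dstep xi (m%:R * h) f (x + w *: xi).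
        by rewrite dstep_mulrn; apply: eq_bigr => i _; rewrite scalerDl addrA.
      rewrite /dstep -[in f (x + w *: xi + _)]addrA -scalerDl.
      have -> : w + m%:R * h = N%:R * u by rewrite /w subrK.
      ring.
    by rewrite (le_trans (ler_normB _ _))// lerD2r ler_normD.
  - by apply: sB; rewrite w0.
have iter k u : 0 <= u <= h -> small p A (dstep xi u f) (K3 * c + M / 2 ^+ k).
  elim: k u => [|k IH] u uh.
    apply: small_le (sM u uh); rewrite expr0 divr1 lerDr mulr_ge0//; exact: ltW.
  apply: (@small_le _ _ _ _ _ (2^-1 * ((K3 * c + M / 2 ^+ k) + K3 * c))).
    rewrite exprS invfM le_eqVlt; apply/orP; left; apply/eqP; field.
    by rewrite expf_neq0.
  have KB : K3 * c <= (K3 * c + M / 2 ^+ k) + K3 * c.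
    by rewrite lerDr addr_ge0 ?mulr_ge0 ?(ltW c0)// invr_ge0 exprn_ge0.
  apply: step => // u' uh'; apply: small_le (IH _ uh').
  by rewrite lerDl mulr_ge0// ltW.
(* The number of iterations depends on M, the resulting constant does not. *)
have [k Mk] : exists k, M / 2 ^+ k <= c.
  exists (Num.truncn (M / c)).+1; set k := _.+1.
  have z0 : 0 <= M / c by rewrite divr_ge0// ltW.
  have /andP[_ /ltW Mc] := Num.Theory.truncn_itv z0.
  rewrite ler_pdivrMr ?exprn_gt0// mulrC -ler_pdivrMr// (le_trans Mc)//.
  by rewrite -natrX ler_nat ltnW// ltn_expl.
move=> u uh; apply: small_le (iter k u uh).
by rewrite mulrDl mul1r lerD2l.
Qed.

Definition fpoly_approx p xi l Y V r f sigma (C : R) : Prop :=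
  exists2 q, fpoly p xi l Y V r q & small p (slab Y l sigma) (fun x => f x - q x) C.

(** The finiteness hypothesis is placed on a slab r + 1 times wider because each descent in r takes
    one more difference of f with a step up to sigma. The bound M does not affect C. *)
Theorem whitney_flow p r : (0 < p)%E -> forall sigma, 0 < sigma ->
  exists2 sigma' : R, 0 < sigma' <= sigma & exists2 C : R, 0 <= C &
  forall xi l Y V f e, flow_box xi l Y -> flow_class xi l V -> V f -> 0 < e ->
  (exists M, small p (slab Y l (r.+1%:R * sigma)) f M) ->
  (forall hs, size hs = r -> (forall h, h \in hs -> `|h| <= sigma) ->
    small p (slab Y l sigma) (mixed xi hs f) e) ->
  fpoly_approx p xi l Y V r f sigma' (C * e).
Proof.
move=> p0; elim: r => [|r IH] sigma s0.
  exists sigma; first by rewrite s0 lexx.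
  exists 1 => // xi l Y V f e _ _ Vf e0 _ /(_ [::] erefl)fe.
  exists (fun=> 0); first exact: fpoly0.
  by rewrite mul1r; apply: small_eq (fe _) => // x _; rewrite /= subr0.
have [s1 /andP[s10 s1s] [C1 C10 H1]] := IH sigma s0.
have [N N0 [K1 K10 HK1]] := @first_step_small p p0.
have [K2 K20 HK2] := @second_step_small R d p r N p0.
(* Small enough that all shifts in [second_step_small] and [first_step_small] keep the half slab
   inside the slab of half-width [s1]. *)
pose h := s1 / 2 / (N + r + 3)%:R.
have Nr0 : 0 < (N + r + 3)%:R :> R by rewrite ltr0n addnS.
have h0 : 0 < h by rewrite !divr_gt0.
have hs1 : (N + r + 3)%:R * h <= s1 / 2 by rewrite /h mulrC divfK// gt_eqF.
have hs1' : N%:R * h + r%:R * h + 3 * h <= s1 / 2 by move: hs1; rewrite !natrD; lra.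
have Nh0 : 0 <= N%:R * h by rewrite mulr_ge0// ltW.
have rh0 : 0 <= r%:R * h by rewrite mulr_ge0// ltW.
have h2s : 0 < h / 2 <= sigma by rewrite divr_gt0//=; lra.
exists (h / 2) => //.
exists (3 * ((K1 + 1) * (C1 + K2 * C1 + 1))).
  by rewrite !mulr_ge0// !addr_ge0// mulr_ge0.
move=> xi l Y V f e fb cV Vf e0 [M fM] fe.
have mS z : measurable (slab Y l z).
  by apply: measurable_slab; [exact: (fb_mY fb)|exact: (fb_ml fb)].
have mf := fc_m cV Vf.
have hsig : h <= sigma by lra.
have rs0 : r%:R * sigma >= 0 by rewrite mulr_ge0// ltW.
have rsE : r.+2%:R * sigma = r%:R * sigma + 2 * sigma by rewrite -!natr1; ring.
have rsE1 : r.+1%:R * sigma = r%:R * sigma + sigma by rewrite -!natr1; ring.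
have finite_dstep f0 u rho M0 : measurable_fun setT f0 -> `|u| <= sigma ->
    rho <= r.+1%:R * sigma -> small p (slab Y l (r.+2%:R * sigma)) f0 M0 ->
    small p (slab Y l rho) (dstep xi u f0) (quasi_const p 2 1 * M0).
  move=> mf0 us rr fM0.
  apply: (@small2 _ _ _ _ _ (fun x => f0 (x + u *: xi)) (fun x => f0 (x + 0 *: xi))) => //.
  - exact: measurable_dstep.
  - exact: measurable_shift.
  - exact: measurable_shift.
  - by move=> x _; rewrite mul1r /dstep scale0r addr0 ler_normB.
  - by apply: small_flow fM0 => //; lra.
  - by apply: small_flow fM0 => //; rewrite normr0; lra.
have [qh fqh hqh] : fpoly_approx p xi l Y V r (dstep xi h f) s1 (C1 * e).
  apply: H1 => //; first exact: (fc_dstep _ cV).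
    exists (quasi_const p 2 1 * M); apply: finite_dstep => //; by rewrite gtr0_norm.
  move=> hs hs_size hs_le; apply: (fe (h :: hs)); first by rewrite /= hs_size.
  by move=> k; rewrite inE => /predU1P[->|/hs_le//]; rewrite gtr0_norm.
(* The discrete primitive q has Delta_h q = [qh], so Delta_h (f - q) is small. *)
have [q fq qE] := fpoly_step_surj fb (lt0r_neq0 h0) fqh.
have Vq := fpoly_V cV Vf fq.
pose f1 x := f x - q x.
have Vf1 : V f1 by exact: (fc_B cV).
have mf1 := fc_m cV Vf1.
have [Mq qM] := fpoly_finite p0 fb cV (r.+2%:R * sigma) (ex_intro _ f Vf) fq.
have M0 := small_ge0 fM; have Mq0 := small_ge0 qM.
pose M1 := quasi_const p 2 1 * (M + Mq).
have f1M : small p (slab Y l (r.+2%:R * sigma)) f1 M1.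
  apply: (@small2 _ _ _ _ _ f q) => //.
  - exact: (fc_m cV).
  - by move=> x _; rewrite mul1r ler_normB.
  - by apply: small_le fM; rewrite lerDl.
  - by apply: small_le qM; rewrite lerDr.
have sg1 : small p (slab Y l s1) (dstep xi h f1) (C1 * e).
  by apply: small_eq hqh => x _; rewrite -qE /dstep /f1; ring.
pose c := (C1 + K2 * C1 + 1) * e.
have KC0 : 0 <= K2 * C1 by rewrite mulr_ge0.
have c0 : 0 < c by rewrite mulr_gt0//; lra.
have sg2 u v : 0 <= u <= h -> `|v| <= N%:R * h ->
    small p (slab Y l (s1 / 2)) (dstep xi v (dstep xi u f1)) c.
  move=> /andP[u0 uh] vN.
  have us : `|u| <= sigma by rewrite ger0_norm//; lra.
  have [pu fpu hpu] : fpoly_approx p xi l Y V r (dstep xi u f1) s1 (C1 * e).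
    apply: H1 => //; first exact: (fc_dstep _ cV).
      by exists (quasi_const p 2 1 * M1); exact: finite_dstep.
    move=> hs hs_size hs_le.
    apply: (@small_eq _ _ _ _ (mixed xi (u :: hs) f)); last first.
      apply: fe; first by rewrite /= hs_size.
      by move=> k; rewrite inE => /predU1P[->|/hs_le//].
    (* Since q has degree < r + 1 along xi, r + 1 differences annihilate it: [f1] inherits the
       hypothesis on f. *)
    move=> x _; rewrite -[RHS]/(mixed xi (u :: hs) f1 x) mixedB.
    by rewrite (@mixed_fpoly0 _ _ p xi l Y V fb (u :: hs) q) ?subr0//= hs_size.
  apply: (@small_le _ _ _ _ _ (K2 * (C1 * e))).
    by rewrite mulrA /c ler_wpM2r ?(ltW e0)//; lra.
  by apply: (HK2 _ _ _ V _ pu _ _ h) => //; rewrite ger0_norm.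
have s1f u : `|u| <= h -> small p (slab Y l (s1 / 2)) (dstep xi u f1) (quasi_const p 2 1 * M1).
  by move=> uh; apply: finite_dstep => //; lra.
have sf1 u : 0 <= u <= h -> small p (slab Y l (s1 / 2)) (dstep xi u f1) (K1 * c).
  apply: (HK1 _ _ _ V _ h _ c (quasi_const p 2 1 * M1)) => //.
  - by rewrite natrD; lra.
  - by apply: small_le sg1; rewrite /c ler_wpM2r ?(ltW e0)//; lra.
  - by move=> u' /andP[u0 uh]; apply: s1f; rewrite ger0_norm.
have sf1' u : `|u| <= 2 * (h / 2) -> small p (slab Y l (h / 2)) (dstep xi u f1) (K1 * c + c).
  rewrite mulrC divfK// => uh.
  have c1 : K1 * c <= K1 * c + c by rewrite lerDl ltW.
  apply: small_le c1 _; have [u0|u0] := leP 0 u.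
    apply: small_sub (sf1 u _) => //; first exact: measurable_dstep.
      move=> x [Yx lx]; split => //; lra.
    by rewrite u0 -[u]ger0_norm.
  rewrite ltr0_norm// in uh.
  have huN : 0 <= - u <= h by rewrite uh oppr_ge0 ltW.
  (* Negative steps reduce to positive ones: Delta_u f1 at x is - Delta_(-u) f1 at x + u xi. *)
  apply: (@small_eq _ _ _ _ (fun x => (fun y => - dstep xi (- u) f1 y) (x + u *: xi))).
    move=> x _; rewrite /dstep opprB scaleNr addrK//.
  apply: (@small_flow _ _ _ _ _ _ (s1 / 2) _ (fun y => - dstep xi (- u) f1 y) u) => //.
  - by apply: measurable_funN; exact: measurable_dstep.
  - by rewrite ltr0_norm//; lra.
  - have -> : K1 * c = quasi_const p 1 1 * (K1 * c) by rewrite quasi_const11 mul1r.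
    apply: (@small_dom _ _ _ 1 1 _ _ (fun=> dstep xi (- u) f1)) => //.
    + by rewrite mulr_ge0// ltW.
    + by apply: measurable_funN; exact: measurable_dstep.
    + by move=> _; exact: measurable_dstep.
    + by move=> x _; rewrite mul1r big_ord1 normrN.
    + by move=> _; exact: sf1.
have Kc0 : 0 < K1 * c + c by rewrite ltr_wpDl// mulr_ge0// ltW.
have [|s sh sa] := @exists_good_section R d p xi l Y f1 (h / 2) (K1 * c + c) p0 _ Kc0
    (fb_ml fb) (fb_l fb) (fb_mY fb) (fb_Y fb) mf1 sf1'; first by rewrite divr_gt0.
have Va : V (fun x => f1 (fproj xi l s x)) by exact: (fc_proj cV).
have ia x t : f1 (fproj xi l s (x + t *: xi)) = f1 (fproj xi l s x).
  by rewrite /fproj (fb_l fb) -addrA -scalerDl; congr (f1 (_ + _ *: _)); ring.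
(* The value of [f1] on the good level is constant along xi and enters as a coefficient of degree
   0. *)
exists (fun x => f1 (fproj xi l s x) * (1%:P).[l x] + q x).
  apply: fpoly_add => //; first by rewrite size_poly1.
  move=> rho; have Kc1 := ltW Kc0.
  apply: (@invariant_finite _ _ p xi l Y V p0 fb cV _ (h / 2)
    (quasi_const p 2 1 * (M1 + 3 * (K1 * c + c)))) => //; first by rewrite divr_gt0.
  have M10 := small_ge0 f1M.
  apply: (@small2 _ _ _ _ _ f1 (fun x => f1 x - f1 (fproj xi l s x))) => //.
  - exact: (fc_m cV).
  - by apply: (fc_m cV); exact: (fc_B cV).
  - move=> x _; rewrite mul1r; set z := f1 _.
    by rewrite (le_trans _ (ler_normB _ _))// opprB addrCA subrr addr0.
  - apply: small_le (small_sub p0 _ _ _ _ f1M) => //; first by rewrite lerDl mulr_ge0.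
    by move=> x [Yx lx]; split => //; lra.
  - by apply: small_le sa; rewrite lerDr.
apply: (@small_eq _ _ _ _ (fun x => f1 x - f1 (fproj xi l s x))).
  by move=> x _; rewrite hornerC mulr1 /f1; ring.
by apply: small_le sa; rewrite /c le_eqVlt; apply/orP; left; apply/eqP; ring.
Qed.

End flow_whitney_theorem.

(** * Functions polynomial in several directions *)

Section tensor.
Context {R : realType} {d : nat}.
Implicit Types (p : \bar R) (f g a c h : 'rV[R]_d -> R) (x xi : 'rV[R]_d).
Implicit Types (xis : 'I_d -> 'rV[R]_d) (ls : 'I_d -> 'rV[R]_d -> R) (k : nat).

(** Coordinates adapted to the directions; an additive offset is allowed, so that a box may have any
    centre. *)
Record dir_coords xis ls : Prop := DirCoords {
  dc_cont : forall i, continuous (ls i);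
  dc_l : forall i j x t, ls i (x + t *: xis j) = ls i x + (if i == j then t else 0);
  dc_span : forall x, exists b : 'I_d -> R, x = \sum_j b j *: xis j }.

Definition cbox ls rho : set 'rV[R]_d := [set x | forall i, `|ls i x| <= rho].

Definition lead_poly xis r k c : Prop := forall x (j : 'I_d), (j < k)%N ->
  exists2 P : {poly R}, (size P <= r)%N & forall t, c (x + t *: xis j) = P.[t].

Definition lead_inv xis k h : Prop := forall x (j : 'I_d) t, (j < k)%N ->
  h (x + t *: xis j) = h x.

(** Intermediate stage after k directions: the factor c is regular and already polynomial along
    them, while h may be irregular but ignores them. For k = 0 this is no restriction, for k = d
    each h is constant. *)
Inductive sep xis r k : ('rV[R]_d -> R) -> Prop :=
| sep0 : sep xis r k (fun=> 0)
| sep_add c h f : continuous c -> lead_poly xis r k c -> lead_inv xis k h ->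
    sep xis r k f -> sep xis r k (fun x => c x * h x + f x).

Definition sepm xis r k f : Prop := measurable_fun setT f /\ sep xis r k f.

Section sep_theory.
Variables (xis : 'I_d -> 'rV[R]_d) (ls : 'I_d -> 'rV[R]_d -> R) (r : nat).
Hypothesis dc : dir_coords xis ls.

Lemma sep_D k f g : sep xis r k f -> sep xis r k g -> sep xis r k (fun x => f x + g x).
Proof.
move=> + sg; elim=> [|c h {}f cc cP hi sf IH].
  by under eq_fun do rewrite add0r.
by under eq_fun do rewrite -addrA; exact: sep_add.
Qed.

Lemma lead_polyZ k c (w : 'rV[R]_d -> R) : lead_poly xis r k c -> lead_inv xis k w ->
  lead_poly xis r k (fun x => w x * c x).
Proof.
move=> cP wi x j jk; have [P sP PE] := cP x j jk.
exists (w x *: P); first by rewrite (leq_trans (size_scale_leq _ _)).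
by move=> t; rewrite hornerZ -PE wi.
Qed.

Lemma sep_M k f w : continuous w -> lead_inv xis k w -> sep xis r k f ->
  sep xis r k (fun x => w x * f x).
Proof.
move=> cw wi; elim=> [|c h {}f cc cP hi sf IH].
  by under eq_fun do rewrite mulr0; exact: sep0.
under eq_fun do rewrite mulrDr mulrA; apply: sep_add => //.
  by move=> x; apply: continuousM; [exact: cw|exact: cc].
exact: lead_polyZ.
Qed.

Lemma sep_comp k f (phi : 'rV[R]_d -> 'rV[R]_d) : continuous phi ->
  (forall x (j : 'I_d) t, (j < k)%N -> phi (x + t *: xis j) = phi x + t *: xis j) ->
  sep xis r k f -> sep xis r k (fun x => f (phi x)).
Proof.
move=> cphi phiD; elim=> [|c h {}f cc cP hi sf IH]; first exact: sep0.
apply: (@sep_add _ _ _ (fun x => c (phi x)) (fun x => h (phi x))) => //.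
- move=> x; exact: (@continuous_comp _ _ _ phi c x (cphi x) (cc (phi x))).
- move=> x j jk; have [P sP PE] := cP (phi x) j jk; exists P => // t.
  by rewrite phiD.
- by move=> x j t jk; rewrite phiD// hi.
Qed.

Lemma continuous_fproj i s : continuous (fproj (xis i) (ls i) s).
Proof.
move=> x; apply: (@continuousD _ _ _ id (fun y => (s - ls i y) *: xis i)); first exact: cvg_id.
apply: continuousZr_tmp; apply: (@continuousB _ _ _ (fun=> s) (ls i)); first exact: cst_continuous.
exact: (dc_cont dc).
Qed.

Lemma continuous_poly_coord i (b : {poly R}) : continuous (fun x => b.[ls i x]).
Proof.
move=> x; apply: (@continuous_comp _ _ _ (ls i) (horner b)); first exact: (dc_cont dc).
exact: continuous_horner.
Qed.

Lemma fproj_lead k (i : 'I_d) s : (k <= i)%N -> forall x (j : 'I_d) t, (j < k)%N ->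
  fproj (xis i) (ls i) s (x + t *: xis j) = fproj (xis i) (ls i) s x + t *: xis j.
Proof.
move=> ki x j t jk; rewrite /fproj (dc_l dc) ifN ?addr0 1?addrAC//.
by apply: contraTneq jk => <-; rewrite -leqNgt.
Qed.

Lemma poly_coord_lead k (i : 'I_d) (b : {poly R}) : (k <= i)%N ->
  lead_inv xis k (fun x => b.[ls i x]).
Proof.
move=> ki x j t jk; rewrite (dc_l dc) ifN ?addr0//.
by apply: contraTneq jk => <-; rewrite -leqNgt.
Qed.

Lemma measurable_poly_coord i (b : {poly R}) : measurable_fun setT (fun x => b.[ls i x]).
Proof. by apply: continuous_measurable_rV; exact: continuous_poly_coord. Qed.

(** Flowing along xis i, projecting along it and multiplying by functions of ls i commute with, or
    ignore, motion along the first k directions. *)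
Lemma sepm_flow_class k (i : 'I_d) : (k <= i)%N ->
  flow_class (xis i) (ls i) (sepm xis r k).
Proof.
move=> ki; have ml := continuous_measurable_rV (dc_cont dc (i := i)).
split.
- by move=> f [].
- move=> f g [mf sf] [mg sg]; split; first exact: measurable_funB.
  rewrite (_ : (fun _ => _) = (fun x => f x + (-1) * g x)); last first.
    by apply/funext => x; rewrite mulN1r.
  apply: sep_D => //; apply: sep_M => //; move=> x; exact: cst_continuous.
- move=> f t [mf sf]; split; first exact: measurable_shift.
  apply: (@sep_comp k f (fun x => x + t *: xis i)) => //.
    move=> x; apply: (@continuousD _ _ _ id (fun=> t *: xis i)); first exact: cvg_id.
    exact: cst_continuous.
  by move=> x j u jk; rewrite addrAC.
- move=> f b [mf sf]; split.
    by apply: measurable_funM => //; exact: measurable_poly_coord.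
  under eq_fun do rewrite mulrC; apply: sep_M => //; first exact: continuous_poly_coord.
  exact: poly_coord_lead.
- move=> f s [mf sf]; split.
    by apply: (measurableT_comp mf); exact: measurable_fproj.
  by apply: sep_comp => //; [exact: continuous_fproj|exact: fproj_lead].
Qed.

(** Composition with the projection onto the level 0 makes all factors independent of the i-th
    coordinate, and b(ls i) is absorbed into the regular factor c. *)
Lemma sep_invariant k (i : 'I_d) a (b : {poly R}) : k = i -> (size b <= r)%N ->
  sep xis r k a -> sep xis r k.+1 (fun x => a (fproj (xis i) (ls i) 0 x) * b.[ls i x]).
Proof.
move=> ki sb; elim=> [|c h {}a cc cP hi sf IH].
  by under eq_fun do rewrite mul0r; exact: sep0.
have fi x t : fproj (xis i) (ls i) 0 (x + t *: xis i) = fproj (xis i) (ls i) 0 x.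
  rewrite /fproj (dc_l dc) eqxx -addrA -scalerDl; congr (_ + _ *: _); ring.
have ki' : (k <= i)%N by rewrite ki.
pose pr := fproj (xis i) (ls i) 0.
rewrite (_ : (fun _ => _) = (fun x => (b.[ls i x] * c (pr x)) * h (pr x) +
   a (pr x) * b.[ls i x])); last by apply/funext => x; rewrite /pr; ring.
apply: sep_add IH.
- move=> x; apply: (@continuousM _ _ (fun x => b.[ls i x]) (fun x => c (pr x))).
    exact: continuous_poly_coord.
  by apply: (@continuous_comp _ _ _ pr c); [exact: continuous_fproj|exact: cc].
- move=> x j; rewrite ltnS leq_eqVlt => /predU1P[jk|jk].
    have -> : j = i by apply: val_inj; rewrite /= jk.
    exists (c (pr x) *: (b \Po ('X + (ls i x)%:P))) => [|t].
      rewrite (leq_trans (size_scale_leq _ _))//.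
      have [->|b0] := eqVneq b 0; first by rewrite comp_poly0 size_poly0.
      rewrite (leq_trans (size_comp_poly_leq _ _))// size_XaddC muln1 prednK//.
      by rewrite size_poly_gt0.
    by rewrite /pr fi hornerZ horner_comp hornerD hornerX hornerC (dc_l dc) eqxx mulrC [t + _]addrC.
  apply: (lead_polyZ (k := k) (c := fun x => c (pr x)) (w := fun x => b.[ls i x])) => //.
    2: exact: poly_coord_lead.
  move=> y m mk; have [P sP PE] := cP (pr y) m mk; exists P => // t.
  by rewrite /pr (fproj_lead (k := k)).
- move=> x j t; rewrite ltnS leq_eqVlt => /predU1P[jk|jk].
    have -> : j = i by apply: val_inj; rewrite /= jk.
    by rewrite /pr fi.
  by rewrite /pr (fproj_lead (k := k))// hi.
Qed.

Lemma sep_fpoly p Y k (i : 'I_d) q : k = i ->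
  fpoly p (xis i) (ls i) Y (sepm xis r k) r q -> sep xis r k.+1 q.
Proof.
move=> ki; elim=> [|a b {}q [ma sa] ia sb _ _ sq]; first exact: sep0.
apply: sep_D => //.
have -> : (fun x => a x * b.[ls i x]) = (fun x => a (fproj (xis i) (ls i) 0 x) * b.[ls i x]).
  by apply/funext => x; rewrite /fproj ia.
exact: sep_invariant.
Qed.

Lemma lead_inv_cst h x : lead_inv xis d h -> h x = h 0.
Proof.
move=> hi; have [b ->] := dc_span dc x.
elim: (index_enum _) => [|j s IH]; first by rewrite big_nil.
by rewrite big_cons addrC hi.
Qed.

(** The irregular factors are invariant along a spanning set, hence constant; this is how continuity
    appears although the sections of f are merely measurable. *)
Lemma sep_dir_poly q : sep xis r d q -> continuous q /\ lead_poly xis r d q.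
Proof.
elim=> [|c h f cc cP hi sf [cf fP]].
  split; first by move=> x; exact: cst_continuous.
  by move=> x j jd; exists 0; rewrite ?size_poly0// => t; rewrite horner0.
have hc x : h x = h 0 by exact: lead_inv_cst.
split.
  move=> x; rewrite (_ : (fun _ => _) = (fun x => c x * h 0 + f x)).
    apply: (@continuousD _ _ _ (fun x => c x * h 0) f); last exact: cf.
    by apply: (@continuousM _ _ c (fun=> h 0)); [exact: cc|exact: cst_continuous].
  by apply/funext => y; rewrite hc.
move=> x j jd; have [P sP PE] := cP x j jd; have [Q sQ QE] := fP x j jd.
exists (h 0 *: P + Q) => [|t]; last by rewrite hc PE QE hornerD hornerZ mulrC.
by rewrite (leq_trans (size_polyD _ _))// geq_max sQ andbT (leq_trans (size_scale_leq _ _)).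
Qed.

End sep_theory.

End tensor.

(** * The Whitney inequality on a parallelepiped *)

Section tensor_whitney.
Context {R : realType} {d : nat}.
Implicit Types (p : \bar R) (f g : 'rV[R]_d -> R) (x xi : 'rV[R]_d) (A G : set 'rV[R]_d).
Implicit Types (xis : 'I_d -> 'rV[R]_d) (ls : 'I_d -> 'rV[R]_d -> R) (k : nat).

Lemma small_sum_seq p (T : eqType) (s : seq T) A f (g : T -> 'rV[R]_d -> R) e :
  (0 < p)%E -> 0 <= e -> measurable A -> measurable_fun setT f ->
  (forall t, measurable_fun setT (g t)) ->
  (forall x, A x -> `|f x| <= \sum_(t <- s) `|g t x|) ->
  (forall t, t \in s -> small p A (g t) e) -> small p A f (quasi_const p (size s) 1 * e).
Proof.
move=> p0 e0 mA mf mg fg ge.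
apply: (@small_dom _ _ _ _ _ _ _ (fun i => g (tnth (in_tuple s) i))) => //.
  by move=> x Ax; rewrite mul1r; have := fg x Ax; rewrite big_tnth.
by move=> i; apply: ge; exact: mem_tnth.
Qed.

Lemma measurable_diff_domain r (h : 'rV[R]_d) G : measurable G ->
  measurable (diff_domain r h G).
Proof.
move=> mG; rewrite (_ : diff_domain r h G =
    \bigcap_(j in [set j : nat | (j <= r)%N]) (fun x => x + h *+ j) @^-1` G).
  apply: bigcap_measurable => [|j _]; first by exists 0%N.
  by rewrite -[X in measurable X]setTI; exact: measurable_addl_rV.
by [].
Qed.

Lemma measurable_fin_diff r (h : 'rV[R]_d) f : measurable_fun setT f ->
  measurable_fun setT (fin_diff r h f).
Proof.
move=> mf; apply: measurable_sum => j; apply: measurable_funM => //.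
exact: measurable_shift.
Qed.

Lemma measurable_cbox ls rho : (forall i, continuous (ls i)) -> measurable (cbox ls rho).
Proof.
move=> cl; rewrite (_ : cbox ls rho = \bigcap_(i in [set: 'I_d]) slab setT (ls i) rho).
  apply: fin_bigcap_measurable => [|i _]; first exact: finite_finset.
  by apply: measurable_slab => //; exact: continuous_measurable_rV.
by apply/seteqP; split => x /= h i; [split => //; exact: h|have [] := h i Logic.I].
Qed.

(** The approximant Q for k directions is itself approximated along the next one. The box is
    normalised to half-width 1 in the coordinates [ls], so that sigma and C do not see its shape. *)
Theorem tensor_whitney p r k : (0 < p)%E -> (k <= d)%N ->
  exists2 sigma : R, 0 < sigma <= 1 & exists2 C : R, 0 <= C &
  forall xis ls f, dir_coords xis ls -> measurable_fun setT f ->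
  (exists M, small p (cbox ls 1) f M) ->
  (forall i u, small p (diff_domain r (u *: xis i) (cbox ls 1)) (fin_diff r (u *: xis i) f) 1) ->
  exists2 q, sepm xis r k q & small p (cbox ls sigma) (fun x => f x - q x) C.
Proof.
move=> p0; elim: k => [_|k IH kd].
  exists 1; first by rewrite ltr01 lexx.
  exists 0 => // xis ls f dc mf _ _; exists f; last first.
    have -> : (fun x => f x - f x) = fun=> 0 by apply/funext => x; rewrite subrr.
    apply: (@small_le _ _ _ _ _ (quasi_const p 0 1 * 0)); first by rewrite mulr0.
    apply: (@small_dom _ _ _ _ _ _ _ (fun _ => f)) => //.
    - exact: (measurable_cbox _ (dc_cont dc)).
    - by move=> x _; rewrite normr0 mulr_ge0// sumr_ge0.
    - by case.
  split => //; rewrite (_ : f = fun x => 1 * f x + 0); last first.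
    by apply/funext => x; rewrite mul1r addr0.
  by apply: sep_add => //; [move=> x; exact: cst_continuous|exact: sep0].
have [tau /andP[tau0 tau1] [C0 C00 HC0]] := IH (ltnW kd).
pose i := Ordinal kd.
(* The points x + (H - j H') xi met by [mixed_fin_diff] have |H| <= r sigma and |j H'| <= r * r
   sigma, so they stay in the box of half-width tau. *)
pose sigma := tau / (1 + r%:R + r%:R * r%:R).
have den0 : 1 <= 1 + r%:R + r%:R * r%:R :> R by rewrite -addrA lerDl addr_ge0// mulr_ge0.
have s0 : 0 < sigma by rewrite divr_gt0// (lt_le_trans ltr01).
have sE : sigma + r%:R * sigma + r%:R * (r%:R * sigma) = tau.
  have den1 : 1 + r%:R + r%:R * r%:R != 0 :> R by rewrite gt_eqF// (lt_le_trans ltr01).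
  by rewrite -[RHS](divfK den1) -/sigma; ring.
have [s' /andP[s'0 s's] [C1 C10 HC1]] := @whitney_flow R d p r p0 sigma s0.
pose e := quasi_const p 2 1 * (quasi_const p (2 ^ r) 1 * (1 + C0)) + 1.
have e0 : 0 < e.
  by rewrite /e ltr_wpDl// mulr_ge0 ?quasi_const_ge0// mulr_ge0 ?quasi_const_ge0// addr_ge0.
have rs0 : 0 <= r%:R * sigma by rewrite mulr_ge0// ltW.
have rrs0 : 0 <= r%:R * (r%:R * sigma) by rewrite mulr_ge0.
exists s'; first by rewrite s'0/=; lra.
exists (quasi_const p 2 1 * (C0 + C1 * e)).
  by rewrite mulr_ge0 ?quasi_const_ge0// addr_ge0// mulr_ge0// ltW.
move=> xis ls f dc mf [M fM] fe.
have mB rho : measurable (cbox ls rho) by exact: (measurable_cbox _ (dc_cont dc)).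
have [Q VQ fQ] := HC0 xis ls f dc mf (ex_intro _ M fM) fe.
have [mQ sQ] := VQ.
pose Y := [set x | forall j, j != i -> `|ls j x| <= tau].
have mY : measurable Y.
  rewrite (_ : Y = \bigcap_(j in [set j : 'I_d | j != i]) slab setT (ls j) tau).
    apply: fin_bigcap_measurable => [|j _]; first exact: finite_finset.
    apply: measurable_slab => //; apply: continuous_measurable_rV; exact: (dc_cont dc).
  by apply/seteqP; split => x /= h j ji; [split => //; exact: h|have [] := h j ji].
have fb : flow_box (xis i) (ls i) Y.
  split => //.
  - by apply: continuous_measurable_rV; exact: (dc_cont dc).
  - by move=> x t; rewrite (dc_l dc) eqxx.
  - by move=> x t Yx j ji; rewrite (dc_l dc) (negbTE ji) addr0; exact: Yx.
have cV := @sepm_flow_class R d xis ls r dc k i (leqnn k).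
have slab_cbox rho : rho <= tau -> slab Y (ls i) rho `<=` cbox ls tau.
  move=> rt x [Yx lx] j; have [->|ji] := eqVneq j i; first exact: le_trans lx rt.
  exact: Yx.
have cbox_le rho rho' : rho <= rho' -> cbox ls rho `<=` cbox ls rho'.
  by move=> rr x hx j; exact: le_trans (hx j) rr.
have mS rho : measurable (slab Y (ls i) rho).
  by apply: measurable_slab => //; exact: (fb_ml fb).
have mfQ : measurable_fun setT (fun x => f x - Q x) by exact: measurable_funB.
have finQ : exists M, small p (slab Y (ls i) (r.+1%:R * sigma)) Q M.
  have M0 := small_ge0 fM.
  exists (quasi_const p 2 1 * (M + C0)).
  have Slt : slab Y (ls i) (r.+1%:R * sigma) `<=` cbox ls tau.
    by apply: slab_cbox; rewrite -natr1; lra.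
  apply: (@small2 _ _ _ _ _ f (fun x => f x - Q x)) => //.
  - by move=> x _; rewrite mul1r -[X in `|X| <= _](subKr (f x)) ler_normB.
  - apply: small_le (small_sub p0 (mB 1) _ mf _ fM) => //; first by rewrite lerDl.
    by apply: (subset_trans Slt); exact: cbox_le.
  - by apply: small_le (small_sub p0 (mB tau) _ mfQ _ fQ) => //; rewrite lerDr.
have hsum (hs : seq R) : size hs = r -> (forall h, h \in hs -> `|h| <= sigma) ->
    \sum_(pr <- ksteps hs) `|pr.1| <= r%:R * sigma /\
    \sum_(pr <- ksteps hs) `|pr.2| <= r%:R * sigma.
  move=> sz hle.
  have rsE : r%:R * sigma = \sum_(0 <= j < r) sigma.
    by rewrite sumr_const_nat subn0 mulr_natl.
  rewrite /ksteps !big_map sz rsE /index_iota subn0 !(big_seq _ _ (iota 0 r)).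
  split; apply: ler_sum => j; rewrite mem_iota add0n => /andP[_ jr] /=.
    by apply: hle; rewrite mem_nth// sz.
  rewrite -[leRHS]mulr1 normrM ler_pM//.
    by apply: hle; rewrite mem_nth// sz.
  by rewrite normfV normr_nat invf_le1 ?ler1n.
(* The mixed difference of Q is that of f, small by Kemperman's identity, minus that of f - Q, small
   term by term. *)
have mixQ hs : size hs = r -> (forall h, h \in hs -> `|h| <= sigma) ->
    small p (slab Y (ls i) sigma) (mixed (xis i) hs Q) e.
  move=> sz hle; have [hs1 hs2] := hsum hs sz hle.
  have szk : size (kterms (ksteps hs)) = (2 ^ r)%N.
    by rewrite size_kterms size_map size_iota sz.
  have smf : small p (slab Y (ls i) sigma) (mixed (xis i) hs f) (quasi_const p (2 ^ r) 1 * 1).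
    rewrite -szk; apply: (@small_sum_seq _ _ _ _ _ (fun t x =>
       fin_diff r ((- t.2) *: xis i) f (x + t.1.2 *: xis i))) => //.
    - exact: measurable_mixed.
    - by move=> t; apply: measurable_shift; exact: measurable_fin_diff.
    - move=> x _; rewrite mixed_fin_diff sz (le_trans (ler_norm_sum _ _ _))//.
      rewrite !big_seq; apply: ler_sum => t /kterms_bound[t1 _ _].
      by rewrite !normrM t1 mulr1 normrX normrN1 expr1n mul1r.
    - move=> t /kterms_bound[_ t2 t3].
      apply: (small_shift p0 _ _ _ _ (fe i (- t.2))) => //.
      + exact: measurable_diff_domain.
      + exact: measurable_fin_diff.
      move=> x [Yx lx] j jr j'; rewrite -addrA -scaler_nat scalerA -scalerDl (dc_l dc).
      have [->|ji] := eqVneq j' i; last by rewrite addr0 (le_trans (Yx _ ji)).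
      rewrite (le_trans (ler_normD _ _))// mulrN.
      have := ler_normB t.1.2 (j%:R * t.2); rewrite normrM normr_nat.
      have : j%:R * `|t.2| <= r%:R * (r%:R * sigma).
        by rewrite ler_pM ?ler_nat// (le_trans t3).
      have := le_trans t2 hs1; lra.
  have smQ : small p (slab Y (ls i) sigma) (mixed (xis i) hs (fun x => f x - Q x))
      (quasi_const p (2 ^ r) 1 * C0).
    rewrite -szk; apply: (@small_sum_seq _ _ _ _ _ (fun t x =>
       f (x + t.1.2 *: xis i) - Q (x + t.1.2 *: xis i))) => //.
    - exact: measurable_mixed.
    - by move=> t; apply: measurable_funB; exact: measurable_shift.
    - move=> x _; rewrite mixed_expand (le_trans (ler_norm_sum _ _ _))//.
      rewrite !big_seq; apply: ler_sum => t /kterms_bound[t1 _ _].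
      by rewrite !normrM t1 mul1r.
    - move=> t /kterms_bound[_ t2 _].
      apply: (@small_shift _ _ _ (cbox ls tau) _ (fun x => f x - Q x)) => //.
      move=> x [Yx lx] j'; rewrite (dc_l dc).
      have [->|ji] := eqVneq j' i; last by rewrite addr0 (le_trans (Yx _ ji)).
      rewrite (le_trans (ler_normD _ _))//.
      have := le_trans t2 hs1; lra.
  have K0 := quasi_const_ge0 p (2 ^ r) (1 : R).
  apply: (@small_le _ _ _ _ _ (quasi_const p 2 1 * (quasi_const p (2 ^ r) 1 * (1 + C0)))).
    by rewrite /e lerDl.
  apply: (@small2 _ _ _ _ _ (mixed (xis i) hs f)
    (mixed (xis i) hs (fun x => f x - Q x))) => //; try exact: measurable_mixed.
  - move=> x _; rewrite mul1r mixedB; set a := mixed _ _ f x; set b := mixed _ _ Q x.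
    by rewrite -[X in `|X| <= _](subKr a) ler_normB.
  - by apply: small_le smf; rewrite ler_wpM2l// lerDl.
  - by apply: small_le smQ; rewrite ler_wpM2l// lerDr.
have [q fq Qq] := HC1 _ _ _ _ Q e fb cV VQ e0 finQ mixQ.
have Vq := fpoly_V cV VQ fq.
exists q.
  split; first by case: Vq.
  exact: (@sep_fpoly R d xis ls r dc p Y k i q erefl fq).
have [mq _] := Vq.
have s'tau : cbox ls s' `<=` cbox ls tau by apply: cbox_le; lra.
apply: (@small2 _ _ _ _ _ (fun x => f x - Q x) (fun x => Q x - q x)) => //.
- exact: measurable_funB.
- exact: measurable_funB.
- by move=> x _; rewrite mul1r (le_trans _ (ler_normD _ _))// addrA subrK.
- apply: small_le (small_sub p0 (mB tau) _ mfQ _ fQ) => //.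
  by rewrite lerDl mulr_ge0// ltW.
- apply: small_le (small_sub p0 (mS s') _ _ _ Qq) => //; first by rewrite lerDr.
    exact: measurable_funB.
  move=> x hx; split; last exact: hx.
  by move=> j _; exact: s'tau.
Qed.

End tensor_whitney.

(** * Euclidean geometry *)

Section euclidean_norm.
Context {R : realType} {d : nat}.
Implicit Types (x y z : 'rV[R]_d) (t : R).

Lemma dotpC x y : dotp x y = dotp y x.
Proof. by apply: eq_bigr => i _; rewrite mulrC. Qed.

Lemma dotpDl x y z : dotp (x + y) z = dotp x z + dotp y z.
Proof. by rewrite /dotp -big_split/=; apply: eq_bigr => i _; rewrite mxE mulrDl. Qed.

Lemma dotpZl t x z : dotp (t *: x) z = t * dotp x z.
Proof. by rewrite /dotp mulr_sumr; apply: eq_bigr => i _; rewrite mxE mulrA. Qed.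

Lemma dotpDr x y z : dotp z (x + y) = dotp z x + dotp z y.
Proof. by rewrite dotpC dotpDl !(dotpC z). Qed.

Lemma dotpZr t x z : dotp z (t *: x) = t * dotp z x.
Proof. by rewrite dotpC dotpZl dotpC. Qed.

Lemma dotp_ge0 x : 0 <= dotp x x.
Proof. by apply: sumr_ge0 => i _; rewrite -expr2 sqr_ge0. Qed.

Lemma dotp_eq0 x : dotp x x = 0 -> x = 0.
Proof.
move=> /eqP; rewrite psumr_eq0 => [/allP h|i _]; last by rewrite -expr2 sqr_ge0.
apply/rowP => i; rewrite mxE; apply/eqP; rewrite -sqrf_eq0 expr2.
by apply: h; rewrite mem_index_enum.
Qed.

Lemma enorm_ge0 x : 0 <= enorm x.
Proof. exact: sqrtr_ge0. Qed.

Lemma enorm_sqr x : enorm x ^+ 2 = dotp x x.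
Proof. by rewrite sqr_sqrtr// dotp_ge0. Qed.

Lemma enorm_le x (rho : R) : 0 <= rho -> (enorm x <= rho) = (dotp x x <= rho ^+ 2).
Proof. by move=> r0; rewrite -enorm_sqr ler_sqr// nnegrE enorm_ge0. Qed.

Lemma enormZ t x : enorm (t *: x) = `|t| * enorm x.
Proof. by rewrite /enorm dotpZl dotpZr mulrA -expr2 sqrtrM ?sqr_ge0// sqrtr_sqr. Qed.

Lemma enormN x : enorm (- x) = enorm x.
Proof. by rewrite -scaleN1r enormZ normrN1 mul1r. Qed.

Lemma enorm0 : enorm (0 : 'rV[R]_d) = 0.
Proof. by rewrite -(scale0r (0 : 'rV[R]_d)) enormZ normr0 mul0r. Qed.

Lemma enorm_eq0 x : enorm x = 0 -> x = 0.
Proof. by move=> x0; apply: dotp_eq0; rewrite -enorm_sqr x0 expr0n. Qed.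

(** Cauchy-Schwarz, from the square of (y.y) x - (x.y) y being nonnegative. *)
Lemma dotp_le x y : `|dotp x y| <= enorm x * enorm y.
Proof.
have [y0|y0] := eqVneq (enorm y) 0.
  by rewrite (enorm_eq0 y0) -(scale0r (0 : 'rV[R]_d)) dotpZr mul0r normr0 mulr_ge0 ?enorm_ge0.
have c0 : 0 < dotp y y by rewrite -enorm_sqr exprn_gt0// lt_neqAle eq_sym y0 enorm_ge0.
have := dotp_ge0 (dotp y y *: x + (- dotp x y) *: y).
rewrite dotpDl !dotpDr !dotpZl !dotpZr (dotpC y x) => h.
rewrite -[leLHS]ger0_norm// -ler_sqr ?nnegrE ?mulr_ge0 ?enorm_ge0// exprMn !enorm_sqr normr_id.
rewrite real_normK ?num_real// -subr_ge0 -(pmulr_rge0 _ c0).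
by apply: le_trans h _; rewrite le_eqVlt; apply/orP; left; apply/eqP; ring.
Qed.

Lemma enormD x y : enorm (x + y) <= enorm x + enorm y.
Proof.
rewrite enorm_le ?addr_ge0 ?enorm_ge0// dotpDl !dotpDr (dotpC y x) sqrrD !enorm_sqr.
have := le_trans (ler_norm _) (dotp_le x y); rewrite mulr2n; lra.
Qed.

Lemma enorm_sum (I : Type) (s : seq I) (F : I -> 'rV[R]_d) :
  enorm (\sum_(i <- s) F i) <= \sum_(i <- s) enorm (F i).
Proof.
elim: s => [|i s IH]; first by rewrite !big_nil enorm0.
by rewrite !big_cons (le_trans (enormD _ _))// lerD2l.
Qed.

Lemma coord_le_enorm x i : `|x ord0 i| <= enorm x.
Proof.
rewrite -ler_sqr ?nnegrE ?enorm_ge0// real_normK ?num_real// enorm_sqr /dotp (bigD1 i)//=.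
by rewrite -expr2 lerDl; apply: sumr_ge0 => j _; rewrite -expr2 sqr_ge0.
Qed.

Lemma enorm_le_coord x (m : R) : (forall i, `|x ord0 i| <= m) -> enorm x <= d%:R * m.
Proof.
move=> xm; have [d0|d0] := posnP d.
  rewrite (_ : x = 0) ?enorm0 ?d0 ?mul0r//; apply/rowP => i.
  by exfalso; move: (leq_trans (leq_ltn_trans (leq0n i) (ltn_ord i)) (eq_leq d0)).
have m0 : 0 <= m by exact: le_trans (xm (Ordinal d0)).
rewrite enorm_le ?mulr_ge0// /dotp.
apply: (@le_trans _ _ (\sum_(i < d) m ^+ 2)).
  apply: ler_sum => i _; rewrite -expr2 -[leLHS]real_normK ?num_real//.
  by rewrite ler_sqr ?nnegrE.
rewrite sumr_const card_ord -[_ *+ d]mulr_natl exprMn ler_wpM2r ?sqr_ge0// -natrX ler_nat.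
by rewrite -{1}(expn1 d) leq_pexp2l.
Qed.

Lemma measurable_eclosed_ball x (rho : R) : measurable (eclosed_ball x rho).
Proof.
have [r0|r0] := leP 0 rho; last first.
  rewrite (_ : eclosed_ball x rho = set0)//; apply/seteqP; split => // y /=.
  by rewrite /eclosed_ball/= leNgt (lt_le_trans r0 (enorm_ge0 _)).
rewrite (_ : eclosed_ball x rho = setT `&` (fun y => dotp (y - x) (y - x)) @^-1`
    `]-oo, rho ^+ 2]%classic); last first.
  by apply/seteqP; split => y; rewrite /eclosed_ball /= in_itv/= enorm_le//; case.
have mc (i : 'I_d) : measurable_fun setT (fun y : 'rV[R]_d => (y - x) ord0 i).
  under eq_fun do rewrite !mxE.
  by apply: measurable_funB => //; exact: measurable_rV_coord.
have : measurable_fun setT (fun y => dotp (y - x) (y - x)).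
  by apply: measurable_sum => i; exact: measurable_funM.
by apply => //; exact: measurable_itv.
Qed.

Lemma compact_diam (G : set 'rV[R]_d) x y : compact G -> G x -> G y -> enorm (x - y) <= diam G.
Proof.
move=> cG Gx Gy.
have [M [Mr HM]] := compact_bounded cG.
have bM z i : G z -> `|z ord0 i| <= M + 1.
  move=> Gz; have MM : M < M + 1 by rewrite ltrDl.
  have := HM (M + 1) MM z Gz; rewrite /= /Num.norm/= mx_normrE.
  by move=> /bigmax_leP[_ /(_ (ord0, i) isT)].
apply: ub_le_sup; last by exists x => //; exists y.
exists (d%:R * (M + 1 + (M + 1))) => _ [u Gu [v Gv <-]].
apply: enorm_le_coord => i; rewrite !mxE (le_trans (ler_normB _ _))// lerD//; exact: bM.
Qed.

End euclidean_norm.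

Section directions.
Context {R : realType} {d : nat}.
Implicit Types (xis : 'I_d -> 'rV[R]_d) (E : set 'rV[R]_d) (x w : 'rV[R]_d).

Record good_directions xis (e : R) : Prop := GoodDirections {
  gd_e : 0 < e <= 1;
  gd_unit : forall i, enorm (xis i) = 1;
  gd_dot : forall w, exists i, e * enorm w <= `|dotp (xis i) w| }.

Record coord_system xis (cf : 'I_d -> 'rV[R]_d -> R) (e : R) : Prop := CoordSystem {
  cs_add : forall i x y t, cf i (x + t *: y) = cf i x + t * cf i y;
  cs_xi : forall i j, cf i (xis j) = (i == j)%:R;
  cs_span : forall x, x = \sum_i cf i x *: xis i;
  cs_le : forall i x, `|cf i x| <= enorm x / e }.

(** Halving eps0 lets a near-maximal direction replace the maximum; the cap at 1 serves later
    estimates. *)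
Lemma directions_of E (eps0 : R) : (0 < d)%N -> 0 < eps0 ->
  independent_directions E -> eps0 <= minmax_dotp E ->
  exists xis, [/\ E = [set xis i | i in [set: 'I_d]], good_directions xis (Num.min (eps0 / 2) 1) &
    exists cf, coord_system xis cf (Num.min (eps0 / 2) 1)].
Proof.
move=> d0 e0 [E1 [s fs Es]] em; set e := Num.min _ _.
have ee : 0 < e <= 1 by rewrite /e lt_min divr_gt0//= ltr01 ge_min lexx orbT.
have /andP[e_gt0 e_le1] := ee.
pose xis i := tnth s i.
have EE : E = [set xis i | i in [set: 'I_d]].
  rewrite Es; apply/seteqP; split => x /=.
    by move=> /tnthP[i ->]; exists i.
  by move=> [i _ <-]; exact: mem_tnth.
have xi1 i : enorm (xis i) = 1 by apply: E1; rewrite EE; exists i.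
have xidot w : exists i, e * enorm w <= `|dotp (xis i) w|.
  have [w0|w0] := eqVneq (enorm w) 0.
    by exists (Ordinal d0); rewrite w0 mulr0.
  have wp : 0 < enorm w by rewrite lt_neqAle eq_sym w0 enorm_ge0.
  pose v := (enorm w)^-1 *: w.
  have v1 : unit_sphere v.
    by rewrite /unit_sphere/= /v enormZ gtr0_norm ?invr_gt0// mulVf.
  have : eps0 <= sup [set `|dotp xi v| | xi in E].
    apply: le_trans em _; apply: ge_inf; last by exists v.
    exists 0 => _ [x _ <-]; set S := [set _ | _ in _].
    have [hs|/sup_out->//] := pselect (has_sup S).
    have [[z [y Ey _]] Sub] := hs.
    by apply: le_trans (normr_ge0 (dotp y x)) _; apply: ub_le_sup => //; exists y.
  (* Without a genuine supremum [sup] would take its default value 0, below eps0. *)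
  move=> hsup; have hs : has_sup [set `|dotp xi v| | xi in E].
    apply: contrapT => /sup_out h0; move: hsup; rewrite h0 leNgt => /negP; exact.
  have [z [y Ey yz] hz] := sup_adherent (divr_gt0 e0 (ltr0Sn _ 1)) hs.
  move: Ey; rewrite EE => -[i _ iy]; exists i.
  have wE : w = enorm w *: v by rewrite /v scalerA divff// scale1r.
  rewrite [in X in _ <= X]wE dotpZr normrM (gtr0_norm wp) mulrC ler_wpM2l ?(ltW wp)//.
  rewrite (@le_trans _ _ (eps0 / 2))// ?ge_min ?lexx// iy yz; lra.
exists xis; split => //.
have spanS : span s = fullv :> {vspace _}.
  apply/eqP; rewrite eqEdim subvf /= (eqP (_ : \dim (span s) == size s))//.
  by rewrite size_tuple dimvf /dim/= mul1n.
pose cf (i : 'I_d) x := coord s i x.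
have cfspan x : x = \sum_i cf i x *: xis i.
  have xs : x \in span s by rewrite spanS memvf.
  by rewrite {1}(coord_span xs); apply: eq_bigr => i _; rewrite /xis (tnth_nth 0).
have cfD i x y t : cf i (x + t *: y) = cf i x + t * cf i y.
  by rewrite /cf linearD linearZ.
have cfxi i j : cf i (xis j) = (i == j)%:R.
  by rewrite /cf /xis (tnth_nth 0) coord_free// eq_sym.
exists cf; split => // i x.
(* The i-th coordinate is the inner product with [v], which pairs to 1 with xis i and to 0 with the
   other directions; testing [xidot] on [v] gives e |v| <= 1. *)
pose v := \row_j cf i (delta_mx 0 j).
have cfv y : cf i y = dotp v y.
  rewrite /cf {1}(row_sum_delta y) linear_sum/=; apply: eq_bigr => j _.
  by rewrite linearZ /= mxE mulrC.
have [j hj] := xidot v.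
rewrite cfv (le_trans (dotp_le _ _))// mulrC ler_wpM2l ?enorm_ge0//.
rewrite -[leRHS]mul1r ler_pdivlMr// mulrC (le_trans hj)// dotpC -cfv cfxi.
by case: (i == j); rewrite ?normr1 ?normr0.
Qed.

End directions.

(** * Extension across balls *)

Section extension.
Context {R : realType} {d : nat}.
Variables (p : \bar R) (r : nat) (xis : 'I_d -> 'rV[R]_d) (e : R).
Hypotheses (p0 : (0 < p)%E) (r0 : (0 < r)%N) (gd : good_directions xis e).
Implicit Types (S T G : set 'rV[R]_d) (F : 'rV[R]_d -> R) (x y c w : 'rV[R]_d).
Implicit Types (u rho delta theta M : R).

(** One factor counts pairs (direction, sign), the other the r + 1 terms of an equation whose
    coefficients are at most 2^r. *)
Definition ext_const : R :=
  quasi_const p #|{: 'I_d * bool}| 1 * quasi_const p r.+1 (2 ^ r)%:R + 1.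

Definition ext_bound M : R := ext_const * (M + 1).

Lemma ext_const_ge1 : 1 <= ext_const.
Proof. by rewrite /ext_const lerDr mulr_ge0// quasi_const_ge0. Qed.

Lemma le_ext_bound M : 0 <= M -> M <= ext_bound M.
Proof.
move=> M0; apply: (@le_trans _ _ (M + 1)); first by rewrite lerDl.
by rewrite ler_peMl ?ext_const_ge1// addr_ge0.
Qed.

Lemma iter_ext_bound_ge0 k M : 0 <= M -> 0 <= iter k ext_bound M.
Proof. by move=> M0; elim: k => //= k IH; exact: le_trans (le_ext_bound IH). Qed.

Lemma iter_ext_bound_le k k' M : 0 <= M -> (k <= k')%N ->
  iter k ext_bound M <= iter k' ext_bound M.
Proof.
move=> M0 /subnK <-; elim: (k' - k)%N => //= j /le_trans; apply.
by rewrite le_ext_bound// iter_ext_bound_ge0.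
Qed.

Definition small_differences G F : Prop := [/\ measurable G, measurable_fun setT F &
  forall i u, small p (diff_domain r (u *: xis i) G) (fin_diff r (u *: xis i) F) 1].

(** The r-th difference is solved for F(x), whose coefficient is a sign; the other r values are
    taken in S. T is split according to the direction and sign that work. *)
Lemma small_extend G F S T u M : small_differences G F -> measurable S -> S `<=` G ->
  measurable T -> T `<=` G ->
  (forall x, T x -> exists i (b : bool), forall j : nat, (0 < j <= r)%N ->
    S (x + ((-1) ^+ b * u *+ j) *: xis i)) ->
  small p S F M -> small p T F (ext_bound M).
Proof.
move=> [mG mF hF] mS SG mT TG TS FM; have M0 := small_ge0 FM.
pose h (ib : 'I_d * bool) := ((-1) ^+ ib.2 * u) *: xis ib.1.
pose Tib (ib : 'I_d * bool) := T `&` [set x | forall j : nat, (0 < j <= r)%N -> S (x + h ib *+ j)].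
have mTib ib : measurable (Tib ib).
  apply: measurableI => //.
  rewrite (_ : [set x | _] =
      \bigcap_(j in [set j : nat | (0 < j <= r)%N]) (fun x => x + h ib *+ j) @^-1` S).
    apply: bigcap_measurable => [|j _]; first by exists 1%N; rewrite /= r0.
    by rewrite -[X in measurable X]setTI; exact: measurable_addl_rV.
  by [].
apply: (@small_le _ _ _ _ _ (quasi_const p #|{: 'I_d * bool}| 1 *
    (quasi_const p r.+1 (2 ^ r)%:R * (M + 1)))).
  by rewrite mulrA ler_wpM2r ?addr_ge0// /ext_const lerDl.
apply: (@small_cover _ _ _ _ _ (fun k => Tib (enum_val k))) => //.
- by rewrite mulr_ge0 ?quasi_const_ge0// addr_ge0.
- move=> x Tx; have [i [b hx]] := TS x Tx; exists (enum_rank (i, b)).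
  rewrite enum_rankK; split => // j jr; rewrite /h /= scalerMnl; exact: hx.
move=> k; set ib := enum_val k.
pose g (j : nat) := if j == 0%N then fin_diff r (h ib) F else fun x => F (x + h ib *+ j).
have mg j : measurable_fun setT (g j).
  by rewrite /g; case: ifP => _; [exact: measurable_fin_diff|exact: measurable_shift].
apply: (@small_dom _ _ _ _ _ _ _ (fun j => g j)) => //.
- by rewrite addr_ge0.
- move=> x [Tx hx].
  have /(congr1 (fun z => z - \sum_(j < r) (-1) ^+ (r + j.+1) * 'C(r, j.+1)%:R *
      F (x + h ib *+ j.+1))) : fin_diff r (h ib) F x = (-1) ^+ r * F x +
      \sum_(j < r) (-1) ^+ (r + j.+1) * 'C(r, j.+1)%:R * F (x + h ib *+ j.+1).
    by rewrite /fin_diff big_ord_recl/= addn0 bin0 mulr1 mulr0n addr0.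
  rewrite addrK => /esym Fx.
  have -> : `|F x| = `|(-1) ^+ r * F x| by rewrite normrM normrX normrN1 expr1n mul1r.
  rewrite Fx (le_trans (ler_normB _ _))// big_ord_recl mulrDr lerD//.
    by rewrite /g/= ler_peMl// ler1n expn_gt0.
  rewrite (le_trans (ler_norm_sum _ _ _))// mulr_sumr; apply: ler_sum => j _.
  rewrite !normrM normrX normrN1 expr1n mul1r normr_nat /g /= ler_wpM2r// ler_nat.
  have -> : (2 ^ r = \sum_(i < r.+1) 'C(r, i))%N.
    rewrite -[2%N]/(1 + 1)%N expnDn; apply: eq_bigr => i _.
    by rewrite !exp1n !muln1.
  by rewrite (bigD1 (lift ord0 j))//= leq_addr.
- move=> j; rewrite /g; case: ifPn => [_|j0].
    apply: (@small_le _ _ _ _ _ 1); first by rewrite lerDr.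
    apply: small_sub (hF ib.1 ((-1) ^+ ib.2 * u)) => //.
    + exact: measurable_diff_domain.
    + exact: measurable_fin_diff.
    move=> x [Tx hx] [_|j' j'r]; first by rewrite mulr0n addr0; exact: TG.
    by apply/SG/hx; rewrite j'r.
  apply: (@small_le _ _ _ _ _ M); first by rewrite lerDl.
  apply: (small_shift p0 mS) => // x [_ hx]; apply: hx.
  by rewrite lt0n j0/= -ltnS.
Qed.

(** Steps have length [ext_lam * rho], so r of them cover e rho / 2. The gain [ext_eta] satisfies (1
    + eta)^2 <= 1 + 3 eta = 1 + ext_lam e / 2, the decrease guaranteed by one inward step. *)
Definition ext_lam : R := e / (2 * r%:R).
Definition ext_eta : R := ext_lam * e / 6.

Lemma ext_lam_gt0 : 0 < ext_lam.
Proof.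
have /andP[e0 _] := gd_e gd.
by rewrite /ext_lam divr_gt0// mulr_gt0// ltr0n.
Qed.

Lemma ext_eta_gt0 : 0 < ext_eta.
Proof.
have /andP[e0 _] := gd_e gd.
by rewrite /ext_eta divr_gt0// mulr_gt0// ext_lam_gt0.
Qed.

Lemma ext_eta_le1 : ext_eta <= 1.
Proof.
have /andP[e0 e1] := gd_e gd; rewrite /ext_eta.
have l1 : ext_lam <= 1.
  have r1 : 1 <= r%:R :> R by rewrite ler1n.
  rewrite /ext_lam ler_pdivrMr ?mulr_gt0//; lra.
have := ext_lam_gt0; nra.
Qed.

(* With s xi.w <= - e |w|, a step t <= e |w| along s xi turns |w|^2 into at most *)
(* |w|^2 - t e |w|.                                                               *)
Lemma inward_direction w rho : 0 < rho -> enorm w <= (1 + ext_eta) * rho ->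
  exists i (b : bool), forall j : nat, (0 < j <= r)%N ->
    enorm (w + ((-1) ^+ b * (ext_lam * rho) *+ j) *: xis i) <= rho.
Proof.
move=> rho0 wr; have /andP[e0 e1] := gd_e gd; have l0 := ext_lam_gt0.
have r1 : 1 <= r%:R :> R by rewrite ler1n.
have rp : 0 < r%:R :> R by rewrite ltr0n.
have [i hi] := gd_dot gd w; exists i, (0 < dotp (xis i) w) => j /andP[j0 jr].
set b := 0 < _; set s : R := (-1) ^+ b.
have sdot : s * dotp (xis i) w <= - (e * enorm w).
  rewrite /s /b; case: ltP => h; rewrite ?expr1 ?expr0.
    by rewrite mulN1r lerN2 -(gtr0_norm h).
  by rewrite mul1r lerNr -(ler0_norm h).
pose t := ext_lam * rho *+ j.
have -> : s * (ext_lam * rho) *+ j = s * t by rewrite /t mulrnAr.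
have lr0 : 0 < ext_lam * rho by rewrite mulr_gt0.
have t1 : ext_lam * rho <= t by rewrite /t -mulr_natr ler_peMr ?(ltW lr0)// ler1n.
have t2 : t <= e * rho / 2.
  rewrite /t -mulr_natr (@le_trans _ _ (ext_lam * rho * r%:R))//.
    by rewrite ler_wpM2l ?(ltW lr0)// ler_nat.
  by rewrite /ext_lam le_eqVlt; apply/orP; left; apply/eqP; field; rewrite gt_eqF.
have t0 : 0 < t by exact: lt_le_trans t1.
have s2 : s * s = 1 by rewrite /s -expr2 sqrr_sign.
have W0 := enorm_ge0 w.
(* Near the centre r steps, of total length at most rho / 2, cannot leave the ball. *)
have [wsmall|wbig] := leP (enorm w) (rho / 2).
  rewrite (le_trans (enormD _ _))// enormZ (gd_unit gd) mulr1 normrM normrX normrN1.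
  rewrite expr1n mul1r gtr0_norm//; nra.
rewrite enorm_le ?(ltW rho0)// dotpDl !dotpDr !dotpZl !dotpZr (dotpC w).
rewrite -(enorm_sqr w) -(enorm_sqr (xis i)) (gd_unit gd) expr1n mulr1.
have -> : enorm w ^+ 2 + s * t * dotp (xis i) w + (s * t * dotp (xis i) w + s * t * (s * t)) =
    enorm w ^+ 2 + 2 * t * (s * dotp (xis i) w) + t ^+ 2.
  by rewrite -[s * t * (s * t)]mulrACA s2 mul1r; ring.
set W := enorm w in W0 wbig wr sdot *.
have h1 : 2 * t * (s * dotp (xis i) w) <= - (2 * t * (e * W)).
  by rewrite -mulrN ler_wpM2l// mulr_ge0// ltW.
have h2 : t ^+ 2 <= t * (e * W) by rewrite expr2 ler_wpM2l ?(ltW t0)//; nra.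
have h3 : ext_lam * rho * (e * (rho / 2)) <= t * (e * W).
  by apply: ler_pM => //; [exact: ltW|nra|nra].
have h4 : W ^+ 2 <= ((1 + ext_eta) * rho) ^+ 2.
  by rewrite ler_sqr// nnegrE// (le_trans W0).
have h5 : ((1 + ext_eta) * rho) ^+ 2 <= rho ^+ 2 + ext_lam * rho * (e * (rho / 2)).
  have -> : ext_lam * rho * (e * (rho / 2)) = 3 * ext_eta * rho ^+ 2 by rewrite /ext_eta; field.
  have -> : rho ^+ 2 + 3 * ext_eta * rho ^+ 2 = (1 + 3 * ext_eta) * rho ^+ 2 by ring.
  rewrite exprMn ler_wpM2r ?sqr_ge0//.
  have := ext_eta_le1; have := ext_eta_gt0; nra.
lra.
Qed.

Lemma small_ball_extend G F T y rho M : small_differences G F -> 0 < rho ->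
  eclosed_ball y rho `<=` G -> measurable T -> T `<=` G ->
  T `<=` eclosed_ball y ((1 + ext_eta) * rho) ->
  small p (eclosed_ball y rho) F M -> small p T F (ext_bound M).
Proof.
move=> hF rho0 BG mT TG TB FM.
apply: (small_extend (u := ext_lam * rho) hF _ BG mT TG _ FM).
  exact: measurable_eclosed_ball.
move=> x /TB xB; have [i [b hib]] := inward_direction rho0 xB.
by exists i, b => j jr; rewrite /eclosed_ball/= addrAC; exact: hib.
Qed.

Definition chain_length theta : nat := (Num.truncn (2 / (ext_eta * theta))).+1.

(** Centre and radius are interpolated linearly from the small ball to the large one in k steps. All
    balls stay inside the large one, and centre and radius together move by at most 2 delta / k <=
    eta theta delta, within the gain of one extension. *)
Lemma small_ball_chain G F y c theta delta M : small_differences G F -> 0 < delta ->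
  0 < theta <= 1 -> enorm (y - c) + theta * delta <= delta -> eclosed_ball c delta `<=` G ->
  small p (eclosed_ball y (theta * delta)) F M ->
  small p (eclosed_ball c delta) F (iter (chain_length theta) ext_bound M).
Proof.
move=> hF delta0 /andP[th0 th1] yc cG FM.
set k := chain_length theta; have eta0 := ext_eta_gt0.
have kp : 0 < k%:R :> R by rewrite ltr0n.
have kbig : 2 / (ext_eta * theta) <= k%:R.
  have z0 : 0 <= 2 / (ext_eta * theta) by rewrite divr_ge0// mulr_ge0// ltW.
  by have /andP[_ /ltW] := Num.Theory.truncn_itv z0.
have k2 : 2 / k%:R <= ext_eta * theta.
  by rewrite ler_pdivrMr// mulrC -ler_pdivrMr// mulr_gt0.
pose q (i : nat) : R := i%:R / k%:R.
pose yy i := y + q i *: (c - y).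
pose rr i := theta * delta + q i * (delta - theta * delta).
have td0 : 0 < theta * delta by rewrite mulr_gt0.
have td : 0 <= delta - theta * delta by rewrite subr_ge0 ler_piMl// ltW.
have q0 i : 0 <= q i by rewrite /q divr_ge0.
have qk : q k = 1 by rewrite /q divff// gt_eqF.
have q1 i : (i <= k)%N -> q i <= 1 by move=> ik; rewrite /q ler_pdivrMr// mul1r ler_nat.
have rr0 i : theta * delta <= rr i by rewrite /rr lerDl mulr_ge0.
have inside i : (i <= k)%N -> eclosed_ball (yy i) (rr i) `<=` eclosed_ball c delta.
  move=> ik x; rewrite /eclosed_ball/= => xr.
  have -> : x - c = (x - yy i) + (1 - q i) *: (y - c).
    by apply/rowP => z; rewrite /yy !mxE; ring.
  rewrite (le_trans (enormD _ _))// enormZ ger0_norm ?subr_ge0 ?q1//.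
  have := q0 i; have := q1 i ik; rewrite /rr in xr; have := enorm_ge0 (y - c); nra.
have step i : (i <= k)%N -> small p (eclosed_ball (yy i) (rr i)) F (iter i ext_bound M).
  elim: i => [_|i IH ik].
    by rewrite /yy /rr /q mul0r scale0r !mul0r !addr0.
  have iG : (i <= k)%N by exact: ltnW.
  apply: (small_ball_extend hF _ _ _ _ _ (IH iG)).
  - exact: lt_le_trans (rr0 i).
  - exact: subset_trans (inside _ iG) cG.
  - exact: measurable_eclosed_ball.
  - exact: subset_trans (inside _ ik) cG.
  move=> x; rewrite /eclosed_ball/= => xr.
  have qS : q i.+1 = q i + k%:R^-1 by rewrite /q -natr1 mulrDl mul1r.
  have -> : x - yy i = (x - yy i.+1) + k%:R^-1 *: (c - y).
    by apply/rowP => z; rewrite /yy qS !mxE; ring.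
  rewrite (le_trans (enormD _ _))// enormZ gtr0_norm ?invr_gt0// -[c - y]opprB enormN.
  have rS : rr i.+1 = rr i + k%:R^-1 * (delta - theta * delta) by rewrite /rr qS; ring.
  rewrite rS in xr.
  have kV : 0 < k%:R^-1 :> R by rewrite invr_gt0.
  have b1 : k%:R^-1 * enorm (y - c) <= k%:R^-1 * delta.
    by rewrite ler_wpM2l ?(ltW kV)//; lra.
  have b2 : k%:R^-1 * (delta - theta * delta) <= k%:R^-1 * delta.
    by rewrite ler_wpM2l ?(ltW kV)//; lra.
  have b3 : 2 * k%:R^-1 * delta <= ext_eta * (theta * delta).
    by rewrite mulrA ler_wpM2r// ltW.
  have b4 : ext_eta * (theta * delta) <= ext_eta * rr i by rewrite ler_wpM2l// ltW.
  lra.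
have := step k (leqnn k); rewrite /yy /rr qk scale1r addrC subrK mul1r addrC subrK.
by [].
Qed.

Definition jump_length : nat := (chain_length (ext_eta / 4)).+1.

(* The balls need not even intersect: the difference steps jump over the gap. *)
Lemma small_ball_jump G F c c' delta M : small_differences G F -> 0 < delta ->
  eclosed_ball c delta `<=` G -> eclosed_ball c' delta `<=` G ->
  enorm (c - c') <= (2 + ext_eta / 2) * delta ->
  small p (eclosed_ball c delta) F M ->
  small p (eclosed_ball c' delta) F (iter jump_length ext_bound M).
Proof.
move=> hF delta0 cG c'G cc FM; have eta0 := ext_eta_gt0; have eta1 := ext_eta_le1.
rewrite /jump_length iterSr.
(* It splits the segment so that the ball of radius eta delta / 4 at [y] fits both in the second
   ball and in the (1 + eta)-enlargement of the first. *)
pose s := (1 + 3 * ext_eta / 4) / (2 + ext_eta / 2).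
have den0 : 0 < 2 + ext_eta / 2 by lra.
have s0 : 0 <= s by rewrite /s divr_ge0//; lra.
have s1 : 1 - s = (1 - ext_eta / 4) / (2 + ext_eta / 2).
  by rewrite /s; field; rewrite gt_eqF//; lra.
have s1' : 0 <= 1 - s by rewrite s1 divr_ge0//; lra.
pose y := c + s *: (c' - c).
have yc : enorm (y - c) <= (1 + 3 * ext_eta / 4) * delta.
  rewrite /y addrAC subrr add0r enormZ ger0_norm// -[c' - c]opprB enormN.
  rewrite (@le_trans _ _ (s * ((2 + ext_eta / 2) * delta)))// ?ler_wpM2l//.
  by rewrite mulrA /s divfK// gt_eqF.
have yc' : enorm (y - c') <= (1 - ext_eta / 4) * delta.
  have -> : y - c' = (1 - s) *: (c - c').
    by apply/rowP => i; rewrite /y !mxE; ring.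
  rewrite enormZ ger0_norm//.
  rewrite (@le_trans _ _ ((1 - s) * ((2 + ext_eta / 2) * delta)))// ?ler_wpM2l//.
  by rewrite mulrA s1 divfK// gt_eqF.
have yB : eclosed_ball y (ext_eta / 4 * delta) `<=` eclosed_ball c' delta.
  move=> x; rewrite /eclosed_ball/= => xy.
  have -> : x - c' = (x - y) + (y - c') by rewrite addrA subrK.
  by rewrite (le_trans (enormD _ _))//; lra.
apply: (small_ball_chain (y := y) hF) => //; first by apply/andP; split; lra.
  lra.
apply: (small_ball_extend hF delta0 cG _ _ _ FM).
- exact: measurable_eclosed_ball.
- exact: subset_trans yB c'G.
move=> x; rewrite /eclosed_ball/= => xy.
have -> : x - c = (x - y) + (y - c) by rewrite addrA subrK.
by rewrite (le_trans (enormD _ _))//; lra.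
Qed.

End extension.

(** * Chains of balls in a connected domain *)

Section connected_domain.
Context {R : realType} {d : nat}.
Variables (p : \bar R) (r : nat) (xis : 'I_d -> 'rV[R]_d) (e L : R).
Hypotheses (p0 : (0 < p)%E) (r0 : (0 < r)%N) (d0 : (0 < d)%N) (gd : good_directions xis e).
Hypothesis (L0 : 0 < L).
Implicit Types (G : set 'rV[R]_d) (F : 'rV[R]_d -> R) (x y c : 'rV[R]_d).

Let eta := @ext_eta R r e.
(** In units of delta: centres in a common cell are within d * mesh = eta, and all of them lie in a
    cube of side 2 L about the initial centre, so [ncell] is independent of G. *)
Let mesh : R := eta / d%:R.
Let ncell : nat := Num.truncn (2 * L / mesh).
Let cells : finType := {ffun 'I_d -> 'I_ncell.+1}.
Let jl : nat := @jump_length R r e.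

Let eta0 : 0 < eta. Proof. by apply: (@ext_eta_gt0 _ _ _ xis). Qed.
Let eta1 : eta <= 1. Proof. by apply: (@ext_eta_le1 _ _ _ xis). Qed.
Let mesh0 : 0 < mesh. Proof. by rewrite /mesh divr_gt0// ltr0n. Qed.

(** A path through distinct cells costs two jumps per edge and one at the start; a last extension
    and a cover by at most one ball per cell follow. *)
Definition chain_const (M : R) : R := quasi_const p #|cells| 1 *
  @ext_bound R d p r (iter (jl * (#|cells|.*2.+1)) (@ext_bound R d p r) M).

Section fixed_domain.
Variables (G : set 'rV[R]_d) (F : 'rV[R]_d -> R) (c0 : 'rV[R]_d) (delta M : R).
Hypotheses (hF : small_differences p r xis G F) (delta0 : 0 < delta) (cG : connected G).
Hypothesis Gdiam : forall x y, G x -> G y -> enorm (x - y) <= L * delta.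
Hypothesis Gball : forall x, G x ->
  exists2 c, eclosed_ball c delta x & eclosed_ball c delta `<=` G.
Hypothesis c0G : eclosed_ball c0 delta `<=` G.
Hypothesis c0M : small p (eclosed_ball c0 delta) F M.

Let center c : Prop := eclosed_ball c delta `<=` G.

Let center_in c : center c -> G c.
Proof. by apply; rewrite /eclosed_ball/= subrr enorm0 ltW. Qed.

Let mu := mesh * delta.
Let mu0 : 0 < mu. Proof. by rewrite /mu mulr_gt0. Qed.

Let idx c (i : 'I_d) : R := (c ord0 i - c0 ord0 i + L * delta) / mu.

Let cell c : cells := [ffun i => inord (Num.truncn (idx c i))].

Let idx_bound c i : center c -> 0 <= idx c i <= 2 * L / mesh.
Proof.
move=> cc; have := le_trans (coord_le_enorm (c - c0) i) (Gdiam (center_in cc) (center_in c0G)).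
rewrite !mxE ler_norml => /andP[h1 h2]; rewrite /idx; apply/andP; split.
  by apply: divr_ge0; [lra|exact: ltW].
have -> : 2 * L / mesh = 2 * L * delta / mu by rewrite /mu; field; rewrite !gt_eqF.
rewrite ler_pM2r ?invr_gt0//; lra.
Qed.

Let cell_near c c' : center c -> center c' -> cell c = cell c' -> enorm (c - c') <= eta * delta.
Proof.
move=> cc cc' /ffunP cE; have -> : eta * delta = d%:R * mu.
  by rewrite /mu /mesh; field; rewrite pnatr_eq0 -lt0n.
apply: enorm_le_coord => i; rewrite !mxE.
have /andP[i1 i2] := idx_bound i cc; have /andP[i1' i2'] := idx_bound i cc'.
have tE : Num.truncn (idx c i) = Num.truncn (idx c' i).
  have := congr1 val (cE i); rewrite !ffunE /= !inordK// ltnS /ncell.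
    by rewrite Num.Theory.le_truncn.
  by rewrite Num.Theory.le_truncn.
have /andP[a1 a2] := Num.Theory.truncn_itv i1; have /andP[b1 b2] := Num.Theory.truncn_itv i1'.
rewrite -tE in b1 b2.
have -> : c ord0 i - c' ord0 i = (idx c i - idx c' i) * mu.
  by rewrite /idx; field; rewrite gt_eqF.
rewrite normrM (gtr0_norm mu0) ler_piMl ?(ltW mu0)// ler_norml.
move: a1 a2 b1 b2; rewrite -natr1; move: (idx c i) (idx c' i) (_%:R : R) => z z' t.
by move=> *; apply/andP; split; lra.
Qed.

Let linked c c' : Prop := enorm (c - c') <= (2 + eta / 2) * delta.

(** The graph lives on the finitely many cells rather than on the centres, which bounds the length
    of simple paths uniformly in G. *)
Let edge (a b : cells) : bool :=
  `[< exists c c', [/\ center c, center c', cell c = a, cell c' = b & linked c c'] >].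

Let edge_linked c c' : center c -> center c' -> linked c c' -> edge (cell c) (cell c').
Proof. by move=> cc cc' cl; apply/asboolP; exists c, c'. Qed.

Let linked_cell c c' : center c -> center c' -> cell c = cell c' -> linked c c'.
Proof.
move=> cc cc' /(cell_near cc cc')/le_trans; apply; rewrite ler_wpM2r ?(ltW delta0)//.
by move: eta0 eta1; lra.
Qed.

Let reached : set 'rV[R]_d := [set x | G x /\ exists c,
  [/\ center c, eclosed_ball c delta x & connect edge (cell c0) (cell c)]].

Let kappa : R := eta * delta / 2 / d%:R.
Let kappa0 : 0 < kappa.
Proof. by rewrite /kappa !divr_gt0// ?ltr0n// mulr_gt0. Qed.

(** The slack eta / 2 in [linked] absorbs |x - y|, uniformly in x. Hence [reached] and its
    complement are both relatively open in G. *)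
Let reached_near x y : G y -> reached x -> ball x kappa y -> reached y.
Proof.
move=> Gy [Gx [c [cc xc con]]] [_ xy]; split => //.
have [c' yc' cc'] := Gball Gy; exists c'; split => //.
apply: (connect_trans con); apply/connect1/edge_linked => //; rewrite /linked.
have xyk : enorm (x - y) <= eta * delta / 2.
  have -> : eta * delta / 2 = d%:R * kappa.
    by rewrite /kappa [RHS]mulrC divfK// pnatr_eq0 -lt0n.
  by apply: enorm_le_coord => i; rewrite !mxE; apply/ltW/xy.
have -> : c - c' = - (x - c) + ((x - y) + (y - c')).
  by apply/rowP => i; rewrite !mxE; ring.
rewrite /eclosed_ball/= in xc yc'.
rewrite (le_trans (enormD _ _))// enormN (le_trans (lerD xc (enormD _ _)))//.
lra.
Qed.

Let all_reached c : center c -> connect edge (cell c0) (cell c).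
Proof.
move=> cc.
have RG : reached = G.
  apply: cG.
  - exists c0; split; first exact: center_in.
    exists c0; split => //; rewrite /eclosed_ball/= subrr enorm0; exact: ltW.
  - exists (\bigcup_(x in reached) ball x kappa).
      by apply: bigcup_open => x _; exact: ball_open.
    apply/seteqP; split => [x Rx|y [Gy [x Rx xy]]]; last exact: reached_near Rx xy.
    by split; [case: Rx|exists x => //; exact: ballxx].
  - exists (~` \bigcup_(x in G `\` reached) ball x kappa).
      by apply: open_closedC; apply: bigcup_open => x _; exact: ball_open.
    apply/seteqP; split => [y Ry|x [Gx nx]].
      split; first by case: Ry.
      by move=> [x [Gx nRx] xy]; apply: nRx; apply: (reached_near Gx Ry); exact: ball_sym.
    apply: contrapT => nRx; apply: nx; exists x => //; exact: ballxx.
have := center_in cc; rewrite -RG => -[_ [c' [cc' cb con]]].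
apply: (connect_trans con); apply/connect1/edge_linked => //; rewrite /linked.
rewrite -opprB enormN; apply: (le_trans cb).
by rewrite ler_peMl ?(ltW delta0)//; move: eta0; lra.
Qed.

Let reachable_bound (n : nat) : R := iter (jl * n.*2.+1) (@ext_bound R d p r) M.

Let jump c c' M' : center c -> center c' -> linked c c' ->
  small p (eclosed_ball c delta) F M' ->
  small p (eclosed_ball c' delta) F (iter jl (@ext_bound R d p r) M').
Proof. by move=> cc cc' cl; exact: (small_ball_jump p0 r0 gd hF delta0 cc cc' cl). Qed.

Let small_path (s : seq cells) c : path edge (cell c0) s -> center c ->
  cell c = last (cell c0) s -> small p (eclosed_ball c delta) F (reachable_bound (size s)).
Proof.
elim/last_ind: s c => [|s b IH] c.
  move=> _ cc cE; rewrite /reachable_bound muln1; apply: (jump c0G) => //.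
  by apply: linked_cell.
rewrite rcons_path last_rcons size_rcons => /andP[ps /asboolP[c1 [c2 [cc1 cc2 E1 E2 c12]]]] cc cE.
(* Two jumps per edge: across it from [c1] to [c2], then inside the new cell from [c2] to [c]. *)
rewrite /reachable_bound doubleS (_ : jl * _ = jl + (jl + jl * (size s).*2.+1))%N; last lia.
rewrite !iterD; apply: (jump cc2) => //; first by apply: linked_cell => //; rewrite cE.
by apply: (jump cc1) => //; exact: IH.
Qed.

Let small_center c : center c -> small p (eclosed_ball c delta) F (reachable_bound #|cells|).
Proof.
move=> cc; have /connectP[s ps cE] := all_reached cc.
move: cE; case/shortenP: ps => s' ps' us' _ cE.
have M0 := small_ge0 c0M.
apply: small_le (small_path ps' cc cE).
apply: iter_ext_bound_le => //; rewrite leq_mul2l ltnS leq_double; apply/orP; right.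
by have := max_card (mem (cell c0 :: s')); rewrite (card_uniqP us') /= => /ltnW.
Qed.

(** Each point is within delta of a centre, itself within eta delta of the representative of its
    cell; so the enlarged balls about the representatives cover G. *)
Lemma small_connected : small p G F (chain_const M).
Proof.
have [mG mF _] := hF.
have M0 := small_ge0 c0M.
(* Cells without a centre get the default representative [c0]. *)
have /choice[rep repP] : forall a : cells, exists c, center c /\
    ((exists c', center c' /\ cell c' = a) -> cell c = a).
  move=> a; have [[c [cc ca]]|na] := pselect (exists c', center c' /\ cell c' = a).
    by exists c.
  by exists c0.
pose B (k : 'I_#|cells|) := G `&` eclosed_ball (rep (enum_val k)) ((1 + eta) * delta).
have mB k : measurable (B k) by apply: measurableI => //; exact: measurable_eclosed_ball.
apply: (@small_cover _ _ _ _ _ B) => //.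
- have I0 := iter_ext_bound_ge0 (d := d) p r (jl * (#|cells|.*2.+1)) M0.
  exact: le_trans I0 (le_ext_bound p r I0).
- move=> x Gx; have [c xc cc] := Gball Gx; exists (enum_rank (cell c)); split => //.
  rewrite enum_rankK; have [crep /(_ (ex_intro _ c (conj cc erefl))) repE] := repP (cell c).
  have := cell_near cc crep (esym repE); rewrite /eclosed_ball/= in xc *.
  have -> : x - rep (cell c) = (x - c) + (c - rep (cell c)) by rewrite addrA subrK.
  move=> h; rewrite (le_trans (enormD _ _))//; lra.
- move=> k; have [crep _] := repP (enum_val k).
  apply: (small_ball_extend p0 r0 gd hF delta0 crep (mB k) _ _ (small_center crep)).
    by move=> x [].
  by move=> x [].
Qed.

End fixed_domain.
End connected_domain.

(** * The L^p quasi-norm *)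

Section lp_norm_small.
Context {R : realType} {d : nat}.
Implicit Types (p : \bar R) (f g Q : 'rV[R]_d -> R) (A G : set 'rV[R]_d) (c : R).

Lemma lp_norm_Phi (q : R) A g :
  lp_norm q%:E A g = ((Phi q%:E (g \_ A)) `^ q^-1)%E.
Proof.
rewrite /lp_norm Lnorm.unlock; congr poweR; apply: eq_integral => x _.
by rewrite restrict_EFin.
Qed.

Lemma lp_norm_infty A g c : 0 <= c -> (lp_norm +oo A g <= c%:E)%E <-> small +oo A g c.
Proof.
move=> c0; split => h.
  apply: ge_ereal_sup => _ [x _ <-]; have [Ax|Ax] := pselect (A x).
    rewrite patch_in//; apply: le_trans h; apply: ereal_sup_ubound; right; by exists x.
  by rewrite patch_notin// normr0 lee_fin.
apply: ge_ereal_sup => _ [->|[x Ax <-]]; first by rewrite lee_fin.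
apply: le_trans h; apply: ereal_sup_ubound; exists x => //.
by rewrite patch_in.
Qed.

Lemma small_of_lp_norm p A g : (0 < p)%E -> (lp_norm p A g <= 1)%E -> small p A g 1.
Proof.
case: p => [q| |]// q0; last by move/(lp_norm_infty _ _ ler01).
have {}q0 : 0 < q by [].
rewrite lp_norm_Phi => h; rewrite /small.
have -> : Phi q%:E (g \_ A) = ((Phi q%:E (g \_ A) `^ q^-1) `^ q)%E.
  by rewrite -poweRrM mulVf ?gt_eqF// poweRe1// Phi_ge0.
rewrite -[1%:E](poweR1r q); apply: gt0_ler_poweR => //; first exact: ltW.
  by rewrite in_itv/= poweR_ge0 leey.
by rewrite in_itv/= lee_fin ler01 leey.
Qed.

Definition lp_const p c : R := if p is q%:E then c `^ q^-1 else c.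

Lemma lp_norm_of_small p A g c : (0 < p)%E -> small p A g c ->
  (lp_norm p A g <= (lp_const p c)%:E)%E.
Proof.
move=> p0 sg; have c0 := small_ge0 sg; case: p p0 sg => [q| |]// q0 sg; last exact/lp_norm_infty.
have {}q0 : 0 < q by [].
rewrite lp_norm_Phi /lp_const -poweR_EFin; apply: gt0_ler_poweR => //.
- by rewrite invr_ge0 ltW.
- by rewrite in_itv; apply/andP; split; [exact: Phi_ge0|exact: leey].
- by rewrite in_itv/= lee_fin c0 leey.
Qed.

Lemma small_of_lp_norm_fin (q : R) A g : 0 < q -> (lp_norm q%:E A g < +oo)%E ->
  exists M, small q%:E A g M.
Proof.
move=> q0; rewrite lp_norm_Phi => /(poweR_lty q).
rewrite -poweRrM mulVf ?gt_eqF// poweRe1 ?Phi_ge0// => h.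
by exists (fine (Phi q%:E (g \_ A))); rewrite /small fineK// ge0_fin_numE ?Phi_ge0.
Qed.

Lemma in_Lp_measurable p G f : compact G -> in_Lp p G f -> measurable_fun G f.
Proof.
move=> cG; have clG : closed G by apply: compact_closed => //; exact: norm_hausdorff.
case: p => [q [] //| |[] //]; rewrite /in_Lp -(closure_id G).1// => cf.
by apply: continuous_within_measurable_rV => //; exact: closed_measurable_rV.
Qed.

Lemma in_Lp_finite p G f : (0 < p)%E -> compact G -> in_Lp p G f -> exists M, small p G f M.
Proof.
move=> p0 cG; have clG : closed G by apply: compact_closed => //; exact: norm_hausdorff.
case: p p0 => [q q0 [_ h]| _|//]; first exact: small_of_lp_norm_fin h.
rewrite /in_Lp -(closure_id G).1// => cf.
have /compact_bounded[M [_ HM]] := continuous_compact cf cG.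
exists (`|M| + 1); apply/lp_norm_infty; first by rewrite addr_ge0.
apply: ge_ereal_sup => _ [->|[x Gx <-]]; first by rewrite lee_fin addr_ge0.
rewrite lee_fin; apply: (HM (`|M| + 1)); last by exists x.
by rewrite (le_lt_trans (ler_norm _))// ltrDl.
Qed.

Lemma small_set0 p g : (0 < p)%E -> measurable_fun setT g -> small p set0 g 1.
Proof.
move=> p0 mg; apply: (@small_le _ _ _ _ _ (quasi_const p 0 1 * 0)); first by rewrite mulr0.
by apply: (@small_dom _ _ _ _ _ _ _ (fun _ => g)) => //; case.
Qed.

(** The modulus only controls |u| <= diam G; for longer steps no two consecutive nodes fit in G and
    the domain is empty. *)
Lemma small_fin_diff p r E G f (xi : 'rV[R]_d) u : (0 < p)%E -> (0 < r)%N -> compact G ->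
  in_Lp p G f -> E `<=` unit_sphere -> E xi -> (dirs_modulus r E f G p <= 1)%E ->
  small p (diff_domain r (u *: xi) G) (fin_diff r (u *: xi) (f \_ G)) 1.
Proof.
move=> p0 r0 cG fL Eu Exi h.
have clG : closed G by apply: compact_closed => //; exact: norm_hausdorff.
have mG := closed_measurable_rV clG.
have mf : measurable_fun setT (f \_ G).
  by apply/(measurable_restrictT f mG); exact: in_Lp_measurable fL.
have [ud|ud] := leP `|u| (diam G); last first.
  rewrite (_ : diff_domain _ _ _ = set0).
    by apply: small_set0 => //; exact: measurable_fin_diff.
  apply/seteqP; split => // x /= hx.
  have := compact_diam cG (hx 1%N r0) (hx 0%N (leq0n r)).
  rewrite mulr0n addr0 mulr1n addrAC subrr add0r enormZ (Eu _ Exi) mulr1.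
  by rewrite leNgt ud.
apply: (@small_eq _ _ _ _ (fin_diff r (u *: xi) f)).
  move=> x hx; rewrite /fin_diff; apply: eq_bigr => j _; rewrite patch_in//; apply: hx.
  by rewrite -ltnS.
apply: small_of_lp_norm => //; apply: le_trans h.
apply: (@le_trans _ _ (dir_modulus r xi f (diam G) p G)).
  by apply: ereal_sup_ubound; exists u.
by apply: ereal_sup_ubound; exists xi.
Qed.

Lemma fin_diff_poly0 r (h : 'rV[R]_d) f Q x (P : {poly R}) : (size P <= r)%N ->
  (forall t, Q (x + t *: h) = P.[t]) ->
  fin_diff r h (fun y => f y - Q y) x = fin_diff r h f x.
Proof.
move=> sP QP; rewrite /fin_diff.
under eq_bigr do rewrite mulrBr.
rewrite sumrB -[RHS]subr0; congr (_ - _).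
rewrite -[RHS](sum_binomial_poly0 sP); apply: eq_bigr => j _.
by rewrite -QP scaler_nat.
Qed.

Lemma enorm_lipschitz_continuous (g : 'rV[R]_d -> R) K : 0 < K ->
  (forall x y, `|g x - g y| <= K * enorm (x - y)) -> continuous g.
Proof.
move=> K0 gK x A /nbhs_ballP[eps /= eps0 epsA]; apply/nbhs_ballP.
have den0 : 0 < K * (d%:R + 1) by rewrite mulr_gt0// ltr_wpDl.
exists (eps / (K * (d%:R + 1))) => /=; first by rewrite divr_gt0.
move=> y [_ xy]; apply: epsA; rewrite /ball/= (le_lt_trans (gK _ _))//.
have : enorm (x - y) <= d%:R * (eps / (K * (d%:R + 1))).
  by apply: enorm_le_coord => i; rewrite !mxE; apply/ltW/xy.
rewrite -(ler_pM2l K0) => /le_lt_trans; apply.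
rewrite !mulrA ltr_pdivrMr// (mulrC eps) ltr_pM2r// ltr_pM2l//.
by rewrite ltrDl.
Qed.

End lp_norm_small.

(** * The directional Whitney constant *)

Section parallelepiped.
Context {R : realType} {d : nat}.
Variables (xis : 'I_d -> 'rV[R]_d) (cf : 'I_d -> 'rV[R]_d -> R) (e : R).
Hypotheses (d0 : (0 < d)%N) (gd : good_directions xis e) (cs : coord_system xis cf e).
Variables (c0 : 'rV[R]_d) (rho : R).
Hypothesis rho0 : 0 < rho.

(** Rescaling turns the parallelepiped with centre [c0] and half-edges rho xi_i into the unit box of
    [tensor_whitney]. *)
Definition scaled_dir i := rho *: xis i.
Definition scaled_coord i x := cf i (x - c0) / rho.

Let e0 : 0 < e. Proof. by have /andP[] := gd_e gd. Qed.

Lemma scaled_dir_coords : dir_coords scaled_dir scaled_coord.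
Proof.
have cfB i x y : cf i (x - y) = cf i x - cf i y.
  by rewrite -scaleN1r (cs_add cs) mulN1r.
split.
- move=> i; apply: (@enorm_lipschitz_continuous _ _ _ (e * rho)^-1).
    by rewrite invr_gt0 mulr_gt0.
  move=> x y; rewrite /scaled_coord -mulrBl !cfB.
  have -> : cf i x - cf i c0 - (cf i y - cf i c0) = cf i (x - y) by rewrite cfB; ring.
  rewrite normrM normfV (gtr0_norm rho0) invfM mulrAC ler_wpM2r ?invr_ge0 ?(ltW rho0)//.
  by rewrite mulrC; exact: (cs_le cs).
- move=> i j x t; rewrite /scaled_coord /scaled_dir addrAC scalerA (cs_add cs) (cs_xi cs).
  by case: eqP => _ /=; rewrite mulrDl ?mulr0 ?mul0r// mulr1 mulfK// gt_eqF.
- move=> x; exists (fun i => cf i x / rho); rewrite {1}(cs_span cs x).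
  by apply: eq_bigr => i _; rewrite /scaled_dir scalerA divfK// gt_eqF.
Qed.

Lemma cbox_sub_ball : cbox scaled_coord 1 `<=` eclosed_ball c0 (d%:R * rho).
Proof.
move=> x hx; rewrite /eclosed_ball/= {1}(cs_span cs (x - c0)).
rewrite (le_trans (enorm_sum _ _))// mulr_natl -[X in _ *+ X](card_ord d) -sumr_const.
apply: ler_sum => i _; rewrite enormZ (gd_unit gd) mulr1.
have := hx i; rewrite /scaled_coord normrM normfV (gtr0_norm rho0).
by rewrite ler_pdivrMr// mul1r.
Qed.

Lemma ball_sub_cbox sigma : eclosed_ball c0 (sigma * e * rho) `<=` cbox scaled_coord sigma.
Proof.
move=> x; rewrite /eclosed_ball/= => hx i.
rewrite /scaled_coord normrM normfV (gtr0_norm rho0) ler_pdivrMr//.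
rewrite (le_trans (cs_le cs _ _))// ler_pdivrMr// (le_trans hx)//.
by rewrite mulrAC.
Qed.

End parallelepiped.

Theorem theorem5p2 (R : realType) (d r : nat) (p : \bar R) (L eps0 : R)
    (d_gt0 : (0 < d)%N) (r_gt0 : (0 < r)%N) (p_gt0 : (0 < p)%E)
    (L_gt1 : 1 < L) (eps0_gt0 : 0 < eps0) :
  exists C : R, forall E G : set 'rV[R]_d,
    independent_directions E -> eps0 <= minmax_dotp E ->
    lip2_domain L G -> connected G ->
    (whitney_const r G E p <= C%:E)%E.
Proof.
pose e := Num.min (eps0 / 2) 1.
have [sigma /andP[sig0 sig1] [C0 C00 HC0]] := tensor_whitney (R := R) r p_gt0 (leqnn d).
(* With rho = delta / d, the ball of radius theta delta = sigma e rho about [c0] lies in the box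
   where [tensor_whitney] gives an estimate. *)
pose theta := sigma * e / d%:R.
pose K0 := iter (chain_length r e theta) (@ext_bound R d p r) C0.
have L0 : 0 < L by exact: lt_trans L_gt1.
exists (lp_const p (@chain_const R d p r e L K0)) => E G indE hE.
move=> [[x0 Gx0] cG [delta delta0 [diamG ballG]]] conG.
have [xis [EE gd [cf cs]]] := directions_of d_gt0 eps0_gt0 indE hE.
rewrite -/e in gd cs; have /andP[e0 e1] := gd_e gd.
have clG : closed G by apply: compact_closed => //; exact: norm_hausdorff.
have mG := closed_measurable_rV clG.
have dR0 : 0 < d%:R :> R by rewrite ltr0n.
have [c0 _ c0G] := ballG x0 Gx0.
pose rho := delta / d%:R; have rho0 : 0 < rho by rewrite divr_gt0.
have drho : d%:R * rho = delta by rewrite mulrC divfK// gt_eqF.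
have dc := scaled_dir_coords gd cs c0 rho0.
set xs := scaled_dir xis rho in dc; set ls := scaled_coord cf c0 rho in dc.
have boxG : cbox ls 1 `<=` G.
  by apply: subset_trans c0G; rewrite -drho; exact: (cbox_sub_ball gd cs rho0).
have mbox z : measurable (cbox ls z) by exact: (measurable_cbox _ (dc_cont dc)).
have theta01 : 0 < theta <= 1.
  rewrite /theta divr_gt0 ?mulr_gt0//= ler_pdivrMr// mul1r.
  have se1 : sigma * e <= 1 by rewrite mulr_ile1// ltW.
  by rewrite (le_trans se1)// ler1n.
apply: ge_ereal_sup => _ [f [fL fmod] <-].
(* The zero extension is measurable on the whole space and has the same differences wherever all
   nodes lie in G. *)
pose f0 := f \_ G.
have mf0 : measurable_fun setT f0.
  by apply/(measurable_restrictT f mG); exact: in_Lp_measurable fL.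
have f0diff i u : small p (diff_domain r (u *: xis i) G) (fin_diff r (u *: xis i) f0) 1.
  apply: (small_fin_diff (E := E)) => //; first by case: indE.
  by rewrite EE; exists i.
have [M0 fM0] := in_Lp_finite p_gt0 cG fL.
have [Q [mQ sQ] fQ] : exists2 q, sepm xs r d q & small p (cbox ls sigma) (fun x => f0 x - q x) C0.
  apply: HC0 => //.
    exists M0; apply: (small_sub p_gt0 mG) => //.
    by apply: small_eq fM0 => x Gx; rewrite /f0 patch_in.
  move=> i u; rewrite /xs /scaled_dir scalerA; apply: small_sub (f0diff i (u * rho)) => //.
  - exact: measurable_diff_domain.
  - exact: measurable_diff_domain.
  - exact: measurable_fin_diff.
  - by move=> x hx j jr; apply: boxG; exact: hx.
have [cQ lQ] := sep_dir_poly dc sQ.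
have lineQ x i : exists2 P : {poly R}, (size P <= r)%N & forall t, Q (x + t *: xis i) = P.[t].
  have [P sP PE] := lQ x i (ltn_ord i); exists (P \Po (rho^-1 *: 'X)).
    have [->|P0] := eqVneq P 0; first by rewrite comp_poly0 size_poly0.
    rewrite (leq_trans (size_comp_poly_leq _ _))// size_scale ?invr_eq0 ?gt_eqF//.
    by rewrite size_polyX muln1 prednK// size_poly_gt0.
  move=> t; rewrite horner_comp hornerZ hornerX -PE /xs /scaled_dir scalerA.
  by rewrite mulrC mulrA divff ?mul1r// gt_eqF.
have Qdir : dir_poly r E Q.
  by split => // x xi; rewrite EE => -[i _ <-]; exact: lineQ.
pose F x := f0 x - Q x.
have hF : small_differences p r xis G F.
  split => //; first exact: measurable_funB.
  move=> i u; apply: small_eq (f0diff i u) => x _.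
  have [P sP PE] := lineQ x i; rewrite /F.
  rewrite (@fin_diff_poly0 _ _ _ _ f0 Q x (P \Po (u *: 'X)))//.
    have [->|P0] := eqVneq P 0; first by rewrite comp_poly0 size_poly0.
    rewrite (leq_trans (size_comp_poly_leq _ _))//.
    (* As u may be 0, the size of the inner polynomial is only bounded above. *)
    have : (size (u *: 'X : {poly R}) <= 2)%N.
      by rewrite (leq_trans (size_scale_leq _ _))// size_polyX.
    move=> su; apply: leq_trans sP; rewrite -size_poly_gt0 in P0.
    rewrite -[leqRHS](prednK P0) ltnS -[leqRHS]muln1 leq_mul2l; apply/orP; right.
    by case: (size _) su.
  by move=> t; rewrite horner_comp hornerZ hornerX scalerA PE mulrC.
have c0M : small p (eclosed_ball c0 delta) F K0.
  apply: (small_ball_chain (y := c0) p_gt0 r_gt0 gd hF delta0 theta01) => //.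
    by rewrite subrr enorm0 add0r ler_piMl ?(ltW delta0)//; case/andP: theta01.
  apply: small_sub fQ => //; [exact: measurable_eclosed_ball|exact: measurable_funB|].
  have -> : theta * delta = sigma * e * rho by rewrite /theta /rho; field; exact: lt0r_neq0.
  exact: (ball_sub_cbox gd cs rho0).
have GF : small p G F (@chain_const R d p r e L K0).
  apply: (small_connected (c0 := c0) p_gt0 r_gt0 d_gt0 gd L0 hF delta0 conG) => //.
  by move=> x y Gx Gy; exact: le_trans (compact_diam cG Gx Gy) diamG.
apply: (@le_trans _ _ (lp_norm p G (f \- Q))).
  by apply: ereal_inf_lbound; exists Q.
apply: lp_norm_of_small => //; apply: small_eq GF => x Gx.
by rewrite /F /f0 patch_in.
Qed.
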